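(* Let $\mathbb{K}$ be a field of characteristic zero. Every strict $1$-dimensional topological quantum field theory $F:1Cob\rightarrow Mat_{\mathbb{K}}$ such that $F(+)=p\geq 2$ is faithful; i.e. for all objects $a,b$ of $1Cob$ and all morphisms $K,L:a\to b$ of $1Cob$, $F(K)=F(L)$ implies $K=L$.
   Context: **The category $1Cob$.** Objects are closed oriented $0$-manifolds presented as pairs $(n,\varepsilon)$, where $n=\{0,\ldots,n-1\}$ is a natural number and $\varepsilon:n\to\{-1,1\}$; equivalently, finite (possibly empty) words $a_1\ldots a_n$ in the letters $+,-$. The empty word is denoted $\emptyset$. A $1$-cobordism from $(n,\varepsilon_0)$ to $(m,\varepsilon_1)$ is a triple $(M,f_0:(n,\varepsilon_0)\to M,f_1:(m,\varepsilon_1)\to M)$, where $M$ is a compact oriented $1$-dimensional manifold whose boundary is a disjoint union $\partial M=\Sigma_0\sqcup\Sigma_1$, $f_0$ is an orientation preserving embedding with image $\Sigma_0$ (ingoing boundary), and $f_1$ is an orientation reversing embedding with image $\Sigma_1$ (outgoing boundary). The boundary convention is that the initial point of an oriented interval has sign $+$ and its terminal point has sign $-$ as points of $\partial M$; thus $[0,1]$ with its standard orientation gives cobordisms $+\to+$ (with $0$ ingoing), $-\to-$ (with $1$ ingoing), $+-\to\emptyset$ and $\emptyset\to-+$. Cobordisms $(M,f_0,f_1)$ and $(M',f_0',f_1')$ are equivalent if there is an orientation preserving homeomorphism $\Phi:M\to M'$ with $\Phi f_0=f_0'$ and $\Phi f_1=f_1'$. Morphisms of $1Cob$ are equivalence classes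 of $1$-cobordisms; composition is gluing along the common boundary; identities are cylinders. $1Cob$ is strict monoidal: the tensor product is concatenation of words on objects and ''putting side by side'' (disjoint union) on morphisms, with unit $\emptyset$. It is symmetric via the cobordisms $\tau_{a,b}:ab\to ba$ ($a$ of length $n$, $b$ of length $m$) consisting of intervals joining the ingoing point $i$ to the outgoing point $m+i$ ($0\le i<n$) and the ingoing point $n+j$ to the outgoing point $j$ ($0\le j<m$). **The category $Mat_{\mathbb{K}}$.** Objects are natural numbers; morphisms $n\to m$ are the $m\times n$ matrices over $\mathbb{K}$; composition is matrix multiplication. It is symmetric strict monoidal with multiplication on objects, Kronecker product on morphisms, unit $1$, and symmetry the $mn\times nm$ commutation matrices $S_{n,m}$, where $S_{n,m}$ represents the linear map $\mathbb{K}^n\otimes\mathbb{K}^m\to\mathbb{K}^m\otimes\mathbb{K}^n$, $e_i\otimes f_j\mapsto f_j\otimes e_i$, in the standard (lexicographically ordered) bases. **Strict $1$-dimensional topological quantum field theory (strict $1$-TQFT):** a strict symmetric monoidal functor $F:1Cob\to Mat_{\mathbb{K}}$; so $F(\emptyset)=1$, $F(ab)=F(a)F(b)$, $F(K\otimes L)=F(K)\otimes F(L)$ and $F(\tau_{a,b})=S_{F(a),F(b)}$. *)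

(* Defs.v *)
From HB Require Import structures.
From mathcomp Require Import all_boot all_order all_algebra.
From mathcomp Require Import all_classical all_reals all_analysis.
From mathcomp Require Import mxtens.
From mathcomp Require Import ring lra.

Set Implicit Arguments.
Unset Strict Implicit.
Unset Printing Implicit Defensive.

Import Order.TTheory GRing.Theory Num.Theory.
Import numFieldNormedType.Exports.

Local Open Scope classical_set_scope.
Local Open Scope ring_scope.

Section Manifolds.
Context {R : realType}.

Record chart (M : topologicalType) := Chart { cdom : set M; cmap : M -> R }.

(* The model space is [0, 1]: the chart [c] restricts to a homeomorphism from
   the open set [cdom c] onto an open subset of [0, 1]; the values of [cmap c]
   outside [cdom c] are irrelevant.  Half-lines of one direction only would not
   do as a model: an oriented interval has boundary points of both signs. *)
Definition is_chart (M : topologicalType) (c : chart M) : Prop :=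
  [/\ open (cdom c),
      set_inj (cdom c) (cmap c),
      {within cdom c, continuous (cmap c)} &
      forall U, open U -> U `<=` cdom c ->
        exists2 V : set R, open V & cmap c @` U = V `&` `[0, 1]].

Definition increasing_at (M N : topologicalType) (Phi : M -> N)
    (c : chart M) (d : chart N) (x : M) : Prop :=
  exists2 W, nbhs x W & forall y z, W y -> W z ->
    cmap c y < cmap c z -> cmap d (Phi y) < cmap d (Phi z).

(* Compact oriented topological 1-manifolds with (possibly empty) boundary.
   The atlas need not be maximal: two atlases on the same space define the same
   orientation when the identity is an oriented homeomorphism in the sense
   below.  Second countability follows from compactness. *)
Record manifold := Manifold {
  carrier :> topologicalType;
  atlas : set (chart carrier);
  manifold_hausdorff : hausdorff_space carrier;
  manifold_compact : compact [set: carrier];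
  atlas_chart : forall c, atlas c -> is_chart c;
  atlas_cover : forall x : carrier, exists2 c, atlas c & cdom c x;
  atlas_oriented : forall c d x, atlas c -> atlas d ->
    cdom c x -> cdom d x -> increasing_at id c d x }.

(* Signs are booleans, [true] being +1 and [false] being -1.  Initial points of
   oriented intervals (value 0 in a chart) are the positive boundary points, and
   terminal points (value 1) the negative ones. *)
Definition boundary (M : manifold) (s : bool) (x : M) : Prop :=
  exists2 c, atlas c & cdom c x /\ cmap c x = (if s then 0 else 1).

Definition oriented_homeo (M N : manifold) (Phi : M -> N) : Prop :=
  [/\ continuous Phi,
      (exists Psi : N -> M,
         [/\ cancel Phi Psi, cancel Psi Phi & continuous Psi]) &
      forall (c : chart M) (d : chart N) x, atlas c -> atlas d ->
        cdom c x -> cdom d (Phi x) -> increasing_at Phi c d x].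

(* [chart_at u x]: near [x], [u] behaves like a chart. *)
Definition chart_at (M : topologicalType) (u : M -> R) (x : M) : Prop :=
  [/\ {for x, continuous u}, 0 <= u x <= 1 &
      forall W, nbhs x W -> exists2 e : R, 0 < e & forall t : R,
        0 <= t <= 1 -> `|t - u x| < e -> exists2 y, W y & u y = t].

Lemma is_chartP (M : topologicalType) (c : chart M) :
  is_chart c <-> [/\ open (cdom c), set_inj (cdom c) (cmap c) &
                   forall x, cdom c x -> chart_at (cmap c) x].
Proof.
split=> [[oD iD cD oI]|[oD iD lD]].
  split=> // x Dx.
  have nD : nbhs x (cdom c) by exact: open_nbhs_nbhs.
  have [V oV IV] := oI _ oD (@subset_refl _ _).
  have : (V `&` `[0, 1]) (cmap c x) by rewrite -IV; exists x.
  case=> _ /=; rewrite in_itv /= => x01.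
  split=> //.
    have := cD; rewrite continuous_open_subspace // => /(_ x); apply.
    by rewrite inE.
  move=> W nW.
  have [U [oU Ux] UW] : exists2 U, open U /\ U x & U `<=` W `&` cdom c.
    have : nbhs x (W `&` cdom c) by exact: filterI.
    rewrite nbhsE /= => -[U oU sU].
    by exists U.
  have [V' oV' IV'] := oI U oU (fun y Uy => (UW y Uy).2).
  have V'x : V' (cmap c x).
    have : (V' `&` `[0, 1]) (cmap c x) by rewrite -IV'; exists x.
    by case.
  have /nbhs_ballP[e /= e0 be] : nbhs (cmap c x) V' by exact: open_nbhs_nbhs.
  exists e => // t t01 te.
  have : (V' `&` `[0, 1]) t.
    split; last by rewrite /= in_itv.
    by apply: be; rewrite /ball /= distrC.
  by rewrite -IV' => -[y Uy <-]; exists y => //; exact: (UW y Uy).1.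
split=> //.
  rewrite continuous_open_subspace // => x; rewrite inE => Dx.
  by have [] := lD x Dx.
move=> U oU UD.
exists [set t : R | exists2 e : R, 0 < e & ball t e `&` `[0, 1] `<=` cmap c @` U].
  rewrite openE => t [e e0 be]; apply/nbhs_ballP; exists (e / 2) => /=.
    by rewrite divr_gt0.
  move=> t' tt'; exists (e / 2); first by rewrite divr_gt0.
  move=> r [tr r01]; apply: be; split => //.
  by rewrite (splitr e); exact: ball_triangle tt' tr.
rewrite eqEsubset; split=> [_ [x Ux <-]|t [[e e0 be] t01]].
  have [_ x01 xo] := lD x (UD _ Ux).
  split; last by rewrite /= in_itv.
  have [e e0 he] := xo U (open_nbhs_nbhs (conj oU Ux)).
  exists e => // r; rewrite /ball /= in_itv /= => -[xr r01].
  by have [|y Uy <-] := he r r01; [rewrite distrC|exists y].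
by apply: be; split=> //; exact: ballxx.
Qed.

Lemma chart_inj (M : manifold) (c : chart M) y z : atlas c -> cdom c y ->
  cdom c z -> cmap c y = cmap c z -> y = z.
Proof.
move=> ac cy cz e; have [_ i _ _] := atlas_chart ac.
by apply: i => //; rewrite inE.
Qed.

Lemma chart_nbhs (M : manifold) (c : chart M) x : atlas c -> cdom c x ->
  nbhs x (cdom c).
Proof.
by move=> ac cx; have [oD _ _ _] := atlas_chart ac; exact: open_nbhs_nbhs.
Qed.

Lemma chart_local (M : manifold) (c : chart M) x : atlas c -> cdom c x ->
  chart_at (cmap c) x.
Proof. by move=> ac; have /is_chartP [_ _ h] := atlas_chart ac; exact: h. Qed.

Lemma oriented_homeo_refl (M : manifold) : oriented_homeo (@id M).
Proof.
split; [by move=> x; exact: cvg_id| |exact: atlas_oriented].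
by exists id; split=> // x; exact: cvg_id.
Qed.

Lemma oriented_homeo_trans (M N P : manifold) (f : M -> N) (g : N -> P) :
  oriented_homeo f -> oriented_homeo g -> oriented_homeo (g \o f).
Proof.
move=> [cf [f' [fK f'K cf']] of_] [cg [g' [gK g'K cg']] og]; split.
- by move=> x; apply: continuous_comp; [exact: cf|exact: cg].
- exists (f' \o g'); split; [exact: can_comp|exact: can_comp|].
  by move=> x; apply: continuous_comp; [exact: cg'|exact: cf'].
move=> c e x ac ae cx ex.
have [d ad dx] := atlas_cover (f x).
have [W nW hW] := of_ _ _ _ ac ad cx dx.
have [V nV hV] := og _ _ _ ad ae dx ex.
exists (W `&` f @^-1` V); first by apply: filterI => //; exact: cf.
by move=> y z [Wy Vy] [Wz Vz] /(hW _ _ Wy Wz) /(hV _ _ Vy Vz).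
Qed.

Lemma oriented_homeo_sym (M N : manifold) (f : M -> N) (g : N -> M) :
  oriented_homeo f -> cancel f g -> cancel g f -> oriented_homeo g.
Proof.
move=> [cf [f' [fK f'K cf']] of_] fg gf.
have cg : continuous g.
  suff -> : g = f' by [].
  by apply/funext => y; rewrite -[in LHS](f'K y) fg.
split=> //; first by exists f.
move=> d c y ad ac dy cgy.
have [|W nW hW] := of_ c d (g y) ac ad cgy; first by rewrite gf.
have nd := chart_nbhs ad dy.
exists (g @^-1` W `&` cdom d `&` g @^-1` cdom c).
  by apply: filterI; [apply: filterI => //; exact: cg|
    apply: cg; exact: chart_nbhs].
move=> z t [[Wz dz] cz] [[Wt dt] ct] zt.
case: ltgtP => // [tz|e].
  by have := hW _ _ Wt Wz tz; rewrite !gf => /(lt_trans zt); rewrite ltxx.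
have /(congr1 f) := chart_inj ac cz ct e.
by rewrite !gf => E; move: zt; rewrite E ltxx.
Qed.

End Manifolds.

Arguments chart : clear implicits.
Arguments manifold : clear implicits.

Section Constructions.
Context {R : realType}.
Local Notation manifold := (manifold R).

Section Sum.
Context {I : finType} (X : I -> manifold).

Definition sum_chart (i : I) (c : chart R (X i)) : chart R {i & X i} :=
  Chart (existT (fun i => X i) i @` cdom c) (untag 0 (cmap c)).

Lemma sum_chartE i (c : chart R (X i)) x :
  cmap (sum_chart c) (existT _ i x) = cmap c x.
Proof. by rewrite /sum_chart /= (untagE _ _ (erefl i : tag (existT (fun i => X i : Type) i x) = i)). Qed.

Arguments sum_chart : simpl never.

Definition sum_atlas : set (chart R {i & X i}) :=
  [set e | exists i, exists2 c : chart R (X i), atlas c & e = sum_chart c].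

Lemma sum_atlas_chart c : sum_atlas c -> is_chart c.
Proof.
move=> [i [c' ac ->]]; apply/is_chartP; split.
- by apply: existT_open_map; have [] := atlas_chart ac.
- move=> x y; rewrite !inE => -[x' cx <-] [y' cy <-].
  by rewrite !sum_chartE => /(chart_inj ac cx cy) ->.
move=> _ [x cx <-]; have [cc c01 co] := chart_local ac cx; split.
- move=> W; rewrite sum_chartE => /cc.
  rewrite /= !nbhs_simpl /= /nbhs /= => nW; rewrite /nbhs /= sigT_nbhsE /=.
  by apply: filterS nW => y Wy; move: (sum_chartE c' y) => /= ->.
- by rewrite sum_chartE.
move=> W; rewrite /nbhs [X in X _]/= sigT_nbhsE => /co[e e0 h]; exists e => // t t01.
rewrite sum_chartE => /(h _ t01)[y Wy <-]; exists (existT _ i y) => //.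
by rewrite sum_chartE.
Qed.

Lemma sum_atlas_cover (x : {i & X i}) : exists2 c, sum_atlas c & cdom c x.
Proof.
case: x => i x; have [c ac cx] := atlas_cover x.
by exists (sum_chart c); [exists i, c|exists x].
Qed.

Lemma sum_atlas_oriented c d (x : {i & X i}) : sum_atlas c -> sum_atlas d ->
  cdom c x -> cdom d x -> increasing_at id c d x.
Proof.
move=> [i [c' ac ->]] [j [d' ad ->]] [x' cx <-] [y' dy E].
have ji : j = i := existT_inj1 E.
subst j.
move: dy; rewrite (existT_inj2 E) => dx.
have [W nW hW] := atlas_oriented ac ad cx dx.
exists (existT _ i @` W); first exact: existT_nbhs.
by move=> _ _ [y Wy <-] [z Wz <-]; rewrite !sum_chartE; exact: hW.
Qed.

Lemma sum_compact : compact [set: {i & X i}].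
Proof.
by apply: sigT_compact => [|i]; [exact: finite_finset|exact: manifold_compact].
Qed.

Lemma sum_hausdorff : hausdorff_space {i & X i}.
Proof. by apply: sigT_hausdorff => i; exact: manifold_hausdorff. Qed.

Definition sum_manifold : manifold :=
  Manifold sum_hausdorff sum_compact sum_atlas_chart sum_atlas_cover
    sum_atlas_oriented.

Lemma sum_boundary s i (x : X i) :
  boundary s (existT _ i x : sum_manifold) <-> boundary s x.
Proof.
split=> [[_ [j [c ac ->]] [[y cy E]]]|[c ac [cx cs]]]; last first.
  by exists (sum_chart c); [exists i, c|split; [exists x|rewrite sum_chartE]].
have ji : j = i := existT_inj1 E.
subst j.
by rewrite -E sum_chartE (existT_inj2 E) in cy * => cs; exists c.
Qed.

End Sum.

Section Interval.

Definition unit_interval : topologicalType := `[0, 1]%classic : set R.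

Lemma mem0_01 : (0 : R) \in (`[0, 1]%classic : set R).
Proof. by rewrite inE /= in_itv /= lexx ler01. Qed.
Lemma mem1_01 : (1 : R) \in (`[0, 1]%classic : set R).
Proof. by rewrite inE /= in_itv /= lexx ler01. Qed.

Definition I0 : unit_interval := exist _ 0 mem0_01.
Definition I1 : unit_interval := exist _ 1 mem1_01.

(* [0, 1] with its standard orientation for [s = true], and with the opposite
   orientation for [s = false]. *)
Definition interval_chart (s : bool) : chart R unit_interval :=
  Chart [set: unit_interval] (fun t => if s then \val t else 1 - \val t).

Lemma interval_val01 (t : unit_interval) : 0 <= \val t <= 1.
Proof. by case: t => t /= /[!inE] /=; rewrite in_itv. Qed.

Lemma interval_val_continuous : continuous (fun t : unit_interval => \val t).
Proof. exact: initial_continuous. Qed.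

Lemma interval_hausdorff : hausdorff_space unit_interval.
Proof.
move=> p q pq; apply/val_inj/(@Rhausdorff R) => A B nA nB.
have [t [At Bt]] :=
  pq _ _ (interval_val_continuous nA) (interval_val_continuous nB).
by exists (\val t).
Qed.

Lemma mem_clamp (t : R) :
  Num.max 0 (Num.min 1 t) \in (`[0, 1]%classic : set R).
Proof.
by rewrite inE /= in_itv /= le_max lexx /= ge_max ler01 /= ge_min lexx.
Qed.

Lemma interval_nbhs (t : unit_interval) W : nbhs t W ->
  exists2 V : set R, nbhs (\val t) V & forall r : unit_interval,
    V (\val r) -> W r.
Proof.
rewrite nbhsE /= => -[_ [[V oV <-] Vt] VW].
by exists V; [exact: open_nbhs_nbhs|move=> r Vr; exact: VW].
Qed.

Lemma interval_compact : compact [set: unit_interval].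
Proof.
pose f t : unit_interval := @exist R (fun x => x \in `[0, 1]%classic) _ (mem_clamp t).
have cf : continuous f.
  move=> t W /interval_nbhs[V nV VW].
  have : {for t, continuous (fun t : R => Num.max 0 (Num.min 1 t))}.
    apply: continuous_max; first exact: cst_continuous.
    by apply: continuous_min; [exact: cst_continuous|exact: cvg_id].
  move=> /(_ V nV) h.
  have {}h : nbhs t [set r : R | V (Num.max 0 (Num.min 1 r))] by exact: h.
  by apply: filterS h => r Vr; exact: VW.
have -> : [set: unit_interval] = f @` `[0, 1].
  rewrite eqEsubset; split=> // t _; exists (\val t).
    by rewrite /= in_itv /= interval_val01.
  apply: val_inj => /=; have /andP[t0 t1] := interval_val01 t.
  by rewrite min_r // max_r.
apply: continuous_compact; last exact: segment_compact.
exact: continuous_subspaceT.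
Qed.

Lemma interval_chart_is_chart s : is_chart (interval_chart s).
Proof.
apply/is_chartP; split; first exact: openT.
  move=> x y _ _ /= e; apply: val_inj; case: s e => //.
  by move=> /addrI/oppr_inj.
move=> t _; split.
- case: s => /=; first exact: interval_val_continuous.
  apply: (@continuousB _ R^o); first exact: cst_continuous.
  exact: interval_val_continuous.
- have := interval_val01 t; case: s => //=.
  by move=> /andP[t0 t1]; rewrite subr_ge0 t1 gerBl t0.
move=> W /interval_nbhs[V /nbhs_ballP[e /= e0 be] VW]; exists e => // r r01 re.
pose r' := if s then r else 1 - r.
have r'01 : r' \in (`[0, 1]%classic : set R).
  rewrite inE /= in_itv /= /r'; case: s {re r'} => //.
  by move: r01 => /andP[t0 t1]; rewrite subr_ge0 t1 gerBl t0.
exists (@exist R (fun x => x \in `[0, 1]%classic) r' r'01); last by rewrite /r' /=; case: s {re r' r'01} => //; rewrite subKr.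
apply: VW; apply: be; rewrite /ball /= /r'.
case: s re {r' r'01}; first by rewrite distrC.
rewrite (_ : \val t - (1 - r) = r - (1 - \val t)) //; ring.
Qed.

Definition interval_atlas s : set (chart R unit_interval) :=
  [set interval_chart s].

Lemma interval_atlas_chart s c : interval_atlas s c -> is_chart c.
Proof. by move=> ->; exact: interval_chart_is_chart. Qed.

Lemma interval_atlas_cover s (x : unit_interval) :
  exists2 c, interval_atlas s c & cdom c x.
Proof. by exists (interval_chart s). Qed.

Lemma interval_atlas_oriented s c d (x : unit_interval) :
  interval_atlas s c -> interval_atlas s d -> cdom c x -> cdom d x ->
  increasing_at id c d x.
Proof. by move=> -> -> _ _; exists setT => //; exact: filterT. Qed.

Definition oriented_interval (s : bool) : manifold :=
  Manifold interval_hausdorff interval_compact (@interval_atlas_chart s)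
    (interval_atlas_cover s) (@interval_atlas_oriented s).

Lemma interval_boundary0 s : boundary s (I0 : oriented_interval s).
Proof.
exists (interval_chart s) => //; split => //=.
by case: s => //; rewrite subr0.
Qed.

Lemma interval_boundary1 s : boundary (~~ s) (I1 : oriented_interval s).
Proof.
exists (interval_chart s) => //; split => //=.
by case: s => //; rewrite subrr.
Qed.

Lemma interval_boundary s s' (t : oriented_interval s) : boundary s' t ->
  t = I0 \/ t = I1.
Proof.
move=> [_ -> [_ /= e]].
suff [h|h] : \val t = 0 \/ \val t = 1.
- by left; apply: val_inj.
- by right; apply: val_inj.
by case: s s' t e => -[] t /= e; [left|right|right|left]; lra.
Qed.

End Interval.

End Constructions.

Section Cobordisms.
Context {R : realType}.
Local Notation manifold := (manifold R).

(* The objects of 1Cob are words in the signs.  Initial points have sign + in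
   the boundary, so ingoing boundary points have the sign of their letter and
   outgoing ones the opposite sign.  Injective maps from a finite discrete space
   to a Hausdorff one are embeddings. *)
Record cobordism (a b : seq bool) := Cobordism {
  cob_manifold :> manifold;
  cob_in : 'I_(size a) -> cob_manifold;
  cob_out : 'I_(size b) -> cob_manifold;
  cob_in_inj : injective cob_in;
  cob_out_inj : injective cob_out;
  cob_in_out : forall i j, cob_in i <> cob_out j;
  cob_in_sign : forall i : 'I_(size a), boundary (nth true a i) (cob_in i);
  cob_out_sign : forall j : 'I_(size b), boundary (~~ nth true b j) (cob_out j);
  cob_boundary : forall s (x : cob_manifold), boundary s x ->
    (exists i, x = cob_in i) \/ (exists j, x = cob_out j) }.

Definition cob_equiv a b (K L : cobordism a b) : Prop :=
  exists Phi : K -> L, [/\ oriented_homeo Phi,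
    forall i, Phi (cob_in K i) = cob_in L i &
    forall j, Phi (cob_out K j) = cob_out L j].

Lemma cob_equiv_refl a b (K : cobordism a b) : cob_equiv K K.
Proof. by exists id; split=> //; exact: oriented_homeo_refl. Qed.

Lemma cob_equiv_sym a b (K L : cobordism a b) : cob_equiv K L -> cob_equiv L K.
Proof.
move=> [f [hf fi fo]]; have [cf [g [fg gf cg]] of_] := hf.
by exists g; split=> [|i|j]; [exact: oriented_homeo_sym hf _ _|
  rewrite -fi fg|rewrite -fo fg].
Qed.

Lemma cob_equiv_trans a b (K L N : cobordism a b) :
  cob_equiv K L -> cob_equiv L N -> cob_equiv K N.
Proof.
move=> [f [hf fi fo]] [g [hg gi go]]; exists (g \o f).
by split=> [|i|j]; [exact: oriented_homeo_trans|
  rewrite /= fi gi|rewrite /= fo go].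
Qed.

(* The morphisms a -> b of 1Cob: equivalence classes of cobordisms.  A quotient
   by generic_quotient would need a choiceType of cobordisms, which the universe
   constraints exclude. *)
Definition cob_hom (a b : seq bool) : Type :=
  {C : cobordism a b -> Prop | exists K, C = cob_equiv K}.

Definition cob_class a b (K : cobordism a b) : cob_hom a b :=
  exist _ (cob_equiv K) (ex_intro _ K erefl).

Lemma cob_classP a b (k : cob_hom a b) : exists K, k = cob_class K.
Proof.
by case: k => C [K CK]; exists K; subst C.
Qed.

Lemma eq_cob_class a b (K L : cobordism a b) :
  cob_class K = cob_class L <-> cob_equiv K L.
Proof.
split=> [[E]|KL].
  by rewrite (_ : cob_equiv K = cob_equiv L) //; exact: cob_equiv_refl.
have E : cob_equiv K = cob_equiv L.
  apply: functional_extensionality_dep => N; apply: propext; split => h.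
    exact: cob_equiv_trans (cob_equiv_sym KL) h.
  exact: cob_equiv_trans KL h.
rewrite /cob_class; move: (ex_intro _ K _) (ex_intro _ L _).
by rewrite E => p q; congr exist; exact: Prop_irrelevance.
Qed.

Section Words.

Definition catl (a b : seq bool) (i : 'I_(size a)) : 'I_(size (a ++ b)) :=
  cast_ord (esym (size_cat a b)) (lshift (size b) i).
Definition catr (a b : seq bool) (j : 'I_(size b)) : 'I_(size (a ++ b)) :=
  cast_ord (esym (size_cat a b)) (rshift (size a) j).

Definition cat_fun (T : Type) (a b : seq bool)
    (f : 'I_(size a) -> T) (g : 'I_(size b) -> T) (i : 'I_(size (a ++ b))) : T :=
  match fintype.split (cast_ord (size_cat a b) i) with inl j => f j | inr j => g j end.

Lemma cat_funl T a b (f : _ -> T) g i : @cat_fun T a b f g (catl b i) = f i.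
Proof. by rewrite /cat_fun cast_ordKV (fintype.unsplitK (inl i)). Qed.

Lemma cat_funr T a b (f : _ -> T) g j : @cat_fun T a b f g (catr a j) = g j.
Proof. by rewrite /cat_fun cast_ordKV (fintype.unsplitK (inr j)). Qed.

Variant cat_ord_spec a b : 'I_(size (a ++ b)) -> Type :=
  | CatL i : cat_ord_spec (catl b i)
  | CatR j : cat_ord_spec (catr a j).

Lemma cat_ordP a b i : @cat_ord_spec a b i.
Proof.
rewrite -[i](cast_ordK (size_cat a b)) -[cast_ord _ i]fintype.splitK.
by case: (fintype.split _) => j; constructor.
Qed.

Lemma nth_catl a b (i : 'I_(size a)) : nth true (a ++ b) (catl b i) = nth true a i.
Proof. by rewrite nth_cat /= ltn_ord. Qed.

Lemma nth_catr a b (j : 'I_(size b)) : nth true (a ++ b) (catr a j) = nth true b j.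
Proof. by rewrite nth_cat /= ltnNge leq_addr /= addKn. Qed.

End Words.

(* Intervals joining the ingoing point [i] to the outgoing point [f i]. *)
Section Strands.
Context (a b : seq bool) (f : 'I_(size a) -> 'I_(size b)).
Context (g : 'I_(size b) -> 'I_(size a)).
Hypotheses (fK : cancel f g) (gK : cancel g f).
Hypothesis (f_sign : forall i : 'I_(size a), nth true b (f i) = nth true a i).

Definition strands_manifold : manifold :=
  sum_manifold (fun i : 'I_(size a) => oriented_interval (nth true a i)).

Definition strands_in (i : 'I_(size a)) : strands_manifold := existT _ i I0.
Definition strands_out (j : 'I_(size b)) : strands_manifold :=
  existT _ (g j) I1.

Lemma strands_in_inj : injective strands_in.
Proof. by move=> i j e; exact: existT_inj1 e. Qed.

Lemma strands_out_inj : injective strands_out.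
Proof. by move=> i j e; apply: (can_inj gK); exact: existT_inj1 e. Qed.

Lemma strands_in_out i j : strands_in i <> strands_out j.
Proof.
move=> e; have ij := existT_inj1 e; subst i.
have := existT_inj2 e; move=> /(congr1 (fun t : unit_interval => \val t)) /= /eqP.
by rewrite eq_sym oner_eq0.
Qed.

Lemma strands_in_sign (i : 'I_(size a)) : boundary (nth true a i) (strands_in i).
Proof. by apply/sum_boundary; exact: interval_boundary0. Qed.

Lemma strands_out_sign (j : 'I_(size b)) : boundary (~~ nth true b j) (strands_out j).
Proof.
rewrite -{1}(gK j) f_sign.
by apply/sum_boundary; exact: interval_boundary1.
Qed.

Lemma strands_boundary s (x : strands_manifold) : boundary s x ->
  (exists i, x = strands_in i) \/ (exists j, x = strands_out j).
Proof.
case: x => i t /sum_boundary/interval_boundary[] ->; first by left; exists i.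
by right; exists (f i); rewrite /strands_out fK.
Qed.

Definition strands : cobordism a b :=
  Cobordism strands_in_inj strands_out_inj strands_in_out strands_in_sign
    strands_out_sign strands_boundary.

End Strands.

Definition cob_id (a : seq bool) : cobordism a a :=
  @strands a a id id (fun=> erefl) (fun=> erefl) (fun=> erefl).

Section Symmetry.

(* Position [i < size a] goes to [size b + i], and position [size a + j] to
   [j]. *)
Definition word_swap (a b : seq bool) : 'I_(size (a ++ b)) -> 'I_(size (b ++ a)) :=
  cat_fun (@catr b a) (@catl b a).

Lemma word_swapK a b : cancel (@word_swap a b) (@word_swap b a).
Proof.
by move=> i; case: (cat_ordP i) => j;
   rewrite /word_swap ?(cat_funl, cat_funr) ?(cat_funl, cat_funr).
Qed.

Lemma word_swap_sign a b (i : 'I_(size (a ++ b))) : nth true (b ++ a) (word_swap i) = nth true (a ++ b) i.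
Proof.
by case: (cat_ordP i) => j;
   rewrite /word_swap ?(cat_funl, cat_funr) ?(nth_catl, nth_catr).
Qed.

Definition cob_sym (a b : seq bool) : cobordism (a ++ b) (b ++ a) :=
  strands (@word_swapK a b) (@word_swapK b a) (@word_swap_sign a b).

End Symmetry.

(* Disjoint union, with [K] on the left. *)
Section Tensor.
Context (a b c d : seq bool) (K : cobordism a b) (L : cobordism c d).

Definition tensor_manifold : manifold :=
  sum_manifold (fun t : bool => if t then L : manifold else K : manifold).

Definition tensorl (x : K) : tensor_manifold := existT _ false x.
Definition tensorr (y : L) : tensor_manifold := existT _ true y.

Definition tensor_in : 'I_(size (a ++ c)) -> tensor_manifold :=
  cat_fun (tensorl \o cob_in K) (tensorr \o cob_in L).
Definition tensor_out : 'I_(size (b ++ d)) -> tensor_manifold :=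
  cat_fun (tensorl \o cob_out K) (tensorr \o cob_out L).

Lemma tensorl_inj : injective tensorl.
Proof. by move=> x y e; exact: (existT_inj2 (e : _ = _)). Qed.
Lemma tensorr_inj : injective tensorr.
Proof. by move=> x y e; exact: (existT_inj2 (e : _ = _)). Qed.
Lemma tensorlr x y : tensorl x <> tensorr y.
Proof. by move=> e; have := existT_inj1 e. Qed.

Lemma tensor_in_inj : injective tensor_in.
Proof.
move=> i j; rewrite /tensor_in; case: (cat_ordP i) => {}i;
  case: (cat_ordP j) => {}j; rewrite ?(cat_funl, cat_funr) /=.
- by move=> /tensorl_inj/cob_in_inj ->.
- by move=> /tensorlr.
- by move=> /esym/tensorlr.
- by move=> /tensorr_inj/cob_in_inj ->.
Qed.

Lemma tensor_out_inj : injective tensor_out.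
Proof.
move=> i j; rewrite /tensor_out; case: (cat_ordP i) => {}i;
  case: (cat_ordP j) => {}j; rewrite ?(cat_funl, cat_funr) /=.
- by move=> /tensorl_inj/cob_out_inj ->.
- by move=> /tensorlr.
- by move=> /esym/tensorlr.
- by move=> /tensorr_inj/cob_out_inj ->.
Qed.

Lemma tensor_in_out i j : tensor_in i <> tensor_out j.
Proof.
rewrite /tensor_in /tensor_out; case: (cat_ordP i) => {}i;
  case: (cat_ordP j) => {}j; rewrite ?(cat_funl, cat_funr) /=.
- by move=> /tensorl_inj/cob_in_out.
- by move=> /tensorlr.
- by move=> /esym/tensorlr.
- by move=> /tensorr_inj/cob_in_out.
Qed.

Lemma tensorl_boundary s x : boundary s (tensorl x) <-> boundary s x.
Proof. exact: sum_boundary. Qed.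
Lemma tensorr_boundary s y : boundary s (tensorr y) <-> boundary s y.
Proof. exact: sum_boundary. Qed.

Lemma tensor_in_sign (i : 'I_(size (a ++ c))) : boundary (nth true (a ++ c) i) (tensor_in i).
Proof.
rewrite /tensor_in; case: (cat_ordP i) => {}i.
  by rewrite nth_catl cat_funl; apply/tensorl_boundary; exact: cob_in_sign.
by rewrite nth_catr cat_funr; apply/tensorr_boundary; exact: cob_in_sign.
Qed.

Lemma tensor_out_sign (j : 'I_(size (b ++ d))) : boundary (~~ nth true (b ++ d) j) (tensor_out j).
Proof.
rewrite /tensor_out; case: (cat_ordP j) => {}j.
  by rewrite nth_catl cat_funl; apply/tensorl_boundary; exact: cob_out_sign.
by rewrite nth_catr cat_funr; apply/tensorr_boundary; exact: cob_out_sign.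
Qed.

Lemma tensor_boundary s (x : tensor_manifold) : boundary s x ->
  (exists i, x = tensor_in i) \/ (exists j, x = tensor_out j).
Proof.
case: x => -[] x; last first.
  move=> /tensorl_boundary/cob_boundary[] [i ->]; [left|right].
    by exists (catl c i); rewrite /tensor_in cat_funl.
  by exists (catl d i); rewrite /tensor_out cat_funl.
move=> /tensorr_boundary/cob_boundary[] [i ->]; [left|right].
  by exists (catr a i); rewrite /tensor_in cat_funr.
by exists (catr b i); rewrite /tensor_out cat_funr.
Qed.

Definition cob_tensor : cobordism (a ++ c) (b ++ d) :=
  Cobordism tensor_in_inj tensor_out_inj tensor_in_out tensor_in_sign
    tensor_out_sign tensor_boundary.

End Tensor.

End Cobordisms.

Arguments cobordism : clear implicits.
Arguments cob_hom : clear implicits.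

Section Gluing.
Local Open Scope quotient_scope.
Context {R : realType} (a b c : seq bool).
Context (K : cobordism R a b) (L : cobordism R b c).

Definition glue_rel (p q : tensor_manifold K L) : Prop :=
  p = q \/ exists j : 'I_(size b),
    (p = tensorl L (cob_out K j) /\ q = tensorr K (cob_in L j)) \/
    (p = tensorr K (cob_in L j) /\ q = tensorl L (cob_out K j)).

Definition glue_relb (p q : tensor_manifold K L) : bool := `[< glue_rel p q >].

Lemma glue_rel_refl : reflexive glue_relb.
Proof. by move=> p; apply/asboolP; left. Qed.

Lemma glue_rel_sym : symmetric glue_relb.
Proof.
suff h p q : glue_rel p q -> glue_rel q p.
  by move=> p q; apply/asboolP/asboolP => /h.
by case=> [->|[j [[-> ->]|[-> ->]]]]; [left|right; exists j; right|
  right; exists j; left].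
Qed.

Lemma glue_rel_trans : transitive glue_relb.
Proof.
move=> q p r /asboolP pq /asboolP qr; apply/asboolP.
case: pq qr => [->//|[j [[-> ->]|[-> ->]]]] [<-|[k [[e ->]|[e ->]]]].
- by right; exists j; left.
- by have := tensorlr (esym e).
- by have /cob_in_inj -> := tensorr_inj e; left.
- by right; exists j; right.
- by have /cob_out_inj -> := tensorl_inj e; left.
- by have := tensorlr e.
Qed.

Canonical glue_equiv :=
  EquivRel glue_relb glue_rel_refl glue_rel_sym glue_rel_trans.

(* The quotient of the disjoint union of [K] and [L] which identifies the
   j-th outgoing point of [K] with the j-th ingoing point of [L]. *)
Definition glue_space : topologicalType :=
  quotient_topology {eq_quot glue_equiv}.

Definition gluel (x : K) : glue_space :=
  (\pi_({eq_quot glue_equiv}) (tensorl L x)).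
Definition gluer (y : L) : glue_space :=
  (\pi_({eq_quot glue_equiv}) (tensorr K y)).

Lemma glue_eqP (p q : tensor_manifold K L) :
  (\pi_({eq_quot glue_equiv}) p = \pi_({eq_quot glue_equiv}) q) <->
  glue_rel p q.
Proof.
by split=> [/eqmodP/asboolP|h]; [|apply/eqmodP/asboolP].
Qed.

Lemma gluel_inj : injective gluel.
Proof.
move=> x y /glue_eqP[/tensorl_inj//|[j [[_ e]|[e _]]]].
- by have := tensorlr e.
- by have := tensorlr e.
Qed.

Lemma gluer_inj : injective gluer.
Proof.
move=> x y /glue_eqP[/tensorr_inj//|[j [[e _]|[_ e]]]].
- by have := tensorlr (esym e).
- by have := tensorlr (esym e).
Qed.

Lemma gluelrP x y :
  gluel x = gluer y <-> exists j, x = cob_out K j /\ y = cob_in L j.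
Proof.
split=> [/glue_eqP[/tensorlr//|[j [[e f]|[e _]]]]|[j [-> ->]]].
- by exists j; rewrite (tensorl_inj e) (tensorr_inj f).
- by have := tensorlr e.
- by apply/glue_eqP; right; exists j; left.
Qed.

Lemma glue_cover p : (exists x, p = gluel x) \/ (exists y, p = gluer y).
Proof.
rewrite -[p]reprK; case: (repr p) => -[] x; first by right; exists x.
by left; exists x.
Qed.

Lemma glue_openP (U : set glue_space) :
  open U <-> open (gluel @^-1` U) /\ open (gluer @^-1` U).
Proof.
split=> [/sigT_openP h|[hl hr]].
  by split; [exact: (h false)|exact: (h true)].
by apply/sigT_openP => -[].
Qed.

Lemma gluel_continuous : continuous gluel.
Proof. by apply/continuousP => U /glue_openP[]. Qed.

Lemma gluer_continuous : continuous gluer.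
Proof. by apply/continuousP => U /glue_openP[]. Qed.

Lemma near_neq (M : manifold R) (x z : M) : x <> z -> nbhs x [set y | y <> z].
Proof.
move=> xz; apply: open_nbhs_nbhs; split => //.
rewrite (_ : [set y | _] = ~` [set z]) //; apply: closed_openC.
exact/accessible_closed_set1/hausdorff_accessible/manifold_hausdorff.
Qed.

Lemma glue_nbhs (A : set K) (B : set L) (p : glue_space) :
  (forall x, gluel x = p -> nbhs x A) -> (forall y, gluer y = p -> nbhs y B) ->
  nbhs p [set q | (forall x, gluel x = q -> A x) /\
                  (forall y, gluer y = q -> B y)].
Proof.
move=> hA hB.
pose O := [set q | (forall x, gluel x = q -> interior A x) /\
                   (forall y, gluer y = q -> interior B y)].
have Op : O p by split=> [x /hA|y /hB].
suff oO : open O.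
  apply: filterS (open_nbhs_nbhs (conj oO Op)) => q [qA qB].
  split=> [x /qA|y /qB]; exact: interior_subset.
apply/glue_openP; split; rewrite openE => x [xA xB].
- have nA : nbhs x (interior A).
    by apply: open_nbhs_nbhs; split; [exact: open_interior|exact: xA].
  have nB : nbhs x [set z | forall j, z = cob_out K j ->
                              interior B (cob_in L j)].
    apply: filter_forall => j.
    have [e|ne] := pselect (x = cob_out K j).
      by apply: nearW => z _; apply: xB; apply/esym/gluelrP; exists j.
    by apply: filterS (near_neq ne) => z zj /zj.
  apply: filterS2 nA nB => z zA zB; split=> [x' /gluel_inj -> //|y].
  by move=> /esym/gluelrP[j [e ->]]; exact: zB.
- have nB : nbhs x (interior B).
    by apply: open_nbhs_nbhs; split; [exact: open_interior|exact: xB].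
  have nA : nbhs x [set z | forall j, z = cob_in L j ->
                              interior A (cob_out K j)].
    apply: filter_forall => j.
    have [e|ne] := pselect (x = cob_in L j).
      by apply: nearW => z _; apply: xA; apply/gluelrP; exists j.
    by apply: filterS (near_neq ne) => z zj /zj.
  apply: filterS2 nA nB => z zA zB; split=> [x'|y /gluer_inj -> //].
  by move=> /gluelrP[j [-> e]]; exact: zA.
Qed.

Lemma glue_compact : compact [set: glue_space].
Proof.
have -> : [set: glue_space] =
    (\pi_({eq_quot glue_equiv})) @` [set: tensor_manifold K L].
  by rewrite eqEsubset; split=> // p _; exists (repr p) => //; exact: reprK.
apply: continuous_compact; last exact: manifold_compact.
by apply: continuous_subspaceT; exact: pi_continuous.
Qed.

Lemma separate (M : manifold R) (P Q : set M) :
  is_subset1 P -> is_subset1 Q -> P `&` Q = set0 ->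
  exists A B : set M, [/\ forall x, P x -> nbhs x A,
    forall x, Q x -> nbhs x B & A `&` B = set0].
Proof.
move=> sP sQ PQ.
have [[x Px]|nP] := pselect (exists x, P x); last first.
  exists set0, setT; rewrite set0I; split=> // [x Px|x _].
    by case: nP; exists x.
  exact: filterT.
have [[y Qy]|nQ] := pselect (exists x, Q x); last first.
  exists setT, set0; rewrite setI0; split=> // [z _|y Qy].
    exact: filterT.
  by case: nQ; exists y.
have /eqP xy : x <> y.
  by move=> xy; rewrite -[False]/(set0 x) -PQ; split=> //; rewrite xy.
have := @manifold_hausdorff _ M; rewrite open_hausdorff => /(_ x y xy).
case=> -[A B] /= [/[!inE] Ax By] [oA oB AB]; exists A, B; split=> //.
- by move=> z Pz; rewrite (sP _ _ Pz Px); exact: open_nbhs_nbhs.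
- by move=> z Qz; rewrite (sQ _ _ Qz Qy); exact: open_nbhs_nbhs.
Qed.

Lemma glue_hausdorff : hausdorff_space glue_space.
Proof.
move=> p q pq; apply: contrapT => npq.
have [A [B [pA qB AB]]] :
    exists A B : set K, [/\ forall x, gluel x = p -> nbhs x A,
    forall x, gluel x = q -> nbhs x B & A `&` B = set0].
  apply: separate => [x y <- /gluel_inj //|x y <- /gluel_inj //|].
  by rewrite -subset0 => x [-> /npq].
have [A' [B' [pA' qB' AB']]] :
    exists A B : set L, [/\ forall x, gluer x = p -> nbhs x A,
    forall x, gluer x = q -> nbhs x B & A `&` B = set0].
  apply: separate => [x y <- /gluer_inj //|x y <- /gluer_inj //|].
  by rewrite -subset0 => x [-> /npq].
have [r [[rA rA'] [rB rB']]] := pq _ _ (glue_nbhs pA pA') (glue_nbhs qB qB').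
case: (glue_cover r) => -[x rx].
- by rewrite -[False]/(set0 x) -AB; split; [exact: rA|exact: rB].
- by rewrite -[False]/(set0 x) -AB'; split; [exact: rA'|exact: rB'].
Qed.

Definition glue_fun (u : K -> R) (v : L -> R) (p : glue_space) : R :=
  match repr p : tensor_manifold K L with
  | existT true y => v y
  | existT false x => u x
  end.

Lemma glue_funl u v x :
  (forall j, x = cob_out K j -> u x = v (cob_in L j)) ->
  glue_fun u v (gluel x) = u x.
Proof.
move=> h; rewrite /glue_fun; have := reprK (gluel x).
case: (repr _) => -[] z; last by move=> /gluel_inj ->.
by move=> /esym/gluelrP[j [e ->]]; rewrite (h j).
Qed.

Lemma glue_funr u v y :
  (forall j, y = cob_in L j -> u (cob_out K j) = v y) ->
  glue_fun u v (gluer y) = v y.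
Proof.
move=> h; rewrite /glue_fun; have := reprK (gluer y).
case: (repr _) => -[] z; first by move=> /gluer_inj ->.
by move=> /gluelrP[j [-> e]]; rewrite (h j).
Qed.

Definition glue_chart (U : set K) (V : set L) (u : K -> R) (v : L -> R) :
  chart R glue_space := Chart (gluel @` U `|` gluer @` V) (glue_fun u v).

Section GlueChart.
Context (U : set K) (V : set L) (u : K -> R) (v : L -> R).
Hypothesis UV : forall j, U (cob_out K j) <-> V (cob_in L j).
Hypothesis uv : forall j, U (cob_out K j) -> u (cob_out K j) = v (cob_in L j).
Hypotheses (oU : open U) (oV : open V).
Let G := glue_chart U V u v.

Lemma glue_doml x : cdom G (gluel x) <-> U x.
Proof.
split=> [[[y Uy /gluel_inj <-]//|[y Vy]]|Ux]; last by left; exists x.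
by move=> /esym/gluelrP[j [-> e]]; apply/UV; rewrite -e.
Qed.

Lemma glue_domr y : cdom G (gluer y) <-> V y.
Proof.
split=> [[[x Ux]|[x Vx /gluer_inj <-]//]|Vy]; last by right; exists y.
by move=> /gluelrP[j [e ->]]; apply/UV; rewrite -e.
Qed.

Lemma glue_mapl x : U x -> cmap G (gluel x) = u x.
Proof. by move=> Ux; apply: glue_funl => j e; rewrite e uv // -e. Qed.

Lemma glue_mapr y : V y -> cmap G (gluer y) = v y.
Proof.
by move=> Vy; apply: glue_funr => j e; rewrite e uv //; apply/UV; rewrite -e.
Qed.

Hypothesis ui : forall x y, U x -> U y -> u x = u y -> x = y.
Hypothesis vi : forall x y, V x -> V y -> v x = v y -> x = y.
Hypothesis uvi : forall x y, U x -> V y -> u x = v y ->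
  exists j, x = cob_out K j /\ y = cob_in L j.
Hypothesis uc : forall x, U x -> {for x, continuous u} /\ 0 <= u x <= 1.
Hypothesis vc : forall y, V y -> {for y, continuous v} /\ 0 <= v y <= 1.
Hypothesis ul : forall x, U x -> (forall j, x <> cob_out K j) -> chart_at u x.
Hypothesis vl : forall y, V y -> (forall j, y <> cob_in L j) -> chart_at v y.
Hypothesis uvl : forall j, U (cob_out K j) ->
  forall W W', nbhs (cob_out K j) W -> nbhs (cob_in L j) W' ->
  exists2 e : R, 0 < e & forall t : R, 0 <= t <= 1 ->
    `|t - u (cob_out K j)| < e ->
    (exists2 x, W x & u x = t) \/ (exists2 y, W' y & v y = t).

Lemma glue_is_chart : is_chart G.
Proof.
have nU x : U x -> nbhs x U by move=> Ux; exact: open_nbhs_nbhs.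
have nV x : V x -> nbhs x V by move=> Vx; exact: open_nbhs_nbhs.
apply/is_chartP; split.
- rewrite openE => p Gp.
  apply: filterS (@glue_nbhs U V p _ _).
  + move=> q [qU qV]; case: (glue_cover q) => -[x e]; rewrite e.
      by apply/glue_doml; exact: qU.
    by apply/glue_domr; exact: qV.
  + by move=> x xp; apply: nU; apply/glue_doml; rewrite xp.
  + by move=> x xp; apply: nV; apply/glue_domr; rewrite xp.
- move=> p q /[!inE].
  case: (glue_cover p) => -[x ->] => [/glue_doml Ux|/glue_domr Vx];
  case: (glue_cover q) => -[y ->] => [/glue_doml Uy|/glue_domr Vy].
  + by rewrite !glue_mapl // => /(ui Ux Uy) ->.
  + by rewrite glue_mapl // glue_mapr // => /(uvi Ux Vy) h; apply/gluelrP.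
  + rewrite glue_mapr // glue_mapl // => /esym/(uvi Uy Vx) h.
    exact/esym/gluelrP.
  + by rewrite !glue_mapr // => /(vi Vx Vy) ->.
move=> p Gp; split.
- move=> W nW.
  have := @glue_nbhs (U `&` u @^-1` W) (V `&` v @^-1` W) p.
  move=> h; have {}h := h _ _; apply: filterS (h _ _).
  + move=> q [qU qV]; case: (glue_cover q) => -[x e]; rewrite /= e.
      by have [Ux Wx] := qU x (esym e); rewrite [glue_fun _ _ _]glue_mapl.
    by have [Vx Wx] := qV x (esym e); rewrite [glue_fun _ _ _]glue_mapr.
  + move=> x xp; have Ux : U x by apply/glue_doml; rewrite xp.
    apply: filterI; first exact: nU.
    by apply: (uc Ux).1; rewrite -(glue_mapl Ux) xp.
  + move=> x xp; have Vx : V x by apply/glue_domr; rewrite xp.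
    apply: filterI; first exact: nV.
    by apply: (vc Vx).1; rewrite -(glue_mapr Vx) xp.
- case: (glue_cover p) Gp => -[x ->] => [/glue_doml Ux|/glue_domr Vx].
    by rewrite glue_mapl //; exact: (uc Ux).2.
  by rewrite glue_mapr //; exact: (vc Vx).2.
move=> W nW.
have nWl x : gluel x = p -> nbhs x (gluel @^-1` W).
  by move=> xp; apply: gluel_continuous; rewrite xp.
have nWr y : gluer y = p -> nbhs y (gluer @^-1` W).
  by move=> yp; apply: gluer_continuous; rewrite yp.
have [[j pj]|np] := pselect (exists j, p = gluel (cob_out K j)).
  have Uj : U (cob_out K j) by apply/glue_doml; rewrite -pj.
  have Vj : V (cob_in L j) by apply/UV.
  have pj' : p = gluer (cob_in L j) by rewrite pj; apply/gluelrP; exists j.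
  have [e e0 he] := uvl Uj
    (filterI (nU _ Uj) (nWl _ (esym pj))) (filterI (nV _ Vj) (nWr _ (esym pj'))).
  exists e => // t t01; rewrite pj glue_mapl // => /(he t t01).
  case=> -[x [Ux Wx] <-].
    by exists (gluel x) => //; rewrite glue_mapl.
  by exists (gluer x) => //; rewrite glue_mapr.
case: (glue_cover p) => -[x px].
- have Ux : U x by apply/glue_doml; rewrite -px.
  have [|_ _ xo] := ul Ux; first by move=> j e; apply: np; exists j; rewrite -e.
  have [e e0 he] := xo _ (filterI (nU _ Ux) (nWl _ (esym px))).
  exists e => // t t01; rewrite px glue_mapl // => /(he t t01)[y [Uy Wy] <-].
  by exists (gluel y) => //; rewrite glue_mapl.
- have Vx : V x by apply/glue_domr; rewrite -px.
  have [|_ _ xo] := vl Vx.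
    by move=> j e; apply: np; exists j; rewrite px e; apply/esym/gluelrP; exists j.
  have [e e0 he] := xo _ (filterI (nV _ Vx) (nWr _ (esym px))).
  exists e => // t t01; rewrite px glue_mapr // => /(he t t01)[y [Vy Wy] <-].
  by exists (gluer y) => //; rewrite glue_mapr.
Qed.

End GlueChart.

(* [half_map e] maps [0, 1] onto [0, 1/2] for e = 1 and onto [1/2, 1] for
   e = 0; in both cases it sends e to 1/2. *)
Definition half_map (e t : R) : R := (t + (1 - e)) / 2.

Lemma half_end e : half_map e e = 1 / 2.
Proof. by rewrite /half_map addrC subrK. Qed.

Lemma half_neq_end (s : bool) : 1 / 2 <> (if s then 0 else 1 : R).
Proof. by case: s; lra. Qed.

Lemma half_eq_end (s : bool) e t : half_map e t = (if s then 0 else 1) ->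
  e = 0 \/ e = 1 -> 0 <= t <= 1 -> t = (if s then 0 else 1).
Proof.
by rewrite /half_map => h e01 /andP[t0 t1]; case: s h => h; case: e01 h => -> h; lra.
Qed.

Lemma half_inj e : injective (half_map e).
Proof. by rewrite /half_map => x y; lra. Qed.

Lemma half_continuous (M : topologicalType) (u : M -> R) e x :
  {for x, continuous u} -> {for x, continuous (half_map e \o u)}.
Proof.
move=> cu; apply: (@continuousM _ _ (fun x => u x + (1 - e)) (fun=> 2^-1)).
  by apply: (@continuousD _ R^o _ u (fun=> 1 - e)) => //; exact: cst_continuous.
exact: cst_continuous.
Qed.

Lemma half01 e t : e = 0 \/ e = 1 -> 0 <= t <= 1 -> 0 <= half_map e t <= 1.
Proof. by rewrite /half_map => -[] -> /andP[t0 t1]; apply/andP; split; lra. Qed.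

Lemma half_chart_at (M : topologicalType) (u : M -> R) e x :
  e = 0 \/ e = 1 -> chart_at u x -> u x <> e -> chart_at (half_map e \o u) x.
Proof.
move=> e01 [uc u01 ul] ue; split.
- exact: half_continuous.
- exact: half01.
move=> W /ul[r r0 h].
have ue0 : 0 < `|u x - e| by rewrite normr_gt0 subr_eq0; apply/eqP.
exists (Num.min (r / 2) (`|u x - e| / 2)).
  by rewrite lt_min !divr_gt0.
move=> t /andP[t0 t1]; rewrite /= lt_min => /andP[tr te].
have [||y Wy yt] := h (2 * t - (1 - e)).
- move: te u01; rewrite /half_map => + /andP[u0 u1].
  case: e01 => ->; rewrite ?subr0 ?(distrC (u x)).
    rewrite (ger0_norm u0) !ltr_norml => /andP[? ?]; apply/andP; split; lra.
  rewrite (ger0_norm (_ : 0 <= 1 - u x)) ?subr_ge0 // !ltr_norml.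
  by move=> /andP[? ?]; apply/andP; split; lra.
- move: tr; rewrite /half_map !ltr_norml => /andP[? ?]; apply/andP; split; lra.
by exists y => //=; rewrite /half_map yt; lra.
Qed.

(* The charts of [K] at the j-th outgoing point have the value [glue_end j]
   there, and those of [L] at the j-th ingoing point have the opposite value. *)
Definition glue_end (j : 'I_(size b)) : R := if nth true b j then 1 else 0.

Lemma glue_end01 j : glue_end j = 0 \/ glue_end j = 1.
Proof. by rewrite /glue_end; case: nth; [right|left]. Qed.

Lemma glue_end01C j : 1 - glue_end j = 0 \/ 1 - glue_end j = 1.
Proof. by case: (glue_end01 j) => ->; [right|left]; lra. Qed.

Definition glue_chartl (f : chart R K) : chart R glue_space :=
  glue_chart (cdom f `\` range (cob_out K)) set0 (cmap f) (fun=> 0).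

Definition glue_chartr (g : chart R L) : chart R glue_space :=
  glue_chart set0 (cdom g `\` range (cob_in L)) (fun=> 0) (cmap g).

Definition glue_chartm (j : 'I_(size b)) (f : chart R K) (g : chart R L) :
    chart R glue_space :=
  glue_chart (cdom f `\` cob_out K @` [set~ j])
    (cdom g `\` cob_in L @` [set~ j])
    (half_map (glue_end j) \o cmap f) (half_map (1 - glue_end j) \o cmap g).

(* The orientation of the composite: the charts of [K] and of [L] away from the
   common boundary, and around the j-th point of the common boundary the
   concatenations of a chart of [K] and a chart of [L]. *)
Inductive glue_atlas : set (chart R glue_space) :=
  | GlueL f of atlas f : glue_atlas (glue_chartl f)
  | GlueR g of atlas g : glue_atlas (glue_chartr g)
  | GlueM j f g of atlas f & atlas g &
      cdom f (cob_out K j) & cmap f (cob_out K j) = glue_end j &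
      cdom g (cob_in L j) & cmap g (cob_in L j) = 1 - glue_end j :
      glue_atlas (glue_chartm j f g).

Lemma finite_closed (M : manifold R) (n : nat) (f : 'I_n -> M) (P : set 'I_n) :
  closed (f @` P).
Proof.
have /accessible_finite_set_closed := hausdorff_accessible
  (@manifold_hausdorff _ M).
by apply; apply: finite_image; exact: finite_finset.
Qed.

Lemma chart_openD (M : manifold R) (f : chart R M) n (g : 'I_n -> M) P :
  atlas f -> open (cdom f `\` g @` P).
Proof.
move=> af; rewrite setDE; apply: openI; first by have [] := atlas_chart af.
exact/closed_openC/finite_closed.
Qed.

Lemma in_imageC (T : Type) n (f : 'I_n -> T) j :
  injective f -> ~ (f @` [set~ j]) (f j).
Proof. by move=> fi [k kj /fi]. Qed.

Lemma notin_imageC (T : Type) n (f : 'I_n -> T) j k :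
  ~ (f @` [set~ j]) (f k) -> k = j.
Proof.
by move=> h; apply: contrapT => kj; apply: h; exists k.
Qed.

Section MiddleChart.
Context (j : 'I_(size b)) (f : chart R K) (g : chart R L).
Hypotheses (af : atlas f) (ag : atlas g).
Hypotheses (fj : cdom f (cob_out K j)) (fe : cmap f (cob_out K j) = glue_end j).
Hypotheses (gj : cdom g (cob_in L j)) (ge : cmap g (cob_in L j) = 1 - glue_end j).

Lemma middle_dom k :
  (cdom f `\` cob_out K @` [set~ j]) (cob_out K k) <->
  (cdom g `\` cob_in L @` [set~ j]) (cob_in L k).
Proof.
split=> -[_ /notin_imageC ->]; split=> //; apply: in_imageC.
  exact: cob_in_inj.
exact: cob_out_inj.
Qed.

Lemma middle_map k : (cdom f `\` cob_out K @` [set~ j]) (cob_out K k) ->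
  (half_map (glue_end j) \o cmap f) (cob_out K k) =
  (half_map (1 - glue_end j) \o cmap g) (cob_in L k).
Proof. by move=> [_ /notin_imageC ->] /=; rewrite fe ge !half_end. Qed.

Lemma middle_eq x y : cdom f x -> cdom g y ->
  half_map (glue_end j) (cmap f x) = half_map (1 - glue_end j) (cmap g y) ->
  x = cob_out K j /\ y = cob_in L j.
Proof.
move=> fx gy; rewrite /half_map => e.
have [_ /andP[f0 f1] _] := chart_local af fx.
have [_ /andP[g0 g1] _] := chart_local ag gy.
split; [apply: (chart_inj af) => //; rewrite fe|apply: (chart_inj ag) => //;
  rewrite ge]; case: (glue_end01 j) e => -> e; lra.
Qed.

Lemma middle_is_chart : is_chart (glue_chartm j f g).
Proof.
apply: glue_is_chart.
- exact: middle_dom.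
- exact: middle_map.
- exact: chart_openD.
- exact: chart_openD.
- by move=> x y [fx _] [fy _] /half_inj; exact: chart_inj.
- by move=> x y [fx _] [fy _] /half_inj; exact: chart_inj.
- by move=> x y [fx _] [gy _] /middle_eq h; exists j; exact: h.
- move=> x [fx _]; have [fc f01 _] := chart_local af fx.
  by split; [exact: half_continuous|exact: half01 (glue_end01 j) _].
- move=> x [gx _]; have [gc g01 _] := chart_local ag gx.
  by split; [exact: half_continuous|exact: half01 (glue_end01C j) _].
- move=> x [fx _] xj; apply: half_chart_at (glue_end01 j) (chart_local af fx) _.
  by rewrite -fe => /(chart_inj af fx fj); exact: xj.
- move=> x [gx _] xj; apply: half_chart_at (glue_end01C j) (chart_local ag gx) _.
  by rewrite -ge => /(chart_inj ag gx gj); exact: xj.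
move=> k [_ /notin_imageC ->] W W' nW nW'.
have [_ _ /(_ _ nW)[r r0 hr]] := chart_local af fj.
have [_ _ /(_ _ nW')[r' r'0 hr']] := chart_local ag gj.
exists (Num.min (r / 2) (r' / 2)); first by rewrite lt_min !divr_gt0.
move=> t /andP[t0 t1] /=; rewrite fe half_end lt_min !ltr_norml.
move=> /andP[/andP[? ?] /andP[? ?]].
have [tj|tj] : (0 <= 2 * t - (1 - glue_end j) <= 1) \/
               (0 <= 2 * t - glue_end j <= 1).
- have [] := leP t (1 / 2) => th; case: (glue_end01 j) => ->; [right|left|left|right];
  apply/andP; split; lra.
- left; have [|y Wy yt] := hr _ tj.
    by rewrite fe ltr_norml; apply/andP; split; lra.
  by exists y => //=; rewrite yt /half_map; lra.
- right; have [|y Wy yt] := hr' _ tj.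
    by rewrite ge ltr_norml; apply/andP; split; lra.
  by exists y => //=; rewrite yt /half_map; lra.
Qed.

End MiddleChart.

Lemma out_dom (f : chart R K) k :
  (cdom f `\` range (cob_out K)) (cob_out K k) <-> set0 (cob_in L k).
Proof. by split=> // -[_ []]; exists k. Qed.

Lemma in_dom (g : chart R L) k :
  set0 (cob_out K k) <-> (cdom g `\` range (cob_in L)) (cob_in L k).
Proof. by split=> // -[_ []]; exists k. Qed.

Lemma left_is_chart f : atlas f -> is_chart (glue_chartl f).
Proof.
move=> af; apply: glue_is_chart => //.
- exact: out_dom.
- by move=> j /out_dom.
- exact: chart_openD.
- exact: open0.
- by move=> x y [fx _] [fy _]; exact: chart_inj.
- by move=> x [fx _]; have [] := chart_local af fx.
- by move=> x [fx _] _; exact: chart_local.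
- by move=> j /out_dom.
Qed.

Lemma right_is_chart g : atlas g -> is_chart (glue_chartr g).
Proof.
move=> ag; apply: glue_is_chart => //.
- exact: in_dom.
- exact: open0.
- exact: chart_openD.
- by move=> x y [gx _] [gy _]; exact: chart_inj.
- by move=> x [gx _]; have [] := chart_local ag gx.
- by move=> x [gx _] _; exact: chart_local.
Qed.

Lemma glue_atlas_chart e : glue_atlas e -> is_chart e.
Proof.
case=> [f|g|j f g af ag]; [exact: left_is_chart|exact: right_is_chart|].
exact: middle_is_chart.
Qed.

Lemma out_chart j : exists2 f, atlas f &
  cdom f (cob_out K j) /\ cmap f (cob_out K j) = glue_end j.
Proof.
have [f af [fj fe]] := cob_out_sign K j; exists f => //; split => //.
by rewrite fe /glue_end; case: nth.
Qed.

Lemma in_chart j : exists2 g, atlas g &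
  cdom g (cob_in L j) /\ cmap g (cob_in L j) = 1 - glue_end j.
Proof.
have [g ag [gj ge]] := cob_in_sign L j; exists g => //; split => //.
by rewrite ge /glue_end; case: nth; rewrite ?subrr ?subr0.
Qed.

Lemma glue_atlas_cover p : exists2 e, glue_atlas e & cdom e p.
Proof.
have [[j pj]|np] := pselect (exists j, p = gluel (cob_out K j)).
  have [f af [fj fe]] := out_chart j; have [g ag [gj ge]] := in_chart j.
  exists (glue_chartm j f g); first exact: GlueM.
  rewrite pj; left; exists (cob_out K j) => //; split=> //.
  exact/in_imageC/cob_out_inj.
case: (glue_cover p) => -[x px].
- have [f af fx] := atlas_cover x; exists (glue_chartl f); first exact: GlueL.
  left; exists x => //; split=> // -[j _ e]; apply: np.
  by exists j; rewrite e.
- have [g ag gx] := atlas_cover x; exists (glue_chartr g); first exact: GlueR.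
  right; exists x => //; split=> // -[j _ e]; apply: np.
  by exists j; rewrite px -e; apply/esym/gluelrP; exists j.
Qed.

Lemma glue_atlasl e x : glue_atlas e -> cdom e (gluel x) ->
  exists2 f, atlas f & cdom f x /\ exists r s, 0 < s /\
    nbhs x [set y | cdom e (gluel y) /\ cmap e (gluel y) = r + s * cmap f y].
Proof.
case=> [f af|g ag|j f g af ag fj fe gj ge].
- move=> /(glue_doml _ _ (@out_dom f)) Ux; exists f => //; split; first by case: Ux.
  exists 0, 1; split=> //.
  have := open_nbhs_nbhs (conj (chart_openD _ _ af) Ux); apply: filterS => y Uy.
  split; first exact/(glue_doml _ _ (@out_dom f)).
  by rewrite add0r mul1r; apply: (glue_mapl _ _ Uy) => k /out_dom.
- by move=> /(glue_doml _ _ (@in_dom g)).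
- have D := @middle_dom j f g fj gj.
  have E := middle_map fe ge.
  move=> /(glue_doml _ _ D) Ux; exists f => //; split; first by case: Ux.
  exists ((1 - glue_end j) / 2), 2^-1; split; first by rewrite invr_gt0.
  have := open_nbhs_nbhs (conj (chart_openD _ _ af) Ux); apply: filterS => y Uy.
  split; first exact/(glue_doml _ _ D).
  by rewrite [LHS](glue_mapl _ E Uy) /= /half_map; lra.
Qed.

Lemma glue_atlasr e x : glue_atlas e -> cdom e (gluer x) ->
  exists2 f, atlas f & cdom f x /\ exists r s, 0 < s /\
    nbhs x [set y | cdom e (gluer y) /\ cmap e (gluer y) = r + s * cmap f y].
Proof.
case=> [f af|g ag|j f g af ag fj fe gj ge].
- by move=> /(glue_domr _ _ (@out_dom f)).
- move=> /(glue_domr _ _ (@in_dom g)) Ux; exists g => //; split; first by case: Ux.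
  exists 0, 1; split=> //.
  have := open_nbhs_nbhs (conj (chart_openD _ _ ag) Ux); apply: filterS => y Uy.
  split; first exact/(glue_domr _ _ (@in_dom g)).
  by rewrite add0r mul1r; apply: (glue_mapr (@in_dom g) _ Uy).
- have D := @middle_dom j f g fj gj.
  have E := middle_map fe ge.
  move=> /(glue_domr _ _ D) Ux; exists g => //; split; first by case: Ux.
  exists (glue_end j / 2), 2^-1; split; first by rewrite invr_gt0.
  have := open_nbhs_nbhs (conj (chart_openD _ _ ag) Ux); apply: filterS => y Uy.
  split; first exact/(glue_domr _ _ D).
  by rewrite [LHS](glue_mapr D E Uy) /= /half_map; lra.
Qed.

Lemma glue_atlasm e j : glue_atlas e -> cdom e (gluel (cob_out K j)) ->
  [/\ nbhs (cob_out K j) [set x | if nth true b j then cmap e (gluel x) <= 1 / 2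
                                  else 1 / 2 <= cmap e (gluel x)],
      nbhs (cob_in L j) [set y | if nth true b j then 1 / 2 <= cmap e (gluer y)
                                 else cmap e (gluer y) <= 1 / 2] &
      cmap e (gluel (cob_out K j)) = 1 / 2].
Proof.
case=> [f af|g ag|k f g af ag fj fe gj ge].
- by move=> /(glue_doml _ _ (@out_dom f))/out_dom.
- by move=> /(glue_doml _ _ (@in_dom g)).
have D := @middle_dom k f g fj gj.
have E := middle_map fe ge.
move=> /(glue_doml _ _ D) Ux; have jk : j = k by case: Ux => _ /notin_imageC.
subst k; have Vx : (cdom g `\` cob_in L @` [set~ j]) (cob_in L j) by apply/D.
split.
- have := open_nbhs_nbhs (conj (chart_openD _ _ af) Ux); apply: filterS => y Uy.
  rewrite /= [glue_fun _ _ _](glue_mapl set0 E Uy) /= /half_map.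
  have [fy _] := Uy; have [_ /andP[f0 f1] _] := chart_local af fy.
  by rewrite /glue_end; case: nth; lra.
- have nV : nbhs (cob_in L j) (cdom g `\` cob_in L @` [set~ j]).
    by apply: open_nbhs_nbhs; split=> //; exact: chart_openD.
  apply: (filterS _ nV) => y Uy.
  rewrite /= [glue_fun _ _ _](glue_mapr D E Uy) /= /half_map.
  have [gy _] := Uy; have [_ /andP[g0 g1] _] := chart_local ag gy.
  by rewrite /glue_end; case: nth; lra.
- by rewrite [LHS](glue_mapl _ E Ux) /= fe half_end.
Qed.

Lemma glue_orientedl e d x : glue_atlas e -> glue_atlas d ->
  cdom e (gluel x) -> cdom d (gluel x) ->
  nbhs x (cdom d \o gluel) /\ exists2 W, nbhs x W & forall y z, W y -> W z ->
  cmap e (gluel y) < cmap e (gluel z) -> cmap d (gluel y) < cmap d (gluel z).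
Proof.
move=> ae ad ex dx.
have [f af [fx [r [s [s0 nf]]]]] := glue_atlasl ae ex.
have [g ag [gx [r' [s' [s'0 ng]]]]] := glue_atlasl ad dx.
split; first by apply: filterS ng => y [].
have [W nW hW] := atlas_oriented af ag fx gx.
exists (W `&` [set y | cdom e (gluel y) /\ cmap e (gluel y) = r + s * cmap f y]
  `&` [set y | cdom d (gluel y) /\ cmap d (gluel y) = r' + s' * cmap g y]).
  by apply: filterI => //; apply: filterI.
move=> y z [[Wy [_ /= ->]] [_ ->]] [[Wz [_ ->]] [_ ->]].
by rewrite !ltrD2l !ltr_pM2l //; exact: hW.
Qed.

Lemma glue_orientedr e d x : glue_atlas e -> glue_atlas d ->
  cdom e (gluer x) -> cdom d (gluer x) ->
  nbhs x (cdom d \o gluer) /\ exists2 W, nbhs x W & forall y z, W y -> W z ->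
  cmap e (gluer y) < cmap e (gluer z) -> cmap d (gluer y) < cmap d (gluer z).
Proof.
move=> ae ad ex dx.
have [f af [fx [r [s [s0 nf]]]]] := glue_atlasr ae ex.
have [g ag [gx [r' [s' [s'0 ng]]]]] := glue_atlasr ad dx.
split; first by apply: filterS ng => y [].
have [W nW hW] := atlas_oriented af ag fx gx.
exists (W `&` [set y | cdom e (gluer y) /\ cmap e (gluer y) = r + s * cmap f y]
  `&` [set y | cdom d (gluer y) /\ cmap d (gluer y) = r' + s' * cmap g y]).
  by apply: filterI => //; apply: filterI.
move=> y z [[Wy [_ /= ->]] [_ ->]] [[Wz [_ ->]] [_ ->]].
by rewrite !ltrD2l !ltr_pM2l //; exact: hW.
Qed.

Lemma glue_atlas_oriented e d p : glue_atlas e -> glue_atlas d ->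
  cdom e p -> cdom d p -> increasing_at id e d p.
Proof.
move=> ae ad ep dp.
have [[j pj]|np] := pselect (exists j, p = gluel (cob_out K j)); last first.
  case: (glue_cover p) => -[x px]; subst p.
  - have [_ [W nW hW]] := glue_orientedl ae ad ep dp.
    exists [set q | (forall y, gluel y = q -> W y) /\
                    (forall y, gluer y = q -> False)].
      apply: (@glue_nbhs W set0) => [y /gluel_inj -> //|y /esym/gluelrP[j [xj _]]].
      by case: np; exists j; rewrite xj.
    move=> q r [qW qn] [rW rn].
    case: (glue_cover q) => -[y qy]; last by case: (qn y).
    case: (glue_cover r) => -[z rz]; last by case: (rn z).
    by subst q r; apply: hW; [exact: qW|exact: rW].
  - have [_ [W nW hW]] := glue_orientedr ae ad ep dp.
    exists [set q | (forall y, gluel y = q -> False) /\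
                    (forall y, gluer y = q -> W y)].
      apply: (@glue_nbhs set0 W) => [y /gluelrP[j [xj xj']]|y /gluer_inj -> //].
      by case: np; exists j; apply/esym/gluelrP; exists j.
    move=> q r [qn qW] [rn rW].
    case: (glue_cover q) => -[y qy]; first by case: (qn y).
    case: (glue_cover r) => -[z rz]; first by case: (rn z).
    by subst q r; apply: hW; [exact: qW|exact: rW].
have pj' : p = gluer (cob_in L j) by rewrite pj; apply/gluelrP; exists j.
have epl := ep; rewrite pj in epl; have epr := ep; rewrite pj' in epr.
have dpl := dp; rewrite pj in dpl; have dpr := dp; rewrite pj' in dpr.
have [nl [W nW hW]] := glue_orientedl ae ad epl dpl.
have [nr [W' nW' hW']] := glue_orientedr ae ad epr dpr.
have [el er eE] := glue_atlasm ae epl.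
have [dl dr dE] := glue_atlasm ad dpl.
have [_ di _ _] := glue_atlas_chart ad.
have half_uniq q : cdom d q -> cmap d q = 1 / 2 -> q = p.
  by move=> dq q2; apply: di; rewrite ?inE // q2 -dE -pj.
have eE' : cmap e p = 1 / 2 by rewrite pj.
pose low (f : chart R glue_space) q : bool := cmap f q <= 1 / 2.
pose high (f : chart R glue_space) q : bool := 1 / 2 <= cmap f q.
pose A := (W `&` (cdom d \o gluel)) `&`
  [set x | if nth true b j then low e (gluel x) && low d (gluel x)
           else high e (gluel x) && high d (gluel x)].
pose B := (W' `&` (cdom d \o gluer)) `&`
  [set x | if nth true b j then high e (gluer x) && high d (gluer x)
           else low e (gluer x) && low d (gluer x)].
have nA : nbhs (cob_out K j) A.
  apply: filterI; first exact: filterI.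
  by apply: filterS2 el dl => x /=; rewrite /low /high; case: nth => -> ->.
have nB : nbhs (cob_in L j) B.
  apply: filterI; first exact: filterI.
  by apply: filterS2 er dr => x /=; rewrite /low /high; case: nth => -> ->.
exists [set q | (forall y, gluel y = q -> A y) /\
                (forall y, gluer y = q -> B y)].
  apply: glue_nbhs => y; first by rewrite pj => /gluel_inj ->.
  by rewrite pj' => /gluer_inj ->.
move=> q r [ql qr] [rl rr].
case: (glue_cover q) => -[y qy]; case: (glue_cover r) => -[z rz].
- have [[Wy _] _] := ql _ (esym qy); have [[Wz _] _] := rl _ (esym rz).
  by rewrite qy rz; exact: hW.
- have [[_ dy] /= ey1] := ql _ (esym qy).
  have [[_ dz] /= ez1] := rr _ (esym rz).
  move: ey1 ez1; rewrite -!qy -!rz /low /high.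
  case: nth => /andP[ey1 dy1] /andP[ez1 dz1] qr'; last first.
    by lra.
  rewrite lt_neqAle (le_trans dy1 dz1) andbT; apply/eqP => E.
  have q2 : cmap d q = 1 / 2 by lra.
  have r2 : cmap d r = 1 / 2 by lra.
  have qp : q = p by apply: half_uniq => //; rewrite qy.
  have rp : r = p by apply: half_uniq => //; rewrite rz.
  by move: qr'; rewrite qp rp ltxx.
- have [[_ dy] /= ey1] := qr _ (esym qy).
  have [[_ dz] /= ez1] := rl _ (esym rz).
  move: ey1 ez1; rewrite -!qy -!rz /low /high.
  case: nth => /andP[ey1 dy1] /andP[ez1 dz1] qr'.
    by lra.
  rewrite lt_neqAle (le_trans dy1 dz1) andbT; apply/eqP => E.
  have q2 : cmap d q = 1 / 2 by lra.
  have r2 : cmap d r = 1 / 2 by lra.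
  have qp : q = p by apply: half_uniq => //; rewrite qy.
  have rp : r = p by apply: half_uniq => //; rewrite rz.
  by move: qr'; rewrite qp rp ltxx.
- have [[Wy _] _] := qr _ (esym qy); have [[Wz _] _] := rr _ (esym rz).
  by rewrite qy rz; exact: hW'.
Qed.

Definition glue_manifold : manifold R :=
  Manifold glue_hausdorff glue_compact glue_atlas_chart glue_atlas_cover
    glue_atlas_oriented.

Definition glue_in (i : 'I_(size a)) : glue_manifold := gluel (cob_in K i).
Definition glue_out (k : 'I_(size c)) : glue_manifold := gluer (cob_out L k).

Lemma glue_in_inj : injective glue_in.
Proof. by move=> i j /gluel_inj/cob_in_inj. Qed.

Lemma glue_out_inj : injective glue_out.
Proof. by move=> i j /gluer_inj/cob_out_inj. Qed.

Lemma glue_in_out i k : glue_in i <> glue_out k.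
Proof. by move=> /gluelrP[j [/cob_in_out]]. Qed.

Lemma glue_in_sign (i : 'I_(size a)) : boundary (nth true a i) (glue_in i).
Proof.
have [f af [fi fe]] := cob_in_sign K i.
have Ui : (cdom f `\` range (cob_out K)) (cob_in K i).
  by split=> // -[j _ /esym/cob_in_out].
exists (glue_chartl f); [exact: GlueL|split; first by left; exists (cob_in K i)].
by rewrite [LHS](glue_mapl _ _ Ui) // => j /out_dom.
Qed.

Lemma glue_out_sign (k : 'I_(size c)) : boundary (~~ nth true c k) (glue_out k).
Proof.
have [g ag [gk ge]] := cob_out_sign L k.
have Vk : (cdom g `\` range (cob_in L)) (cob_out L k).
  by split=> // -[j _ /cob_in_out].
exists (glue_chartr g); [exact: GlueR|split; first by right; exists (cob_out L k)].
by rewrite [LHS](glue_mapr (@in_dom g) _ Vk).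
Qed.

Lemma glue_boundary s (p : glue_manifold) : boundary s p ->
  (exists i, p = glue_in i) \/ (exists k, p = glue_out k).
Proof.
case=> e ae [ep es].
have [[j pj]|np] := pselect (exists j, p = gluel (cob_out K j)).
  have := ep; rewrite pj => epj; have [_ _ epj2] := glue_atlasm ae epj.
  by move: es; rewrite pj epj2 => /half_neq_end.
have left_case x : p = gluel x -> (exists s', boundary s' x) ->
    (exists i, p = glue_in i) \/ (exists k, p = glue_out k).
  move=> px [s' /cob_boundary[[i xi]|[j xj]]]; first by left; exists i; rewrite px xi.
  by case: np; exists j; rewrite px xj.
have right_case y : p = gluer y -> (exists s', boundary s' y) ->
    (exists i, p = glue_in i) \/ (exists k, p = glue_out k).
  move=> py [s' /cob_boundary[[j yj]|[k yk]]]; last by right; exists k; rewrite py yk.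
  by case: np; exists j; rewrite py yj; apply/esym/gluelrP; exists j.
case: (glue_cover p) => -[x px]; [apply: (left_case x px)|apply: (right_case x px)];
  exists s; move: ep es; rewrite px.
- case: ae => [f af|g ag|j f g af ag fj fe gj ge].
  + move=> /(glue_doml _ _ (@out_dom f)) Ux.
    rewrite (glue_mapl _ _ Ux) => [fx|k /out_dom//].
    by exists f => //; split=> //; case: Ux.
  + by move=> /(glue_doml _ _ (@in_dom g)).
  + have D := @middle_dom j f g fj gj; have E := middle_map fe ge.
    move=> /(glue_doml _ _ D) Ux; rewrite (glue_mapl _ E Ux) /= => es.
    have fx : cdom f x by case: Ux.
    have [_ f01 _] := chart_local af fx.
    by exists f => //; split=> //; apply: half_eq_end es (glue_end01 j) f01.
- case: ae => [f af|g ag|j f g af ag fj fe gj ge].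
  + by move=> /(glue_domr _ _ (@out_dom f)).
  + move=> /(glue_domr _ _ (@in_dom g)) Ux.
    rewrite (glue_mapr (@in_dom g) _ Ux) // => gx.
    by exists g => //; split=> //; case: Ux.
  + have D := @middle_dom j f g fj gj; have E := middle_map fe ge.
    move=> /(glue_domr _ _ D) Ux; rewrite (glue_mapr D E Ux) /= => es.
    have gx : cdom g x by case: Ux.
    have [_ g01 _] := chart_local ag gx.
    by exists g => //; split=> //; apply: half_eq_end es (glue_end01C j) g01.
Qed.

(* [L] after [K]. *)
Definition cob_comp : cobordism R a c :=
  Cobordism glue_in_inj glue_out_inj glue_in_out glue_in_sign glue_out_sign
    glue_boundary.
End Gluing.

(* The commutation matrix S_(n,m) : K^n (x) K^m -> K^m (x) K^n, which sends
   e_i (x) f_j to f_j (x) e_i; [mxtens_index (i, j)] is the position of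
   e_i (x) f_j in the lexicographically ordered basis. *)
Definition commutation_mx (F : fieldType) (n m : nat) : 'M[F]_(m * n, n * m) :=
  \matrix_(k, l) (((mxtens_unindex k).1 == (mxtens_unindex l).2) &&
                  ((mxtens_unindex k).2 == (mxtens_unindex l).1))%:R.

(* Strict symmetric monoidal functors from 1Cob to Mat_F.  The operations on
   classes of cobordisms are given by representatives. *)
Record strict_tqft (R : realType) (F : fieldType) := StrictTqft {
  tqft_ob : seq bool -> nat;
  tqft_mor : forall a b, cob_hom R a b -> 'M[F]_(tqft_ob b, tqft_ob a);
  tqft_id : forall a, tqft_mor (cob_class (cob_id a)) = 1%:M;
  tqft_comp : forall a b c (K : cobordism R a b) (L : cobordism R b c),
    tqft_mor (cob_class (cob_comp K L)) =
    tqft_mor (cob_class L) *m tqft_mor (cob_class K);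
  tqft_unit : tqft_ob [::] = 1%N;
  tqft_cat : forall a b, tqft_ob (a ++ b) = (tqft_ob a * tqft_ob b)%N;
  tqft_tensor : forall a b c d (K : cobordism R a b) (L : cobordism R c d),
    castmx (tqft_cat b d, tqft_cat a c)
      (tqft_mor (cob_class (cob_tensor K L))) =
    tensmx (tqft_mor (cob_class K)) (tqft_mor (cob_class L));
  tqft_sym : forall a b,
    castmx (tqft_cat b a, tqft_cat a b)
      (tqft_mor (cob_class (cob_sym a b))) =
    commutation_mx F (tqft_ob a) (tqft_ob b) }.

(* Main.v *)
Require Import Defs.
From mathcomp Require Import all_boot all_order all_algebra.
From mathcomp Require Import all_classical all_reals all_analysis.
From mathcomp Require Import mxtens ring lra.

(* Clopen sets play the role of H^0, and all topology rests on one fact: a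
   cobordism is determined up to equivalence by its number of circles and by
   which of its boundary points lie in the same component.

   Classification.  Starting from a point, an injective curve is prolonged along
   the charts of a finite cover.  It can meet itself again only at its starting
   point, so after finitely many steps it either closes up or reaches a terminal
   boundary point.  Images of closed curves and of curves between boundary points
   are clopen, hence they are the components, and mapping the components of two
   cobordisms to each other by their parametrizations is a homeomorphism.

   Values.  The zigzag identity makes the functor send the circle to the trace of
   an identity matrix of size p = F(+), so it sends a closed manifold with k
   circles to p^k, which determines k.

   Faithfulness.  Let F(K) = F(L).  For X = K or L, glue the reversal of X to K and
   to L along the whole boundary: F takes the same value on the two closed
   manifolds, so they have the same number of circles, hence of clopen subsets.
   If n_K(v) is the number of clopen subsets of K with trace v on the boundary,
   this number is the sum over v of n_X(v) n_K(v), respectively n_X(v) n_L(v).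
   So the sums of n_K^2, n_K n_L and n_L^2 agree, the sum of (n_K - n_L)^2
   vanishes, and n_K = n_L; this function determines the circles and the
   connected boundary points. *)

Module Faithfulness.

Set Implicit Arguments.
Unset Strict Implicit.
Unset Printing Implicit Defensive.

Import Order.TTheory GRing.Theory Num.Theory.
Import numFieldNormedType.Exports.

Local Open Scope classical_set_scope.
Local Open Scope ring_scope.

(** * Immersed curves *)

(** [n] bounds the number of hypotheses chained together, so that the search terminates. *)
Ltac chain n := first
  [ assumption
  | match goal with |- is_true (?x <= ?x) => exact: lexx end
  | match goal with
    | H : is_true (?x < ?y) |- is_true (?x <= ?y) => exact: (ltW H) end
  | lazymatch n with O => fail | S ?m =>
    match goal with
    | H : is_true (?x < ?z) |- is_true (?x < ?y) =>
        apply: (lt_le_trans H); chain m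
    | H : is_true (?x <= ?z) |- is_true (?x < ?y) =>
        apply: (le_lt_trans H); chain m
    | H : is_true (?x <= ?z) |- is_true (?x <= ?y) =>
        apply: (le_trans H); chain m
    | H : is_true (?x < ?z) |- is_true (?x <= ?y) =>
        apply: (le_trans (ltW H)); chain m
    end end ].

(** A goal that neither [chain] nor [lra] closes is left to the caller, already split at its
    conjunctions. *)
Ltac bounds := repeat match goal with
  | H : is_true (_ && _) |- _ => case/andP: H => ? ?
  | H : is_true (_ < Num.min _ _) |- _ => rewrite lt_min in H
  | |- is_true (_ < Num.min _ _) => rewrite lt_min
  | |- is_true (_ && _) => apply/andP; split
  end; lazymatch goal with
  | |- is_true _ => first [chain 2%N |
      repeat match goal with
      | H : is_true (`|_| < _) |- _ => rewrite ltr_norml in H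
      | H : is_true (_ && _) |- _ => case/andP: H => ? ?
      | |- is_true (`|_| < _) => rewrite ltr_norml
      | |- is_true (_ && _) => apply/andP; split
      end; lra | idtac]
  | |- _ => idtac
  end.

(** * Signs of boundary points *)

Section Boundary.
Context {R : realType} {M : manifold R}.
Implicit Types (c d : chart R M) (x y : M).

Lemma cmap01 c x : atlas c -> cdom c x -> 0 <= cmap c x <= 1.
Proof. by move=> ac cx; have [] := chart_local ac cx. Qed.

(** If [cmap c x] were not extreme, the chart [c] would contain points just beyond [x], and there
    the compatible chart [d] would take values below 0 or above 1. *)
Lemma boundary_cmap s c x : boundary s x -> atlas c -> cdom c x ->
  cmap c x = if s then 0 else 1.
Proof.
move=> [d ad [dx ds]] ac cx.
have [W nW hW] := atlas_oriented ac ad cx dx.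
have [_ /andP[c0 c1] /(_ _ (filterI nW (chart_nbhs ad dx)))[e e0 he]] :=
  chart_local ac cx.
case: s ds => ds.
  apply/eqP; rewrite eq_le c0 andbT leNgt; apply/negP => cp.
  (* The minimum keeps the new value in [0, 1] and within [e] of the old one. *)
  have [||y [Wy dy] yt] := he (cmap c x - Num.min (e / 2) (cmap c x)).
  - by case: (ltP (e / 2) (cmap c x)) => ?; bounds.
  - by case: (ltP (e / 2) (cmap c x)) => ?; bounds.
  have := hW y x Wy (nbhs_singleton nW); rewrite yt ds.
  have /andP[? _] := cmap01 ad dy.
  by case: (ltP (e / 2) (cmap c x)) => ? /(_ ltac:(lra)); lra.
apply/eqP; rewrite eq_le c1 /= leNgt; apply/negP => cp.
have [||y [Wy dy] yt] := he (cmap c x + Num.min (e / 2) (1 - cmap c x)).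
- by case: (ltP (e / 2) (1 - cmap c x)) => ?; bounds.
- by case: (ltP (e / 2) (1 - cmap c x)) => ?; bounds.
have := hW x y (nbhs_singleton nW) Wy; rewrite yt ds.
have /andP[_ ?] := cmap01 ad dy.
by case: (ltP (e / 2) (1 - cmap c x)) => ? /(_ ltac:(lra)); lra.
Qed.

Lemma boundary_sign s s' x : boundary s x -> boundary s' x -> s = s'.
Proof.
move=> bs [c ac [cx]]; rewrite (boundary_cmap bs ac cx).
by case: s s' {bs} => -[] // /eqP; rewrite ?oner_eq0 // eq_sym oner_eq0.
Qed.

End Boundary.

Section Curves.
Context {R : realType} {M : manifold R}.
Implicit Types (c d : chart R M) (x y : M) (g h : R -> M).

(* An immersed path: continuous and locally increasing, but maybe not
   injective. *)
Definition curve g (a b : R) : Prop := forall t, a <= t <= b ->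
  (forall W, nbhs (g t) W -> exists2 e : R, 0 < e &
     forall u, a <= u <= b -> `|u - t| < e -> W (g u)) /\
  (forall c, atlas c -> cdom c (g t) -> exists2 e : R, 0 < e &
     forall u v, a <= u <= b -> a <= v <= b -> `|u - t| < e -> `|v - t| < e ->
     u < v -> cmap c (g u) < cmap c (g v)).

Lemma curve_window g a b t c W : curve g a b -> a <= t <= b -> atlas c ->
  cdom c (g t) -> nbhs (g t) W -> exists2 e : R, 0 < e &
  forall u, a <= u <= b -> `|u - t| < e -> [/\ W (g u), cdom c (g u) &
    forall v, a <= v <= b -> `|v - t| < e -> u < v ->
      cmap c (g u) < cmap c (g v)].
Proof.
move=> cg tab ac ct nW; have [gc gm] := cg _ tab.
have [e e0 he] := gc _ (filterI nW (chart_nbhs ac ct)).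
have [e' e'0 he'] := gm _ ac ct.
exists (Num.min e e') => [|u uab ue]; first by rewrite lt_min e0.
have [] := he u uab; first by bounds.
by move=> Wu cu; split=> // v vab ve uv; apply: he' => //; bounds.
Qed.

(** Transition maps are locally increasing, so monotony in one chart at each parameter carries over
    to all charts there. *)
Lemma curve_chart g a b : (forall t, a <= t <= b ->
  (forall W, nbhs (g t) W -> exists2 e : R, 0 < e &
     forall u, a <= u <= b -> `|u - t| < e -> W (g u)) /\
  exists c, [/\ atlas c, cdom c (g t) & exists2 e : R, 0 < e &
     forall u v, a <= u <= b -> a <= v <= b -> `|u - t| < e -> `|v - t| < e ->
     u < v -> cmap c (g u) < cmap c (g v)]) -> curve g a b.
Proof.
move=> H t tab; have [gc [c [ac ct [e e0 he]]]] := H _ tab.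
split=> // d ad dt.
have [W nW hW] := atlas_oriented ac ad ct dt.
have [e' e'0 he'] := gc _ nW.
exists (Num.min e e') => [|u v uab vab ue ve uv]; first by rewrite lt_min e0.
by apply: hW; [apply: he' => //; bounds..|apply: he => //; bounds].
Qed.

Lemma curve_sub g a b a' b' : a <= a' -> b' <= b -> curve g a b -> curve g a' b'.
Proof.
move=> aa bb cg t tab; have tab' : a <= t <= b by bounds.
have [gc gm] := cg _ tab'; split=> [W /gc[e e0 he]|c ac /(gm _ ac)[e e0 he]];
  exists e => //.
- by move=> u uab; apply: he; bounds.
- by move=> u v uab vab; apply: he; bounds.
Qed.

Lemma curve_affine g a b k l : 0 < k -> curve g (k * a + l) (k * b + l) ->
  curve (fun u => g (k * u + l)) a b.
Proof.
move=> k0 cg t tab.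
have sc u : a <= u <= b -> k * a + l <= k * u + l <= k * b + l.
  by move=> /andP[? ?]; rewrite !lerD2r !ler_pM2l //; apply/andP.
have sd u e : `|u - t| < e / k -> `|k * u + l - (k * t + l)| < e.
  rewrite (_ : k * u + l - _ = k * (u - t)); last by ring.
  by rewrite normrM gtr0_norm // ltr_pdivlMr // mulrC.
have [gc gm] := cg _ (sc _ tab).
split=> [W /gc[e e0 he]|c ac /(gm _ ac)[e e0 he]]; exists (e / k);
  rewrite ?divr_gt0 //.
- by move=> u uab /sd; apply: he; exact: sc.
- move=> u v uab vab /sd ue /sd ve uv; apply: he => //; try exact: sc.
  by rewrite ltrD2r ltr_pM2l.
Qed.

Definition concat (T : Type) (g h : R -> T) (b u : R) : T :=
  if u <= b then g u else h u.

Lemma concatl (T : Type) (g h : R -> T) b u : u <= b -> concat g h b u = g u.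
Proof. by rewrite /concat => ->. Qed.

Lemma concatr (T : Type) (g h : R -> T) b u : g b = h b -> b <= u ->
  concat g h b u = h u.
Proof.
rewrite /concat => e; rewrite le_eqVlt => /orP[/eqP <-|bu]; first by rewrite lexx.
by rewrite leNgt bu.
Qed.

Lemma curve_concat g h a b z : curve g a b -> curve h b z -> g b = h b ->
  a <= b -> b <= z -> curve (concat g h b) a z.
Proof.
move=> cg ch gh ab bd t tad.
have L u := @concatl M g h b u; have Rr u := @concatr M g h b u gh.
case: (ltgtP t b) => tb.
- have [|gc gm] := cg t; first by bounds.
  rewrite L 1?ltW //; split=> [W /gc[e e0 he]|c ac /(gm _ ac)[e e0 he]];
    exists (Num.min e (b - t)); rewrite ?lt_min ?e0 ?subr_gt0 //.
  + by move=> u ? ?; rewrite L; [apply: he|]; bounds.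
  + by move=> u v ? ? ? ? ?; rewrite !L; [apply: he| |]; bounds.
- have [|gc gm] := ch t; first by bounds.
  rewrite Rr 1?ltW //; split=> [W /gc[e e0 he]|c ac /(gm _ ac)[e e0 he]];
    exists (Num.min e (t - b)); rewrite ?lt_min ?e0 ?subr_gt0 //.
  + by move=> u ? ?; rewrite Rr; [apply: he|]; bounds.
  + by move=> u v ? ? ? ? ?; rewrite !Rr; [apply: he| |]; bounds.
subst t; have [|gc gm] := cg b; first by bounds.
have [|hc hm] := ch b; first by bounds.
rewrite L //; split=> [W nW|c ac cb].
  have [e e0 he] := gc _ nW; have [|f f0 hf] := hc W; first by rewrite -gh.
  exists (Num.min e f); rewrite ?lt_min ?e0 // => u ? ?.
  by case: (leP u b) => ub; [rewrite L //; apply: he|rewrite Rr 1?ltW //; apply: hf]; bounds.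
have [e e0 he] := gm _ ac cb; have [|f f0 hf] := hm _ ac; first by rewrite -gh.
exists (Num.min e f); rewrite ?lt_min ?e0 // => u v ? ? ? ? uv.
have bb : `|b - b| < Num.min e f by rewrite subrr normr0 lt_min e0.
case: (leP v b) => vb.
  by rewrite !L; [apply: he| |]; bounds.
case: (ltP b u) => ub.
  by rewrite !Rr; [apply: hf| |]; bounds.
(* The parameters lie on opposite sides of the seam: both values are compared with the value at
   [b]. *)
rewrite L // Rr 1?ltW //.
have : cmap c (h b) < cmap c (h v) by apply: hf; bounds.
move: ub; rewrite le_eqVlt => /orP[/eqP -> |ub]; rewrite -gh //.
by apply: lt_trans; apply: he; bounds.
Qed.

Lemma curve_continuous g a b : curve g a b -> {within `[a, b], continuous g}.
Proof.
move=> cg; apply/subspace_continuousP => t; rewrite /= in_itv /= => tab W nW.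
have [e e0 he] := (cg t tab).1 _ nW.
apply/nbhs_ballP; exists e => //= u tu; rewrite in_itv /= => uab.
by apply: he => //; move: tu; rewrite /ball /= distrC.
Qed.

Lemma curve_compact g a b a' b' : curve g a b -> a <= a' -> b' <= b ->
  compact (g @` `[a', b']).
Proof.
move=> cg aa bb; apply: continuous_compact; last exact: segment_compact.
exact/curve_continuous/(curve_sub aa bb cg).
Qed.

Lemma curve_closed g a b a' b' : curve g a b -> a <= a' -> b' <= b ->
  closed (g @` `[a', b']).
Proof.
move=> cg aa bb; apply: compact_closed; first exact: manifold_hausdorff.
exact: curve_compact cg aa bb.
Qed.

(** The intermediate value theorem in the chart; injectivity of the chart turns the equality of
    values into one of points. *)
Lemma curve_ivt g a b u v c y : curve g a b -> a <= u -> u <= v -> v <= b ->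
  atlas c -> (forall w, u <= w <= v -> cdom c (g w)) -> cdom c y ->
  cmap c (g u) <= cmap c y <= cmap c (g v) -> exists2 w, u <= w <= v & g w = y.
Proof.
move=> cg au uv vb ac cd cy uyv.
have [| |w] := @IVT R (cmap c \o g) u v (cmap c y) uv.
- apply/subspace_continuousP => t; rewrite /= in_itv /= => tuv W nW.
  have tab : a <= t <= b by bounds.
  have [cc _ _] := chart_local ac (cd _ tuv).
  have [e e0 he] := (cg t tab).1 _ (cc _ nW).
  apply/nbhs_ballP; exists e => //= w tw; rewrite in_itv /= => wuv.
  by apply: he; [bounds|move: tw; rewrite /ball /= distrC].
- by move: uyv => /andP[? ?]; rewrite /= min_l ?max_r; bounds.
- rewrite in_itv /= => wuv e; exists w => //.
  exact: (chart_inj ac (cd _ wuv) cy e).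
Qed.

(** Invariance of domain in dimension one: on each side of [t] either the curve runs on and
    [curve_ivt] yields all nearby chart values, or [g t] is a boundary point and the chart has no
    values on that side. *)
Lemma curve_nbhs g a b t e : curve g a b -> a <= t <= b ->
  (a < t \/ boundary true (g t)) -> (t < b \/ boundary false (g t)) -> 0 < e ->
  nbhs (g t) [set x | exists u, [/\ a <= u <= b, `|u - t| < e & g u = x]].
Proof.
move=> cg tab lt rt e0; have [c ac ct] := atlas_cover (g t).
have [f f0 hf] := curve_window cg tab ac ct filterT.
pose S x := exists u, [/\ a <= u <= b, `|u - t| < e & g u = x].
have tt (k : R) : 0 < k -> `|t - t| < k by rewrite subrr normr0.
have St : S (g t) by exists t; split=> //; exact: tt.
have [l l0 hl] : exists2 l : R, 0 < l & forall y, cdom c y ->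
    cmap c (g t) - l < cmap c y -> cmap c y <= cmap c (g t) -> S y.
  case: lt => [at_|bt]; last first.
    exists 1 => // y cy _ yt; suff <- : g t = y by [].
    apply: (chart_inj ac ct cy); apply/eqP; rewrite eq_le yt andbT.
    by rewrite (boundary_cmap bt ac ct); have /andP[] := cmap01 ac cy.
  (* [s] is close enough to [t] for both [e] and the window [f] of monotony; all values between
     those of [g s] and [g t] are then attained. *)
  have [s [sa st [se sf]]] : exists s, [/\ a <= s, s < t & t - s < e /\ t - s < f].
    pose k := Num.min (Num.min (e / 2) (f / 2)) (t - a).
    have : 0 < k by rewrite !lt_min; bounds.
    have : k <= e / 2 by rewrite /k !ge_min lexx.
    have : k <= f / 2 by rewrite /k !ge_min lexx orbT.
    have : k <= t - a by rewrite /k !ge_min lexx orbT.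
    by move=> ? ? ? ?; exists (t - k); split; [|..|split]; lra.
  have sab : a <= s <= b by bounds.
  have [|_ cs mono] := hf s sab; first by bounds.
  exists (cmap c (g t) - cmap c (g s)).
    by rewrite subr_gt0; apply: mono => //; exact: tt.
  move=> y cy ys yt.
  have [| | | | |w wst <-] := @curve_ivt g a b s t c y cg _ _ _ ac _ cy; try by bounds.
    by move=> w wst; have [||] := hf w; bounds.
  by exists w; split=> //; bounds.
have [r r0 hr] : exists2 l : R, 0 < l & forall y, cdom c y ->
    cmap c y < cmap c (g t) + l -> cmap c (g t) <= cmap c y -> S y.
  case: rt => [tb|bt]; last first.
    exists 1 => // y cy _ yt; suff <- : g t = y by [].
    apply: (chart_inj ac ct cy); apply/eqP; rewrite eq_le yt /=.
    by rewrite (boundary_cmap bt ac ct); have /andP[] := cmap01 ac cy.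
  have [s [sb st [se sf]]] : exists s, [/\ s <= b, t < s & s - t < e /\ s - t < f].
    pose k := Num.min (Num.min (e / 2) (f / 2)) (b - t).
    have : 0 < k by rewrite !lt_min; bounds.
    have : k <= e / 2 by rewrite /k !ge_min lexx.
    have : k <= f / 2 by rewrite /k !ge_min lexx orbT.
    have : k <= b - t by rewrite /k !ge_min lexx orbT.
    by move=> ? ? ? ?; exists (t + k); split; [|..|split]; lra.
  have sab : a <= s <= b by bounds.
  have [|_ _ mono] := hf t tab; first exact: tt.
  exists (cmap c (g s) - cmap c (g t)).
    by rewrite subr_gt0; apply: mono => //; bounds.
  move=> y cy ys yt.
  have [| | | | |w wst <-] := @curve_ivt g a b t s c y cg _ _ _ ac _ cy; try by bounds.
    by move=> w wst; have [||] := hf w; bounds.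
  by exists w; split=> //; bounds.
have [cc _ _] := chart_local ac ct.
have nb : nbhs (cmap c (g t)) (ball (cmap c (g t)) (Num.min l r)).
  by apply: (@nbhsx_ballx R R^o); rewrite lt_min l0.
have {}nb : nbhs (g t) (cmap c @^-1` ball (cmap c (g t)) (Num.min l r)).
  exact: cc nb.
apply: filterS (filterI nb (chart_nbhs ac ct)) => y [] /=; rewrite /ball /=.
rewrite distrC => yt cy; rewrite -/(S y).
by case: (leP (cmap c y) (cmap c (g t))) => ?; [apply: hl|apply: hr]; bounds.
Qed.

End Curves.

(** * Prolongation of curves *)

Lemma compact_finite_cover (T : topologicalType) (V : T -> set T) :
  compact [set: T] -> (forall x, nbhs x (V x)) ->
  exists s : seq T, forall y, exists2 x, x \in s & V x y.
Proof.
move=> cT nV; apply: contrapT => ns.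
(* The sets with finitely covered complement: without a finite cover of the whole space this filter
   is proper, and a cluster point [p] contradicts that [V p] covers itself. *)
pose F := [set A | exists s : seq T, forall y, ~ A y -> exists2 x, x \in s & V x y].
have FF : ProperFilter F.
  split=> [[s hs]|]; first by apply: ns; exists s => y; apply: hs.
  split=> [|A B [s hs] [t ht]|A B AB [s hs]]; first by exists [::] => y [].
    exists (s ++ t) => y AB; have [Ay|/hs[x xs Vx]] := pselect (A y).
      have [|x xt Vx] := ht y; first by move=> By; apply: AB.
      by exists x => //; rewrite mem_cat xt orbT.
    by exists x => //; rewrite mem_cat xs.
  by exists s => y nB; apply: hs => /AB.
have [|p [_ cp]] := cT F FF; first by exists [::] => y [].
have [|y [nVy Vy]] := cp (~` V p) (V p) _ (nV p).
  by exists [:: p] => y /contrapT Vy; exists p; rewrite ?mem_head.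
exact: nVy Vy.
Qed.

Section ChartInverse.
Context {R : realType} {M : manifold R}.
Implicit Types (c d : chart R M) (x y : M) (g h : R -> M) (a b t : R).

(* Meaningful only on the image of the chart; [x] is a default value. *)
Definition chart_inv c x (r : R) : M := xget x [set y | cdom c y /\ cmap c y = r].

Definition chart_covers c (s t : R) : Prop :=
  forall r, s <= r <= t -> exists y, cdom c y /\ cmap c y = r.

Lemma chart_invP c x s t r : chart_covers c s t -> s <= r <= t ->
  cdom c (chart_inv c x r) /\ cmap c (chart_inv c x r) = r.
Proof. by move=> cov /cov h; exact: (xgetPex x h). Qed.

Lemma chart_invK c x y : atlas c -> cdom c y -> chart_inv c x (cmap c y) = y.
Proof.
move=> ac cy; have [|cz e] := @xgetPex _ x [set z | cdom c z /\ cmap c z = cmap c y].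
  by exists y.
exact: (chart_inj ac cz cy e).
Qed.

(** Continuity of the inverse is the openness of the chart; read in [c] itself the path is the
    identity, hence increasing. *)
Lemma curve_chart_inv c x s t : atlas c -> chart_covers c s t ->
  curve (chart_inv c x) s t.
Proof.
move=> ac cov; apply: curve_chart => r rst.
have [cr er] := chart_invP x cov rst; split=> [W nW|].
  have [_ r01 h] := chart_local ac cr.
  have [e e0 he] := h _ (filterI nW (chart_nbhs ac cr)).
  exists e => // u ust ur; have [cu eu] := chart_invP x cov ust.
  have [||y [Wy cy] yu] := he u; first by rewrite -eu cmap01.
    by rewrite er.
  by rewrite -yu chart_invK.
exists c; split=> //; exists 1 => // u v ust vst _ _.
by rewrite (chart_invP x cov ust).2 (chart_invP x cov vst).2.
Qed.

Lemma local_cover x : exists c, exists2 e : R, 0 < e & [/\ atlas c, cdom c x &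
  forall s t, 0 <= s -> t <= 1 -> cmap c x - e <= s -> t <= cmap c x + e ->
  chart_covers c s t].
Proof.
have [c ac cx] := atlas_cover x.
have [_ c01 /(_ _ (chart_nbhs ac cx))[e e0 he]] := chart_local ac cx.
(* Half of the radius allows non-strict bounds on [s] and [t]. *)
exists c, (e / 2); first by rewrite divr_gt0.
split=> // s t s0 t1 sx tx r rst.
by have [||y cy yr] := he r; [bounds|bounds|exists y].
Qed.

Definition injective_on g a b : Prop :=
  forall u v, a <= u -> u < v -> v <= b -> g u <> g v.

Section Follow.
Variables (g : R -> M) (a b : R) (c : chart R M) (x : M) (t : R).
Hypotheses (cg : curve g a b) (ab : a <= b) (ig : injective_on g a b).
Hypotheses (ac : atlas c) (cb : cdom c (g b)).
Let s := cmap c (g b).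
Hypotheses (st : s < t) (cov : chart_covers c s t).
Let sg := chart_inv c x.
Let E r := (g @` `[a, b]) (sg r).

Let cs : curve sg s t. Proof. exact: curve_chart_inv. Qed.
Let sgb : sg s = g b. Proof. exact: chart_invK. Qed.

(** Near [b] the curve has chart values at most [s], and its earlier part is a compact set that
    misses [g b] by injectivity. *)
Lemma follow_start : exists2 e : R, 0 < e & forall r, s < r -> r <= t ->
  r < s + e -> ~ E r.
Proof.
have bab : a <= b <= b by rewrite ab /=.
have [e e0 he] := curve_window cg bab ac cb filterT.
have nK : ~ (g @` `[a, b - e / 2]) (g b).
  move=> [u]; rewrite /= in_itv /= => /andP[au ub]; apply: ig => //; lra.
have nW : nbhs (sg s) (~` (g @` `[a, b - e / 2])).
  rewrite sgb; apply: open_nbhs_nbhs; split=> //; apply: closed_openC.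
  by apply: curve_closed cg _ _ => //; lra.
have sst : s <= s <= t by rewrite lexx ltW.
have [f f0 hf] := (cs sst).1 _ nW.
exists f => // r sr rt rf [u]; rewrite /= in_itv /= => /andP[au ub] gu.
have srt : s <= r <= t by rewrite rt ltW.
have ue : b - e / 2 < u.
  rewrite ltNge; apply/negP => ue; have [|] := hf r srt.
    by bounds.
  by exists u => //; rewrite /= in_itv /= au.
have [_ er] := chart_invP x cov srt.
have [||_ _ mono] := he u; [bounds|bounds|].
have : cmap c (g u) <= s.
  move: ub; rewrite le_eqVlt => /orP[/eqP -> //|ub]; apply/ltW/mono => //.
  by rewrite subrr normr0.
by rewrite gu er leNgt sr.
Qed.

(** A first return exists, if there is any return, because the image of the curve is closed. It
    cannot occur at an interior parameter, where the curve fills a neighbourhood and would have been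
    met earlier, nor at [b], where the chart value is [s]. *)
Lemma follow : (forall r, s < r -> r <= t -> ~ E r) \/
  (exists r, [/\ s < r, r <= t, sg r = g a &
     forall r', s < r' -> r' < r -> ~ E r']).
Proof.
have [h|/existsNP[r1 /not_implyP[sr1 /not_implyP[r1t /contrapT Er1]]]] :=
  pselect (forall r, s < r -> r <= t -> ~ E r); first by left.
right; pose A := [set r | [/\ s < r, r <= t & E r]].
have Ar1 : A r1 by split.
have hl : has_lbound A by exists s => r [/ltW].
have [e e0 he] := follow_start.
have hi : has_inf A by split=> //; exists r1.
have sr0 : s < inf A.
  apply: (@lt_le_trans _ _ (s + e)); first by rewrite ltrDl.
  apply: lb_le_inf; first by exists r1.
  by move=> r [sr rt Er]; rewrite leNgt; apply/negP => re; exact: he Er.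
have r0t : inf A <= t by apply: le_trans (ge_inf hl Ar1) r1t.
have r0st : s <= inf A <= t by rewrite r0t ltW.
have nE r : s < r -> r < inf A -> ~ E r.
  move=> sr rA Er; suff Ar : A r by move: rA; rewrite ltNge (ge_inf hl Ar).
  by split=> //; apply: ltW (lt_le_trans rA r0t).
have E0 : E (inf A).
  apply: contrapT => nE0.
  have nW : nbhs (sg (inf A)) (~` (g @` `[a, b])).
    apply: open_nbhs_nbhs; split=> //; apply: closed_openC.
    by apply: curve_closed cg _ _.
  have [f f0 hf] := (cs r0st).1 _ nW.
  have [r Ar rf] := inf_adherent f0 hi; have := ge_inf hl Ar.
  by case: (Ar) => sr rt Er r0r; apply: (hf r _ _ Er); bounds.
exists (inf A); split=> //; move: (E0) => [q]; rewrite /= in_itv /= => qab gq.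
rewrite -gq; congr (g _); apply/eqP; rewrite eq_sym; apply: contrapT => /negP qa.
have {}qa : a < q by rewrite lt_neqAle qa; case/andP: qab.
have [qb|bq] := ltP q b; last first.
  have qE : q = b by apply/eqP; rewrite eq_le bq; case/andP: qab => _ ->.
  move: gq; rewrite qE -sgb => /(congr1 (cmap c)).
  have sst : s <= s <= t by rewrite lexx ltW.
  rewrite (chart_invP x cov sst).2 (chart_invP x cov r0st).2 => e1.
  by move: sr0; rewrite -e1 ltxx.
have nW : nbhs (sg (inf A)) (g @` `[a, b]).
  rewrite -gq; apply: filterS (curve_nbhs cg qab (or_introl qa) (or_introl qb) ltr01).
  by move=> y [u [uab _ <-]]; exists u => //; rewrite /= in_itv.
have [f f0 hf] := (cs r0st).1 _ nW.
(* [inf A - k] is still above [s] and is a return before the first one. *)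
pose k := Num.min (f / 2) ((inf A - s) / 2).
have k0 : 0 < k by rewrite lt_min; apply/andP; split; lra.
have kf : k <= f / 2 by rewrite /k ge_min lexx.
have ks : k <= (inf A - s) / 2 by rewrite /k ge_min lexx orbT.
apply: (nE (inf A - k)); [lra|lra|apply: hf]; first by apply/andP; split; lra.
by bounds.
Qed.

Lemma extend r : s < r -> r <= t -> exists h b',
  [/\ b < b', curve h a b', forall u, u <= b -> h u = g u, h b' = sg r &
   forall u, b < u -> u <= b' -> exists w, [/\ s < w, w <= r, h u = sg w,
     u < b' -> w < r & forall u', u < u' -> u' <= b' -> h u <> h u']].
Proof.
(* A translation taking [b] to [s]; the factor 1 gives it the form required by [curve_affine]. *)
move=> sr rt; pose sh u := sg (1 * u + (s - b)).
have shb : g b = sh b by rewrite /sh -sgb; congr (sg _); ring.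
exists (concat g sh b), (b + (r - s)).
have bb' : b < b + (r - s) by rewrite ltrDl subr_gt0.
have sE u : b <= u -> concat g sh b u = sg (s + (u - b)).
  by move=> bu; rewrite concatr // /sh; congr (sg _); ring.
split=> //.
- apply: curve_concat => //; last exact: ltW.
  apply: curve_affine => //; apply: curve_sub cs; lra.
- by move=> u; exact: concatl.
- by rewrite sE 1?ltW //; congr (sg _); ring.
move=> u bu ub'; exists (s + (u - b)); rewrite (sE u (ltW bu)).
split=> //; [lra|lra|by move=> ?; lra|].
move=> u' uu' ub''; rewrite sE; last by lra.
move=> /(congr1 (cmap c)); rewrite !(chart_invP x cov _).2 //; try (apply/andP; split; lra).
by lra.
Qed.

End Follow.

(** Allows injective paths as well as closed curves without further double points. *)
Definition simple g a b : Prop :=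
  forall u v, a <= u -> u < v -> v <= b -> g u = g v -> u = a /\ v = b.

(** By [follow] the way up to the value [t] either avoids the curve, which is then prolonged, or
    first meets it at [g a], where the prolongation stops and closes up. *)
Lemma curve_extension g a b c t : curve g a b -> a <= b -> injective_on g a b ->
  atlas c -> cdom c (g b) -> cmap c (g b) < t -> chart_covers c (cmap c (g b)) t ->
  (exists h b', [/\ b < b', curve h a b', injective_on h a b',
     forall u, u <= b -> h u = g u & ~ (g @` `[a, b]) (h b') /\
     cdom c (h b') /\ cmap c (h b') = t]) \/
  (exists h b', [/\ a < b', curve h a b', h a = g a, h b' = h a & simple h a b']).
Proof.
move=> cg ab ig ac cb st cov.
have sE : cmap c (g b) <= t <= t by rewrite lexx ltW.
case: (follow (g b) cg ab ig ac cb st cov) => [nE|[r [sr rt era nE]]].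
  have [h [b' [bb' ch hg hb' hs]]] := extend (g b) cg ab ac cb cov st (lexx t).
  left; exists h, b'; split=> //; last first.
    by rewrite hb'; split; [exact: nE|exact: (chart_invP _ cov)].
  move=> u v au uv vb; case: (leP v b) => vb1.
    by rewrite !hg //; [exact: ig|lra].
  case: (leP u b) => ub; last by have [w [_ _ _ _]] := hs _ ub (ltW (lt_le_trans uv vb)); apply.
  have [w [sw wt -> _ _]] := hs _ vb1 vb; rewrite hg // => e.
  by apply: (nE w sw wt); exists u => //; rewrite /= in_itv /= au.
have [h [b' [bb' ch hg hb' hs]]] := extend (g b) cg ab ac cb cov sr rt.
right; exists h, b'; split=> //; first lra.
- exact: hg.
- by rewrite hb' era hg.
move=> u v au uv vb; case: (leP v b) => vb1.
  by rewrite !hg //; [move=> /ig []|lra].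
case: (leP u b) => ub; last first.
  by have [w [_ _ _ _ /(_ v uv vb)]] := hs _ ub (ltW (lt_le_trans uv vb)).
have [w [sw wr hw wlt _]] := hs _ vb1 vb; rewrite hg // hw => e.
have [vb'|bv] := ltP v b'.
  case: (nE w sw (wlt vb')); exists u => //; by rewrite /= in_itv /= au.
have vE : v = b' by apply/eqP; rewrite eq_le vb.
split=> //; move: e; rewrite -hw vE hb' era => e.
move: au; rewrite le_eqVlt => /orP[/eqP //|au].
by have := ig a u (lexx a) au ub; rewrite e.
Qed.

(* Finitely many charts cover [M]; each prolongation through one of them
   puts its top point on the curve, so the walk stops. *)
Lemma walk x : exists g a b, [/\ a <= b, curve g a b, g a = x &
  (injective_on g a b /\ boundary false (g b)) \/
  [/\ a < b, g b = g a & simple g a b]].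
Proof.
have [C hC] := choice (fun x => local_cover x).
have /choice[e He] y : exists e : R, 0 < e /\ [/\ atlas (C y), cdom (C y) y &
    forall s t, 0 <= s -> t <= 1 -> cmap (C y) y - e <= s ->
    t <= cmap (C y) y + e -> chart_covers (C y) s t].
  by case: (hC y) => e e0 h; exists e.
have {}He y : [/\ 0 < e y, atlas (C y), cdom (C y) y & forall s t, 0 <= s -> t <= 1 ->
    cmap (C y) y - e y <= s -> t <= cmap (C y) y + e y -> chart_covers (C y) s t].
  by case: (He y) => ? [].
pose V y := [set z | cdom (C y) z /\ `|cmap (C y) z - cmap (C y) y| < e y].
have nV y : nbhs y (V y).
  have [e0 ac cy _] := He y; have [cc _ _] := chart_local ac cy.
  have nb : nbhs y (cmap (C y) @^-1` ball (cmap (C y) y) (e y)).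
    by apply: cc; exact: (@nbhsx_ballx R R^o).
  apply: filterS (filterI nb (chart_nbhs ac cy)) => z [] /=.
  by rewrite /ball /= distrC.
have [s hs] := compact_finite_cover (@manifold_compact _ M) nV.
(* The highest value up to which the chart of [y] is known to be onto, capped at 1. *)
pose top y : R := Num.min 1 (cmap (C y) y + e y).
pose hit (g : R -> M) (a b : R) y :=
  `[< exists2 z, (g @` `[a, b]) z & cdom (C y) z /\ cmap (C y) z = top y >].
pose miss (g : R -> M) (a b : R) := size [seq y <- s | ~~ hit g a b y].
suff H n (g : R -> M) a b : (miss g a b < n)%N -> a <= b -> curve g a b ->
    injective_on g a b ->
    exists h a' b', [/\ a' <= b', curve h a' b', h a' = g a &
      (injective_on h a' b' /\ boundary false (h b')) \/
      [/\ a' < b', h b' = h a' & simple h a' b']].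
  (* The walk starts with the constant path on [0, 0], whose monotony and injectivity are
     vacuous. *)
  have [] := H _ (fun=> x) 0 0 (ltnSn _) (lexx 0).
  - move=> t t0; split=> [W /nbhs_singleton Wx|c ac cx]; first by exists 1.
    exists 1 => // u v /andP[u0 u1] /andP[v0 v1] _ _; lra.
  - by move=> u v u0 uv v0; exfalso; lra.
  by move=> h [a [b hab]]; exists h, a, b.
elim: n g a b => [//|n IH] g a b mn ab cg ig.
have [y ys [cb yb]] := hs (g b); have [e0 ac cy cov] := He y.
have /andP[c0 c1] := cmap01 ac cb.
(* An end of value 1 is a terminal boundary point, and the walk is over. *)
have [ct|ct] := ltP (cmap (C y) (g b)) 1; last first.
  exists g, a, b; split=> //; left; split=> //; exists (C y) => //; split=> //.
  by apply/eqP; rewrite eq_le c1.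
have bt : cmap (C y) (g b) < top y by rewrite /top lt_min ct /=; bounds.
have t1 : top y <= 1 by rewrite /top ge_min lexx.
have te : top y <= cmap (C y) y + e y by rewrite /top ge_min lexx orbT.
have {}cov : chart_covers (C y) (cmap (C y) (g b)) (top y).
  by apply: cov => //; bounds.
case: (curve_extension cg ab ig ac cb bt cov) => [[h [b' [bb' ch ih hg [nh [ch' eh]]]]]|].
  have ab' : a <= b' by lra.
  suff mh : (miss h a b' < n)%N.
    have [k [a' [b'' [? ? ka ?]]]] := IH h a b' mh ab' ch ih.
    by exists k, a', b''; split=> //; rewrite ka hg.
  rewrite ltnS in mn; apply: leq_trans mn; rewrite /miss.
  have sub z : ~~ hit h a b' z -> ~~ hit g a b z.
    apply: contra => /asboolP[w [u uab <-] hw]; apply/asboolP; exists (g u) => //.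
    move: uab; rewrite /= in_itv /= => /andP[au ub]; exists u; last by rewrite hg.
    by rewrite /= in_itv /= au /=; lra.
  have -> : [seq z <- s | ~~ hit h a b' z] =
      [seq z <- [seq z <- s | ~~ hit g a b z] | ~~ hit h a b' z].
    rewrite -filter_predI; apply: eq_filter => z /=.
    by case: (boolP (~~ hit h a b' z)) => //= /sub ->.
  rewrite size_filter -(count_predC (fun z => ~~ hit h a b' z)) -[X in (X < _)%N]addn0.
  (* [y] is hit only now: the chart has a single point of value [top y], the new end, which lies off
     the old curve. *)
  rewrite ltn_add2l -has_count; apply/hasP; exists y.
    rewrite mem_filter ys andbT; apply/negP => /asboolP[z gz [cz ez]]; apply: nh.
    by rewrite (_ : h b' = z) //; apply: (chart_inj ac) => //; rewrite eh ez.
  rewrite /= negbK; apply/asboolP; exists (h b') => //.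
  by exists b' => //; rewrite /= in_itv /= ab' lexx.
by move=> [h [b' [? ? ha ? ?]]]; exists h, a, b'; split=> //; [exact: ltW|right].
Qed.

End ChartInverse.

(** * Components *)

Section Reversal.
Context {R : realType}.

Definition rev_chart (M : topologicalType) (c : chart R M) : chart R M :=
  Chart (cdom c) (fun x => 1 - cmap c x).

Variable M : manifold R.

Definition rev_atlas : set (chart R M) := 
  [set e | exists2 c, atlas c & e = rev_chart c].

Lemma rev_atlas_chart c : rev_atlas c -> is_chart c.
Proof.
move=> [c' ac ->]; apply/is_chartP; have /is_chartP[oD iD lD] := atlas_chart ac.
split=> // [x y xD yD /= /addrI/oppr_inj|x cx]; first exact: iD.
have [cc c01 co] := lD x cx; split.
- apply: (@continuousB _ R^o) => //; exact: cst_continuous.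
- by case/andP: c01 => ? ?; apply/andP; split=> /=; lra.
move=> W /co[e e0 h]; exists e => // t /andP[t0 t1] te.
have [||y Wy yt] := h (1 - t); first by apply/andP; split; lra.
  by rewrite distrC (_ : _ - _ = t - (1 - cmap c' x)) //; ring.
by exists y => //=; rewrite yt; ring.
Qed.

Lemma rev_atlas_cover (x : M) : exists2 c, rev_atlas c & cdom c x.
Proof.
by have [c ac cx] := atlas_cover x; exists (rev_chart c) => //; exists c.
Qed.

Lemma rev_atlas_oriented c d (x : M) : rev_atlas c -> rev_atlas d ->
  cdom c x -> cdom d x -> increasing_at id c d x.
Proof.
move=> [c' ac ->] [d' ad ->] cx dx; have [W nW hW] := atlas_oriented ac ad cx dx.
exists W => // y z Wy Wz /=; rewrite !ltrD2l !ltrN2; exact: hW.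
Qed.

(** Serves to follow curves backwards, and in [bend_in] to make a whole boundary ingoing. *)
Definition rev_manifold : manifold R :=
  Manifold (@manifold_hausdorff _ M) (@manifold_compact _ M) rev_atlas_chart
    rev_atlas_cover rev_atlas_oriented.

Lemma rev_boundary s (x : M) : boundary s (x : rev_manifold) <-> boundary (~~ s) x.
Proof.
split=> [[_ [c ac ->] [cx /= e]]|[c ac [cx e]]].
  by exists c => //; split=> //; case: s e => /= e; lra.
exists (rev_chart c); first by exists c.
by split=> //=; rewrite e; case: s {e} => /=; lra.
Qed.

Lemma rev_curve (g : R -> M) a b : curve (g : R -> rev_manifold) a b ->
  curve (g \o -%R) (- b) (- a).
Proof.
move=> cg; have sw (u : R) : - b <= u <= - a -> a <= - u <= b.
  by move=> /andP[? ?]; apply/andP; split; lra.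
have sd (u t : R) : `|- u - - t| = `|u - t|.
  by rewrite (_ : - u - - t = - (u - t)) ?normrN //; ring.
move=> t tab; have [gc gm] := cg _ (sw _ tab); split=> [W nW|c ac ct].
  have [e e0 he] := gc W nW; exists e => // u uab ut.
  by apply: he; [exact: sw|rewrite sd].
have [|e e0 he] := gm (rev_chart c) _ ct; first by exists c.
exists e => // u v uab vab ut vt uv.
have := he (- v) (- u); rewrite !sd !ltrN2 /= ltrD2l ltrN2.
by apply=> //; exact: sw.
Qed.

End Reversal.

Lemma in01_0 (R : realType) : (0 : R) <= (0 : R) <= (1 : R).
Proof. by rewrite lexx ler01. Qed.

Lemma in01_1 (R : realType) : (0 : R) <= (1 : R) <= (1 : R).
Proof. by rewrite lexx ler01. Qed.

(** * Circles and arcs as parametrized components *)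

Section Pieces.
Context {R : realType} {M : manifold R}.
Implicit Types (c d : chart R M) (x y : M) (g h : R -> M) (a b t : R).

(** A circle, or an arc from an initial to a terminal boundary point. *)
Definition piece g : Prop :=
  [/\ curve g 0 1, simple g 0 1 &
   g 0 = g 1 \/ (boundary true (g 0) /\ boundary false (g 1))].

Lemma curve_clopen g a b (U : set M) u v : curve g a b -> clopen U ->
  a <= u <= b -> a <= v <= b -> U (g u) -> U (g v).
Proof.
move=> cg [oU cU] uab vab Uu.
have co := connected_continuous_connected (@segment_connected R a b)
  (curve_continuous cg).
have -> : U (g v) = ((g @` `[a, b]) `&` U) (g v).
  by apply/propext; split=> [Uv|[]//]; split=> //; exists v.
rewrite (co (g @` `[a, b] `&` U)).
- by exists v.
- by exists (g u); split=> //; exists u.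
- by exists U.
- by exists U.
Qed.

(* Around any of its points, including the base point of a closed curve, a
   piece is an immersed path that extends on both sides, or stops at the
   boundary of [M]; the parametrization [phi] only depends on the kind of
   piece. *)
Lemma piece_local g t : piece g -> 0 <= t <= 1 ->
  exists phi a b t', [/\ a <= t' <= b, forall u, a <= u <= b -> 0 <= phi u <= 1,
    a < t' \/ boundary true (g t), t' < b \/ boundary false (g t) &
    forall (N : manifold R) (h : R -> N), curve h 0 1 -> (g 0 = g 1 -> h 0 = h 1) ->
      curve (h \o phi) a b /\ h (phi t') = h t].
Proof.
move=> [cg _ ends] t01.
have seam : g 0 = g 1 -> t = 0 \/ t = 1 ->
    exists phi a b t', [/\ a <= t' <= b, forall u, a <= u <= b -> 0 <= phi u <= 1,
    a < t' \/ boundary true (g t), t' < b \/ boundary false (g t) &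
    forall (N : manifold R) (h : R -> N), curve h 0 1 -> (g 0 = g 1 -> h 0 = h 1) ->
      curve (h \o phi) a b /\ h (phi t') = h t].
  (* Two turns of the closed curve, parametrized by [-1, 1], put the base point at the interior
     parameter 0. *)
  move=> gE te; exists (concat (fun u => 1 * u + 1) id 0), (- 1), 1, 0.
  split; [by apply/andP; split; lra| |by left; lra|by left|].
    move=> u /andP[? ?]; rewrite /concat; case: ifP => /= u0;
      first by apply/andP; split; lra.
    by move/negbT: u0; rewrite -ltNge => u0; apply/andP; split; lra.
  move=> N h ch /(_ gE) hE; split; last first.
    by rewrite concatl // mulr0 add0r; case: te => ->.
  rewrite (_ : h \o _ = concat (fun u => h (1 * u + 1)) h 0); last first.
    by apply/funext => u; rewrite /concat /=; case: ifP.
  apply: curve_concat => //.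
  - by apply: curve_affine => //; apply: curve_sub ch; lra.
  - by rewrite mulr0 add0r.
case: (ltP 0 t) => t0; last first.
  have tE : t = 0 by apply/eqP; rewrite eq_le t0; case/andP: t01.
  case: ends => [gE|[b0 b1]]; first by apply: seam => //; left.
  exists id, 0, 1, t; split=> //; [by right; rewrite tE|by left; rewrite tE].
case: (ltP t 1) => t1; last first.
  have tE : t = 1 by apply/eqP; rewrite eq_le t1 andbT; case/andP: t01.
  case: ends => [gE|[b0 b1]]; first by apply: seam => //; right.
  exists id, 0, 1, t; split=> //; [by left|by right; rewrite tE].
by exists id, 0, 1, t; split=> //; left.
Qed.

(** Closed by compactness; open since [piece_local] makes [curve_nbhs] available at every parameter,
    even at the base point of a circle. *)
Lemma piece_clopen g : piece g -> clopen (g @` `[0, 1]).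
Proof.
move=> pg; have [cg _ _] := pg; split; last exact: curve_closed cg _ _.
rewrite openE => _ [t /= /[!in_itv] /= t01 <-].
have [phi [a [b [t' [tab hphi hl hr /(_ _ _ cg id)[ck e]]]]]] := piece_local pg t01.
rewrite -e in hl hr *; apply: filterS (curve_nbhs ck tab hl hr ltr01) => y.
by move=> [v [vab _ <-]]; exists (phi v) => //; rewrite /= in_itv /= hphi.
Qed.

Lemma piece_sub g (U : set M) t : piece g -> clopen U -> 0 <= t <= 1 ->
  U (g t) -> g @` `[0, 1] `<=` U.
Proof.
move=> [cg _ _] oU t01 Ut _ [u /= /[!in_itv] /= u01 <-].
exact: curve_clopen cg oU t01 u01 Ut.
Qed.

(** Pieces are connected with clopen images, so each of two meeting pieces contains the other. *)
Lemma piece_eq g h t u : piece g -> piece h -> 0 <= t <= 1 -> 0 <= u <= 1 ->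
  g t = h u -> g @` `[0, 1] = h @` `[0, 1].
Proof.
move=> pg ph t01 u01 e; apply/seteqP; split.
  apply: (piece_sub pg (piece_clopen ph) t01).
  by rewrite e; exists u => //; rewrite /= in_itv.
apply: (piece_sub ph (piece_clopen pg) u01).
by rewrite -e; exists t => //; rewrite /= in_itv.
Qed.

(** At any other parameter the curve would run through chart values below 0 or above 1. *)
Lemma curve_boundary g a b s t : curve g a b -> a <= t <= b ->
  boundary s (g t) -> t = if s then a else b.
Proof.
move=> cg tab bs; have [c ac ct] := atlas_cover (g t).
have [e e0 he] := curve_window cg tab ac ct filterT.
have ct' := boundary_cmap bs ac ct; have /andP[at_ tb] := tab.
have tt : `|t - t| < e by rewrite subrr normr0.
case: s {bs} ct' => ct'; apply/eqP; rewrite eq_le ?at_ ?tb /= ?andbT leNgt;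
  apply/negP => lt.
  pose k := Num.min (e / 2) (t - a).
  have k0 : 0 < k by rewrite lt_min; apply/andP; split; lra.
  have k1 : k <= t - a by rewrite ge_min lexx orbT.
  have ke : k <= e / 2 by rewrite ge_min lexx.
  have [||_ cu /(_ t tab tt)] := he (t - k); [by apply/andP; split; lra| |].
    by rewrite ltr_norml; apply/andP; split; lra.
  rewrite ct' => /(_ ltac:(lra)); have /andP[h _] := cmap01 ac cu.
  by rewrite ltNge h.
pose k := Num.min (e / 2) (b - t).
have k0 : 0 < k by rewrite lt_min; apply/andP; split; lra.
have k1 : k <= b - t by rewrite ge_min lexx orbT.
have ke : k <= e / 2 by rewrite ge_min lexx.
have tk : a <= t + k <= b by apply/andP; split; lra.
have tk' : `|t + k - t| < e by rewrite ltr_norml; apply/andP; split; lra.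
have [_ cu _] := he _ tk tk'; have [_ _ /(_ _ tk tk')] := he t tab tt.
rewrite ct' => /(_ ltac:(lra)); have /andP[_ h] := cmap01 ac cu.
by rewrite ltNge h.
Qed.

Lemma piece_boundary g s t : piece g -> 0 <= t <= 1 -> boundary s (g t) ->
  t = (if s then 0 else 1) /\ g 0 <> g 1.
Proof.
move=> [cg _ _] t01 bs; have tE := curve_boundary cg t01 bs.
have r01 := @in01_0 R.
have r11 := @in01_1 R.
split=> // gE; case: s bs tE => bs tE; rewrite tE in bs.
  by rewrite gE in bs; have := curve_boundary cg r11 bs; lra.
by rewrite -gE in bs; have := curve_boundary cg r01 bs; lra.
Qed.

Lemma curve_normalize g a b : a < b -> curve g a b -> simple g a b ->
  let h u := g ((b - a) * u + a) in
  [/\ curve h 0 1, simple h 0 1, h 0 = g a & h 1 = g b].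
Proof.
move=> ab cg sg h; have k0 : 0 < b - a by rewrite subr_gt0.
split; rewrite /h.
- apply: curve_affine => //; apply: curve_sub cg; lra.
- move=> u v u0 uv v1; have uv' : (b - a) * u < (b - a) * v by rewrite ltr_pM2l.
  have u0' : 0 <= (b - a) * u by rewrite mulr_ge0 // ltW.
  have v1' : (b - a) * v <= b - a by rewrite ler_piMr // ltW.
  move=> /sg[| | |e1 e2]; [lra|lra|lra|].
  have /eqP : (b - a) * u = 0 by lra.
  have /eqP : (b - a) * (v - 1) = 0 by lra.
  rewrite !mulf_eq0 !subr_eq0 !(gt_eqF ab) /=.
  by move=> /eqP -> /eqP ->.
- by congr g; ring.
- by congr g; ring.
Qed.

Lemma injective_on_simple g a b : injective_on g a b -> simple g a b.
Proof. by move=> ig u v au uv vb /(ig u v au uv vb). Qed.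

(** The walk from [x] cannot close up, because a curve meets an initial boundary point only at its
    first parameter; so it ends at the boundary. *)
Lemma boundary_piece x : boundary true x -> exists2 g, piece g & g 0 = x.
Proof.
move=> bx; have [g [a [b [ab cg gx H]]]] := walk x; rewrite -gx in bx *.
have abb : a <= b <= b by rewrite ab lexx.
case: H => [[ig bb]|[ab' gE _]]; last first.
  by rewrite -gE in bx; have := curve_boundary cg abb bx; lra.
have ab' : a < b.
  rewrite lt_neqAle ab andbT; apply/eqP => e; subst b.
  by have := boundary_sign bx bb.
have [ch sh h0 h1] := curve_normalize ab' cg (injective_on_simple ig).
by exists (fun u => g ((b - a) * u + a)); first (split=> //; right; rewrite h0 h1).
Qed.

End Pieces.

Section PieceThrough.
Context {R : realType} {M : manifold R}.

(** The case of initial points in the opposite orientation, run backwards. *)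
Lemma boundary_piece_false (x : M) : boundary false x ->
  exists2 g : R -> M, piece g & g 1 = x.
Proof.
move=> bx; have [|h [ch sh ends] hx] := @boundary_piece R (rev_manifold M) x.
  exact/rev_boundary.
have b0 : boundary true (h 0) by rewrite hx; exact/rev_boundary.
have r01 := @in01_0 R.
have b1 : boundary false (h 1).
  by case: ends => [e|[]//]; have [_] := piece_boundary (And3 ch sh (or_introl e)) r01 b0.
exists (fun u => h (- 1 * u + 1)); last by rewrite mulr1 addNr.
have e (u : R) : h (- 1 * u + 1) = (h \o -%R) (1 * u + - 1).
  by rewrite /=; congr h; ring.
split.
- rewrite (_ : (fun u => _) = (fun u => (h \o -%R) (1 * u + - 1))); last exact/funext.
  apply: curve_affine => //; apply: curve_sub (rev_curve ch); lra.
- move=> u v u0 uv v1 /esym/sh[| | |? ?]; lra.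
right; rewrite mulr0 add0r mulr1 addNr.
split; first exact: ((@rev_boundary R M false (h 1)).1 b1).
exact: ((@rev_boundary R M true (h 0)).1 b0).
Qed.

(** A walk from [x] that does not close up ends at a terminal boundary point; the piece ending there
    is clopen and so contains the whole walk. *)
Lemma piece_through (x : M) : exists g : R -> M, piece g /\ (g @` `[0, 1]) x.
Proof.
have [g [a [b [ab cg gx H]]]] := walk x.
have aab : a <= a <= b by rewrite ab lexx.
have abb : a <= b <= b by rewrite ab lexx.
case: H => [[ig bb]|[ab' gE sg]]; last first.
  have [ch sh h0 h1] := curve_normalize ab' cg sg.
  exists (fun u => g ((b - a) * u + a)); split; last first.
    by exists 0; [rewrite /= in_itv /= in01_0|rewrite h0 gx].
  by split=> //; left; rewrite h0 h1.
have [h ph h1] := boundary_piece_false bb; exists h; split=> //; rewrite -gx.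
apply: (curve_clopen cg (piece_clopen ph) abb aab).
by exists 1 => //; rewrite /= in_itv /= ?in01_0 ?in01_1.
Qed.

End PieceThrough.

(** * Classification of cobordisms *)

Section Transfer.
Context {R : realType}.
Local Notation manifold := (manifold R).

Definition decomposition (M : manifold) (J : Type) (g : J -> R -> M) : Prop :=
  [/\ forall j, piece (g j), forall x, exists j t, 0 <= t <= 1 /\ g j t = x &
   forall i j t u, 0 <= t <= 1 -> 0 <= u <= 1 -> g i t = g j u -> i = j].

Section OneWay.
Context (M N : manifold) (J : Type) (g : J -> R -> M) (h : J -> R -> N).
Hypotheses (dg : decomposition g) (dh : decomposition h).
Hypothesis gh : forall j, g j 0 = g j 1 -> h j 0 = h j 1.

(** Well defined: within a piece two parameters give one point only at the base point of a closed
    piece, where [gh] makes the two values agree. *)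
Lemma transfer_exists : exists Phi : M -> N,
  forall j t, 0 <= t <= 1 -> Phi (g j t) = h j t.
Proof.
have [pg cover disj] := dg.
have /choice[Phi hPhi] x : exists y, forall j t, 0 <= t <= 1 -> g j t = x -> y = h j t.
  have [j [t [t01 <-]]] := cover x; exists (h j t) => i u u01 e.
  have ij := disj _ _ _ _ u01 t01 e; subst i.
  have [_ sg _] := pg j; have /andP[t0 t1] := t01; have /andP[u0 u1] := u01.
  case: (ltgtP t u) => [tu|ut|-> //].
    by have [|t0' u1'] := sg t u t0 tu u1; [|rewrite t0' u1' gh // -t0' -u1'].
  by have [|t0' u1'] := sg u t u0 ut t1; [|rewrite t0' u1' -gh // -t0' -u1'].
by exists Phi => j t t01; exact: hPhi.
Qed.

Variable Phi : M -> N.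
Hypothesis PhiE : forall j t, 0 <= t <= 1 -> Phi (g j t) = h j t.

(** One reparametrization from [piece_local] serves both [g j] and [h j], so [Phi] is locally the
    identity on parameters. *)
Lemma transfer_local x : exists k l a b t, [/\ curve k a b, curve l a b,
  a <= t <= b, forall u, a <= u <= b -> Phi (k u) = l u & k t = x /\
  forall e : R, 0 < e ->
  nbhs x [set y | exists u, [/\ a <= u <= b, `|u - t| < e & k u = y]]].
Proof.
have [pg cover _] := dg; have [ph _ _] := dh.
have [j [s [s01 <-]]] := cover x; have [cg _ _] := pg j; have [ch _ _] := ph j.
have [phi [a [b [t [tab hphi hl hr H]]]]] := piece_local (pg j) s01.
have [ck kE] := H _ _ cg id; have [cl _] := H _ _ ch (@gh j).
exists (g j \o phi), (h j \o phi), a, b, t; split=> //.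
  by move=> u uab; rewrite /= PhiE // hphi.
split=> // e e0; rewrite -kE in hl hr *; exact: (curve_nbhs ck).
Qed.

Lemma transfer_continuous : continuous Phi.
Proof.
move=> x W nW; have [k [l [a [b [t [ck cl tab kl [kt nk]]]]]]] := transfer_local x.
have [|e e0 he] := (cl t tab).1 W; first by rewrite -kl // kt.
apply: filterS (nk e e0) => _ [u [uab ut <-]]; rewrite /= kl //; exact: he.
Qed.

Lemma transfer_increasing c d x : atlas c -> atlas d -> cdom c x ->
  cdom d (Phi x) -> increasing_at Phi c d x.
Proof.
move=> ac ad cx dx; have [k [l [a [b [t [ck cl tab kl [kt nk]]]]]]] := transfer_local x.
rewrite -kt kl // in dx; rewrite -kt in cx.
have [e e0 he] := (ck t tab).2 c ac cx; have [f f0 hf] := (cl t tab).2 d ad dx.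
exists [set y | exists u, [/\ a <= u <= b, `|u - t| < Num.min e f & k u = y]].
  by apply: nk; rewrite lt_min e0.
move=> _ _ [u [uab ut <-]] [v [vab vt <-]]; rewrite !kl //.
rewrite lt_min in ut; rewrite lt_min in vt; case/andP: ut => ue uf; case/andP: vt => ve vf.
case: (ltgtP u v) => [uv _|vu uv|->]; [exact: hf| |by rewrite ltxx].
by have := lt_trans uv (he v u vab uab ve ue vu); rewrite ltxx.
Qed.

End OneWay.

Lemma decomposition_homeo (M N : manifold) (J : Type) (g : J -> R -> M)
    (h : J -> R -> N) : decomposition g -> decomposition h ->
  (forall j, g j 0 = g j 1 <-> h j 0 = h j 1) ->
  exists2 Phi : M -> N, oriented_homeo Phi &
    forall j t, 0 <= t <= 1 -> Phi (g j t) = h j t.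
Proof.
move=> dg dh gh; have gh1 j := (gh j).1; have gh2 j := (gh j).2.
have [Phi hPhi] := transfer_exists dg gh1; have [Psi hPsi] := transfer_exists dh gh2.
exists Phi => //; split; first exact: (transfer_continuous dg dh gh1 hPhi).
  exists Psi; split; last exact: (transfer_continuous dh dg gh2 hPsi).
    by move=> x; have [_ /(_ x)[j [t [t01 <-]]] _] := dg; rewrite hPhi // hPsi.
  by move=> x; have [_ /(_ x)[j [t [t01 <-]]] _] := dh; rewrite hPsi // hPhi.
by move=> c d x; exact: (transfer_increasing dg dh gh1 hPhi).
Qed.

End Transfer.

(** * Normal forms: circles, arcs and their boundary points *)

Section NormalForm.
Context {R : realType}.

Definition label (a b : seq bool) : finType := ('I_(size a) + 'I_(size b))%type.

Definition label_sign a b (l : label a b) : bool :=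
  match l with inl i => nth true a i | inr j => ~~ nth true b j end.

Definition bpt a b (K : cobordism R a b) (l : label a b) : K :=
  match l with inl i => cob_in K i | inr j => cob_out K j end.

Section OneCobordism.
Context (a b : seq bool) (K : cobordism R a b).

Lemma bpt_inj : injective (bpt K).
Proof.
move=> [i|i] [j|j] /=.
- by move=> /cob_in_inj ->.
- by move=> /cob_in_out.
- by move=> /esym/cob_in_out.
- by move=> /cob_out_inj ->.
Qed.

Lemma bpt_sign l : boundary (label_sign l) (bpt K l).
Proof. by case: l => i; [exact: cob_in_sign|exact: cob_out_sign]. Qed.

Lemma boundary_bpt s (x : K) : boundary s x -> exists2 l, label_sign l = s & bpt K l = x.
Proof.
move=> bs; have [[i xi]|[j xj]] := cob_boundary bs.
  by exists (inl i); rewrite ?xi //; apply: boundary_sign bs; rewrite xi; exact: cob_in_sign.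
by exists (inr j); rewrite ?xj //; apply: boundary_sign bs; rewrite xj; exact: cob_out_sign.
Qed.

(* The circles are numbered, and the arcs named by their initial points. *)
Definition strand (k : nat) : finType := ('I_k + {l : label a b | label_sign l})%type.

(** [k] and [comp] are the combinatorial invariants of the cobordism, the latter naming the
    component of each boundary point. *)
Record normal_form (k : nat) (g : strand k -> R -> K)
    (comp : label a b -> strand k) : Prop := NormalForm {
  nf_decomposition : decomposition g;
  nf_circle : forall i : 'I_k, g (inl i) 0 = g (inl i) 1;
  nf_arc : forall l : {l : label a b | label_sign l}, g (inr l) 0 = bpt K (val l);
  nf_comp : forall l, exists2 t, 0 <= t <= 1 & g (comp l) t = bpt K l }.

(** Images of pieces are open and the manifold is compact, so finitely many pieces cover it; each
    arc is replaced by the chosen one from its initial point. *)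
Lemma normal_form_exists : exists k g comp, @normal_form k g comp.
Proof.
have /choice[G hG] := @piece_through R K.
pose img (g : R -> K) := g @` `[0, 1].
have [|s hs] := compact_finite_cover (V := fun x => img (G x)) (@manifold_compact _ K).
  move=> x; have [pg gx] := hG x; have [og _] := piece_clopen pg.
  exact: open_nbhs_nbhs.
(* Several chosen pieces may run over one circle; listing images instead of pieces counts it
   once. *)
pose T := undup [seq img (G x) | x <- s & `[< G x 0 = G x 1 >]].
have hT A : A \in T -> exists g : R -> K, [/\ piece g, g 0 = g 1 & img g = A].
  rewrite mem_undup => /mapP[x]; rewrite mem_filter => /andP[/asboolP e _] ->.
  by exists (G x); split=> //; have [] := hG x.
have /choice[C hC] (i : 'I_(size T)) := hT _ (mem_nth set0 (ltn_ord i)).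
have /choice[B hB] (l : {l : label a b | label_sign l}) :
    exists g : R -> K, piece g /\ g 0 = bpt K (val l).
  have [|g pg g0] := @boundary_piece R K (bpt K (val l)); last by exists g.
  by have := bpt_sign (val l); rewrite (valP l).
pose g (j : strand (size T)) := match j with inl i => C i | inr l => B l end.
have in0 := @in01_0 R.
have pg j : piece (g j) by case: j => [i|l] /=; [have [] := hC i|have [] := hB l].
have img_in (f : R -> K) t : 0 <= t <= 1 -> img f (f t).
  by move=> t01; exists t => //; rewrite /= in_itv.
have cover x : exists j t, 0 <= t <= 1 /\ g j t = x.
  have [y ys [t /= /[!in_itv] /= t01 tx]] := hs x; have [py _] := hG y.
  have [|ends] := pselect (G y 0 = G y 1) => [e|].
    have yT : img (G y) \in T.
      by rewrite mem_undup; apply: map_f; rewrite mem_filter ys andbT; apply/asboolP.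
    have iT : (index (img (G y)) T < size T)%N by rewrite index_mem.
    have [_ _] := hC (Ordinal iT); rewrite /= nth_index // => Ci.
    have : img (C (Ordinal iT)) x by rewrite Ci -tx; exact: img_in.
    by move=> [u /= /[!in_itv] /= u01 ux]; exists (inl (Ordinal iT)), u.
  have [_ _ []//] := py => -[b0 _].
  have [l sl bl] := boundary_bpt b0.
  have [pl l0] := hB (exist _ l sl).
  have : img (B (exist _ l sl)) x.
    by rewrite /img (piece_eq pl py in0 in0) ?l0 //= -tx; exact: img_in.
  by move=> [u /= /[!in_itv] /= u01 ux]; exists (inr (exist _ l sl)), u.
have disj i j t u : 0 <= t <= 1 -> 0 <= u <= 1 -> g i t = g j u -> i = j.
  move=> t01 u01 e; have {e t01 u01} E : img (g i) = img (g j) := piece_eq (pg i) (pg j) t01 u01 e.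
  (* A closed piece contains no boundary point, so no circle is an arc. *)
  have noca c l : img (C c) <> img (B l).
    move=> EE; have : img (C c) (B l 0) by rewrite EE; exact: img_in.
    move=> [v /= /[!in_itv] /= v01 ve]; have [pc c01 _] := hC c.
    case: (@piece_boundary R K (C c) true v pc v01) => [|_]; last by [].
    by rewrite ve (hB l).2; have := bpt_sign (val l); rewrite (valP l).
  case: i j E => [i|l] [j|m] /= E.
  - congr inl; apply/val_inj/eqP.
    rewrite -(nth_uniq set0 (ltn_ord i) (ltn_ord j) (undup_uniq _)).
    by have [_ _ <-] := hC i; have [_ _ <-] := hC j; apply/eqP.
  - by have := noca _ _ E.
  - by have := noca _ _ (esym E).
  - congr inr; apply/val_inj/bpt_inj; have [pm m0] := hB m; have [pl l0] := hB l.
    have : img (B m) (B l 0) by rewrite -E; exact: img_in.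
    move=> [v /= /[!in_itv] /= v01 ve].
    case: (@piece_boundary R K (B m) true v pm v01) => [|v0 _].
      by rewrite ve l0; have := bpt_sign (val l); rewrite (valP l).
    by rewrite -l0 -m0 -ve v0.
have /choice[comp hcomp] l : exists j, exists2 t, 0 <= t <= 1 & g j t = bpt K l.
  by have [j [t [t01 e]]] := cover (bpt K l); exists j, t.
exists (size T), g, comp; split=> //.
  by move=> i; have [_ e _] := hC i; exact: e.
by move=> l; have [_ e] := hB l; exact: e.
Qed.

Section Properties.
Context (k : nat) (g : strand k -> R -> K) (comp : label a b -> strand k).
Hypothesis nf : normal_form g comp.

Let in0 := @in01_0 R.

Lemma comp_bpt l : g (comp l) (if label_sign l then 0 else 1) = bpt K l /\
  g (comp l) 0 <> g (comp l) 1.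
Proof.
have [t t01 e] := nf_comp nf l; have [pg _ _] := nf_decomposition nf.
have := bpt_sign l; rewrite -e => /(piece_boundary (pg _) t01)[te ne].
by split=> //; rewrite -te e.
Qed.

Lemma comp_arc l : exists m, comp l = inr m.
Proof.
have [_] := comp_bpt l; case: (comp l) => [i|m _]; last by exists m.
by rewrite (nf_circle nf).
Qed.

Lemma comp_positive (m : {l : label a b | label_sign l}) : comp (val m) = inr m.
Proof.
have [_ _ disj] := nf_decomposition nf; have [t t01 e] := nf_comp nf (val m).
by apply: (disj _ _ t 0 t01 in0); rewrite e (nf_arc nf).
Qed.

(** The bijection from sets of strands onto clopen subsets, which are the unions of components. *)
Definition clopen_of (S : {set strand k}) : set K :=
  [set x | exists j t, [/\ j \in S, 0 <= t <= 1 & g j t = x]].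

Lemma clopen_ofP j t S : 0 <= t <= 1 -> clopen_of S (g j t) <-> j \in S.
Proof.
have [_ _ disj] := nf_decomposition nf => t01; split; last by exists j, t.
by move=> [i [u [iS u01 e]]]; rewrite -(disj _ _ _ _ u01 t01 e).
Qed.

Lemma clopen_of_clopen S : clopen (clopen_of S).
Proof.
have [pg cover disj] := nf_decomposition nf.
suff oS S' : open (clopen_of S').
  split=> //; rewrite (_ : clopen_of S = ~` (clopen_of (~: S))) //.
    exact: open_closedC.
  apply/seteqP; split=> x; have [j [t [t01 <-]]] := cover x.
    by move=> /(clopen_ofP _ _ t01) jS /(clopen_ofP _ _ t01); rewrite inE jS.
  move=> nS; apply/(clopen_ofP _ _ t01); apply: contrapT => /negP jS; apply: nS.
  by apply/(clopen_ofP _ _ t01); rewrite inE.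
rewrite (_ : clopen_of S' = \bigcup_(j in [set` S']) (g j @` `[0, 1])).
  by apply: bigcup_open => j _; have [] := piece_clopen (pg j).
apply/seteqP; split=> [x [j [t [jS t01 <-]]]|x [j jS [t /= /[!in_itv] /= t01 <-]]].
  by exists j => //; exists t => //; rewrite /= in_itv.
by exists j, t.
Qed.

Lemma clopen_of_inj : injective clopen_of.
Proof.
move=> S S' E; apply/setP => j; apply/idP/idP => jS.
  by apply/(clopen_ofP j S' in0); rewrite -E; exact/(clopen_ofP j S in0).
by apply/(clopen_ofP j S in0); rewrite E; exact/(clopen_ofP j S' in0).
Qed.

Lemma clopen_of_surj U : clopen U -> exists S, U = clopen_of S.
Proof.
have [pg cover disj] := nf_decomposition nf => cU.
exists (finset (fun j => `[< U (g j 0) >])); apply/seteqP; split=> x;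
  have [j [t [t01 <-]]] := cover x; have [cg _ _] := pg j.
  move=> Ut; apply/(clopen_ofP _ _ t01); rewrite inE; apply/asboolP.
  exact: curve_clopen cg cU t01 in0 Ut.
move=> /(clopen_ofP _ _ t01); rewrite inE => /asboolP.
exact: curve_clopen cg cU in0 t01.
Qed.

Lemma clopen_of_bpt S l : clopen_of S (bpt K l) <-> comp l \in S.
Proof. by have [t t01 <-] := nf_comp nf l; exact: clopen_ofP. Qed.

End Properties.
End OneCobordism.

(** Strands with the same name are both closed or both arcs, so parameters can be matched; boundary
    points correspond, being ends of arcs fixed by [comp] and their signs. *)
Lemma normal_form_equiv a b (K L : cobordism R a b) k (g : strand a b k -> R -> K)
    (h : strand a b k -> R -> L) comp :
  normal_form g comp -> normal_form h comp -> cob_equiv K L.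
Proof.
move=> ng nh; have gh j : g j 0 = g j 1 <-> h j 0 = h j 1.
  case: j => [i|m]; first by split=> _; [exact: (nf_circle nh)|exact: (nf_circle ng)].
  have [_ gm] := comp_bpt ng (val m); have [_ hm] := comp_bpt nh (val m).
  by rewrite (comp_positive ng) in gm; rewrite (comp_positive nh) in hm.
have [Phi hPhi PhiE] := decomposition_homeo (nf_decomposition ng) (nf_decomposition nh) gh.
have PhiB l : Phi (bpt K l) = bpt L l.
  have [<- _] := comp_bpt ng l; have [<- _] := comp_bpt nh l.
  by apply: PhiE; case: ifP => _; rewrite ?in01_0 ?in01_1.
by exists Phi; split=> // i; [exact: (PhiB (inl i))|exact: (PhiB (inr i))].
Qed.

End NormalForm.

(** * Counting clopen subsets by their traces *)

Section TraceCount.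
Local Close Scope classical_set_scope.
Context {a b : seq bool}.
Local Notation label := (label a b).
Local Notation strand := (strand a b).

Definition trace k (comp : label -> strand k) (S : {set strand k}) :
    {ffun label -> bool} := [ffun l => comp l \in S].

Definition ntrace k (comp : label -> strand k) (v : {ffun label -> bool}) : nat :=
  #|[set S | trace comp S == v]|.

(** By [clopen_count] such pairs correspond to the clopen subsets of the closed manifold glued from
    the two cobordisms. *)
Definition npairs k (c : label -> strand k) k' (c' : label -> strand k') : nat :=
  #|[set P : {set strand k} * {set strand k'} | trace c P.1 == trace c' P.2]|.

Lemma npairsE k (c : label -> strand k) k' (c' : label -> strand k') :
  npairs c c' = (\sum_v ntrace c v * ntrace c' v)%N.
Proof.
rewrite /npairs -sum1_card (partition_big (fun P => trace c P.1) predT) //=.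
apply: eq_bigr => v _; rewrite sum1_card -cardsX; apply: eq_card => -[S S'].
rewrite !inE /= unfold_in /= inE /=.
by case: (trace c S =P v) => [->|]; rewrite ?andbF ?andbT // eq_sym.
Qed.

(* The three sums of products agree, so the sum of the squares
   [(ntrace c v - ntrace c' v) ^ 2] vanishes. *)
Lemma npairs_ntrace k (c : label -> strand k) k' (c' : label -> strand k') :
  npairs c c = npairs c c' -> npairs c' c' = npairs c c' ->
  ntrace c =1 ntrace c'.
Proof.
rewrite !npairsE => e1 e2.
have : \sum_v ((ntrace c v)%:Z - (ntrace c' v)%:Z) ^+ 2 = 0.
  have cast (f g : {ffun label -> bool} -> nat) :
      \sum_v (f v)%:Z * (g v)%:Z = (\sum_v f v * g v)%N%:Z.
    by rewrite (big_morph Posz PoszD (erefl _)); apply: eq_bigr => v _; rewrite PoszM.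
  under eq_bigr => v _ do rewrite sqrrB !expr2.
  by rewrite big_split sumrB /= sumrMnl !cast e1 e2; ring.
move=> /eqP; rewrite psumr_eq0 => [/allP h v|v _]; last exact: sqr_ge0.
have /(_ (mem_index_enum v)) := h v.
by rewrite /= sqrf_eq0 subr_eq0 => /eqP[].
Qed.

Definition comp_wf k (c : label -> strand k) : Prop :=
  (forall l, exists m, c l = inr m) /\ (forall m, c (val m) = inr m).

(** A set of strands with empty trace contains no arc, since each arc contains its initial point,
    but it may contain any circles. *)
Lemma ntrace0 k (c : label -> strand k) : comp_wf c ->
  ntrace c [ffun => false] = (2 ^ k)%N.
Proof.
move=> [arc pos]; rewrite /ntrace.
rewrite (_ : [set S | _] = powerset (inl @: [set: 'I_k])).
  by rewrite card_powerset card_imset ?cardsT ?card_ord //; apply: inl_inj.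
apply/setP => S; rewrite powersetE inE; apply/eqP/fintype.subsetP => [e j jS|sS].
  case: j jS => [i _|m mS]; first exact: imset_f.
  by have := congr1 (fun f : {ffun _ -> _} => f (val m)) e; rewrite !ffunE pos mS.
apply/ffunP => l; rewrite !ffunE; apply/negP => /sS /imsetP[i _].
by have [m ->] := arc l.
Qed.

Lemma ntrace_circles k (c : label -> strand k) k' (c' : label -> strand k') :
  comp_wf c -> comp_wf c' -> ntrace c =1 ntrace c' -> k = k'.
Proof.
move=> wc wc' /(_ [ffun => false]); rewrite !ntrace0 //.
by move/eqP; rewrite eqn_exp2l // => /eqP.
Qed.

(** The trace of the single strand [c' l] under [c'] is also a trace under [c]. A trace under [c]
    agrees at [l] and at the initial point of the arc [c l], so under [c'] these two points lie on
    the same arc. *)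
Lemma ntrace_comp k (c c' : label -> strand k) :
  comp_wf c -> comp_wf c' -> ntrace c =1 ntrace c' -> c = c'.
Proof.
move=> [arc pos] [arc' pos'] cc'; apply: functional_extensionality_dep => l.
have [m cl] := arc l; rewrite cl -(pos' m).
have : (0 < ntrace c (trace c' [set c' l]))%N.
  by rewrite cc' card_gt0; apply/set0Pn; exists [set c' l]; rewrite inE.
rewrite card_gt0 => /set0Pn[S]; rewrite inE => /eqP E.
have tr q : (c q \in S) = (c' q == c' l).
  by have := congr1 (fun f : {ffun _ -> _} => f q) E; rewrite !ffunE inE.
by have := tr (val m); rewrite pos -cl tr eqxx => /esym/eqP.
Qed.

End TraceCount.

Section Recognition.
Context {R : realType} (a b : seq bool).

Lemma nf_comp_wf (K : cobordism R a b) k g comp :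
  @normal_form R a b K k g comp -> comp_wf comp.
Proof. by move=> nf; split=> [l|m]; [exact: comp_arc nf l|exact: comp_positive nf m]. Qed.

Lemma ntrace_equiv (K L : cobordism R a b) k (g : strand a b k -> R -> K) c
    k' (h : strand a b k' -> R -> L) c' :
  normal_form g c -> normal_form h c' -> ntrace c =1 ntrace c' -> cob_equiv K L.
Proof.
move=> ng nh cc'; have kk := ntrace_circles (nf_comp_wf ng) (nf_comp_wf nh) cc'.
subst k'; have e := ntrace_comp (nf_comp_wf ng) (nf_comp_wf nh) cc'; subst c'.
exact: normal_form_equiv ng nh.
Qed.

End Recognition.

(** * Closing up cobordisms *)

Section Bending.
Context {R : realType} (a b : seq bool) (X : cobordism R a b).

Definition no_point (T : Type) (i : 'I_(size ([::] : seq bool))) : T :=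
  False_rect T (notF (ltn_ord i)).

(** All boundary points on one side: an ingoing point may be read as an outgoing one with the
    opposite letter. *)
Definition bent : 'I_(size (map negb a ++ b)) -> X :=
  cat_fun (fun i => cob_in X (cast_ord (size_map negb a) i)) (cob_out X).

Lemma bentl i : bent (catl b (cast_ord (esym (size_map negb a)) i)) = cob_in X i.
Proof. by rewrite /bent cat_funl cast_ordKV. Qed.

Lemma bentr j : bent (catr (map negb a) j) = cob_out X j.
Proof. by rewrite /bent cat_funr. Qed.

Lemma bent_inj : injective bent.
Proof.
move=> i j; rewrite /bent; case: (cat_ordP i) => {}i; case: (cat_ordP j) => {}j;
  rewrite ?(cat_funl, cat_funr).
- by move=> /cob_in_inj/cast_ord_inj ->.
- by move=> /cob_in_out.
- by move=> /esym/cob_in_out.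
- by move=> /cob_out_inj ->.
Qed.

Lemma bent_sign (i : 'I_(size (map negb a ++ b))) :
  boundary (~~ nth true (map negb a ++ b) i) (bent i).
Proof.
rewrite /bent; case: (cat_ordP i) => {}i; rewrite ?(cat_funl, cat_funr).
  rewrite nth_catl (nth_map true) ?negbK; first exact: cob_in_sign.
  by rewrite -(size_map negb a).
by rewrite nth_catr; exact: cob_out_sign.
Qed.

Lemma bent_boundary s (x : X) : boundary s x -> exists i, x = bent i.
Proof.
move=> /cob_boundary[[i ->]|[j ->]].
  by exists (catl b (cast_ord (esym (size_map negb a)) i)); rewrite bentl.
by exists (catr (map negb a) j); rewrite bentr.
Qed.

Definition bend_out : cobordism R [::] (map negb a ++ b).
Proof.
refine (@Cobordism R [::] (map negb a ++ b) X (@no_point X) bent _ bent_inj _ _ bent_sign _).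
- by move=> [].
- by move=> [].
- by move=> [].
- by move=> s x /bent_boundary; right.
Defined.

(** Reading the bent points as ingoing flips the required signs, hence the opposite orientation. *)
Definition bend_in : cobordism R (map negb a ++ b) [::].
Proof.
refine (@Cobordism R (map negb a ++ b) [::] (rev_manifold X) bent (@no_point X)
  bent_inj _ _ _ _ _).
- by move=> [].
- by move=> ? [].
- by move=> i; apply/rev_boundary; exact: bent_sign.
- by move=> [].
- by move=> s x /rev_boundary/bent_boundary; left.
Defined.

End Bending.

(** * Clopen subsets of sums and gluings *)

Section Clopens.
Context {R : realType}.

(** In a compact Hausdorff space this means lying in the same component; the form with clopen sets
    passes directly through continuous maps and gluings. *)
Definition inseparable (T : topologicalType) (x y : T) : Prop :=
  forall U, clopen U -> U x <-> U y.

Lemma inseparable_sym (T : topologicalType) (x y : T) :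
  inseparable x y -> inseparable y x.
Proof. by move=> xy U cU; split=> Ux; apply/(xy U cU). Qed.

Lemma inseparable_trans (T : topologicalType) (x y z : T) :
  inseparable x y -> inseparable y z -> inseparable x z.
Proof. by move=> xy yz U cU; rewrite (xy U cU); exact: yz. Qed.

Lemma inseparable_map (T S : topologicalType) (f : T -> S) (x y : T) :
  continuous f -> inseparable x y -> inseparable (f x) (f y).
Proof. by move=> cf xy U cU; apply: (xy (f @^-1` U)); exact: preimage_clopen. Qed.

(** The inverse of the chart is a curve through all points of the interval. *)
Lemma interval_inseparable (t u : @unit_interval R) : inseparable t u.
Proof.
suff H (v w : @oriented_interval R true) (U : set (@oriented_interval R true)) :
    clopen U -> U v -> U w by move=> U cU; split; exact: (H _ _ U).
move=> cU; pose c : chart R (@oriented_interval R true) := interval_chart true.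
have ac : atlas c by [].
have cov : chart_covers (M := @oriented_interval R true) c 0 1.
  move=> r r01; have mr : r \in (`[0, 1]%classic : set R) by rewrite inE /= in_itv.
  by exists (exist _ r mr).
pose o : @oriented_interval R true := I0; have cc := curve_chart_inv o ac cov.
have K (x : @oriented_interval R true) : chart_inv c o (\val x) = x.
  exact: (chart_invK o ac (I : cdom c x)).
rewrite -[v]K -[w]K; apply: (curve_clopen cc cU); exact: interval_val01.
Qed.

Lemma sum_clopen (I : finType) (M : I -> manifold R) (U : set (sum_manifold M)) :
  (forall i, clopen (existT (fun i => M i) i @^-1` U)) -> clopen U.
Proof.
move=> cU; split; first by apply/sigT_openP => i; have [] := cU i.
rewrite -[U]setCK; apply: open_closedC; apply/sigT_openP => i.
by have [_ /closed_openC] := cU i.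
Qed.

Lemma sum_inseparable (I : finType) (M : I -> manifold R) i (x y : M i) :
  inseparable x y -> inseparable (existT (fun i => M i) i x : sum_manifold M) (existT _ i y).
Proof. by apply: inseparable_map; exact: existT_continuous. Qed.

Section Glue.
Context (a b c : seq bool) (K : cobordism R a b) (L : cobordism R b c).

Lemma glue_eq j : gluel L (cob_out K j) = gluer K (cob_in L j).
Proof. by apply/gluelrP; exists j. Qed.

(** Openness in the glued space is tested on the two parts, and agreement at the seam lets the union
    restrict to exactly [A] and [B]. *)
Lemma glue_clopen (A : set K) (B : set L) : clopen A -> clopen B ->
  (forall j, A (cob_out K j) <-> B (cob_in L j)) ->
  exists U : set (cob_comp K L), [/\ clopen U,
    forall x, U (gluel L x) <-> A x & forall y, U (gluer K y) <-> B y].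
Proof.
move=> [oA cA] [oB cB] AB.
pose U : set (cob_comp K L) := [set p | (exists2 x, A x & gluel L x = p) \/
  (exists2 y, B y & gluer K y = p)].
have Ul x : U (gluel L x) <-> A x.
  split=> [[[z Az /gluel_inj <-]//|[y By /esym/gluelrP[j [-> e]]]]|Ax].
    by apply/AB; rewrite -e.
  by left; exists x.
have Ur y : U (gluer K y) <-> B y.
  split=> [[[x Ax /gluelrP[j [e ->]]]|[z Bz /gluer_inj <-]//]|By].
    by apply/AB; rewrite -e.
  by right; exists y.
exists U; split=> //; split.
  apply/glue_openP; split.
    by rewrite (_ : _ @^-1` U = A) //; apply/seteqP; split=> x /Ul.
  by rewrite (_ : _ @^-1` U = B) //; apply/seteqP; split=> x /Ur.
rewrite -[U]setCK; apply: open_closedC; apply/glue_openP; split.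
  rewrite (_ : _ @^-1` (~` U) = ~` A); first exact: closed_openC.
  by apply/seteqP; split=> x /= nU /Ul.
rewrite (_ : _ @^-1` (~` U) = ~` B); first exact: closed_openC.
by apply/seteqP; split=> x /= nU /Ur.
Qed.

Lemma glue_ext (U V : set (cob_comp K L)) :
  (forall x, U (gluel L x) <-> V (gluel L x)) ->
  (forall y, U (gluer K y) <-> V (gluer K y)) -> U = V.
Proof.
move=> l r; apply/seteqP; split=> p; case: (glue_cover p) => -[x ->];
  by [move/l|move/r].
Qed.

End Glue.

Section Strands.
Context (a b : seq bool) (f : 'I_(size a) -> 'I_(size b)) (g : 'I_(size b) -> 'I_(size a))
  (fK : cancel f g) (gK : cancel g f)
  (fs : forall i : 'I_(size a), nth true b (f i) = nth true a i).
Let S := strands (R := R) fK gK fs.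

Lemma strands_inseparable i t u :
  @inseparable S (existT _ i t) (existT _ i u).
Proof. by apply: sum_inseparable; exact: interval_inseparable. Qed.

Lemma strands_clopen (P : set 'I_(size a)) :
  clopen ([set x | P (projT1 x)] : set S).
Proof.
apply: sum_clopen => i.
have [Pi|Pi] := pselect (P i).
  by rewrite (_ : _ @^-1` _ = setT); [exact: clopenT|apply/seteqP; split].
by rewrite (_ : _ @^-1` _ = set0); [exact: clopen0|apply/seteqP; split].
Qed.

End Strands.

Lemma tensorl_continuous a b c d (K : cobordism R a b) (L : cobordism R c d) :
  continuous (fun x : K => tensorl L x).
Proof. by apply/continuousP => U /sigT_openP /(_ false). Qed.

Lemma tensorr_continuous a b c d (K : cobordism R a b) (L : cobordism R c d) :
  continuous (fun y : L => tensorr K y).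
Proof. by apply/continuousP => U /sigT_openP /(_ true). Qed.

End Clopens.

(** * Numbers of clopen subsets and of circles *)

Section ClopenCount.
Context {R : realType}.

Lemma card_strand_closed k : #|strand [::] [::] k| = k.
Proof.
rewrite card_sum card_ord card_sig eq_card0 ?addn0 //.
by move=> [[]|[]].
Qed.

Lemma card_set_strand_closed k : #|{: {set strand [::] [::] k}}| = (2 ^ k)%N.
Proof. by rewrite -cardsT -powersetT card_powerset cardsT card_strand_closed. Qed.

Section Count.
Context (a b : seq bool) (X Y : cobordism R a b) (D : cobordism R [::] [::]).
Context (kX kY kD : nat) (gX : strand a b kX -> R -> X) (gY : strand a b kY -> R -> Y).
Context (gD : strand [::] [::] kD -> R -> D).
Context (cX : label a b -> strand a b kX) (cY : label a b -> strand a b kY).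
Context (cD : label [::] [::] -> strand [::] [::] kD).
Hypotheses (nX : normal_form gX cX) (nY : normal_form gY cY) (nD : normal_form gD cD).
Context (iX : X -> D) (iY : Y -> D).
Hypotheses (coX : continuous iX) (coY : continuous iY).
Hypothesis same_trace : forall l, inseparable (iX (bpt X l)) (iY (bpt Y l)).
Hypothesis separating : forall U V, clopen U -> clopen V ->
  (forall x, U (iX x) <-> V (iX x)) -> (forall y, U (iY y) <-> V (iY y)) -> U = V.
Hypothesis lifting : forall A B, clopen A -> clopen B ->
  (forall l, A (bpt X l) <-> B (bpt Y l)) ->
  exists U, [/\ clopen U, forall x, U (iX x) <-> A x & forall y, U (iY y) <-> B y].

(** The hypotheses say that, for clopen subsets, [D] is [X] and [Y] glued along their boundary, even
    if it contains further cylinders. Restriction to both parts is then a bijection onto the pairs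
    with equal traces. *)
Lemma clopen_count : (2 ^ kD)%N = npairs cX cY.
Proof.
have /choice[F hF] (S : {set strand [::] [::] kD}) :
    exists P : {set strand a b kX} * {set strand a b kY},
      iX @^-1` clopen_of gD S = clopen_of gX P.1 /\
      iY @^-1` clopen_of gD S = clopen_of gY P.2.
  have cS := clopen_of_clopen nD S.
  have [P1 e1] := clopen_of_surj nX (preimage_clopen cS coX).
  have [P2 e2] := clopen_of_surj nY (preimage_clopen cS coY).
  by exists (P1, P2).
rewrite -card_set_strand_closed.
have Fi : injective F.
  move=> S S' e; apply: (clopen_of_inj nD); have [e1 e2] := hF S.
  have [e3 e4] := hF S'; rewrite -e -e1 in e3; rewrite -e -e2 in e4.
  apply: separating; [exact: clopen_of_clopen nD _|exact: clopen_of_clopen nD _| |].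
    by move=> x; rewrite -[_ (iX x)]/((iX @^-1` clopen_of gD S) x) -e3.
  by move=> y; rewrite -[_ (iY y)]/((iY @^-1` clopen_of gD S) y) -e4.
rewrite -cardsT -(card_imset _ Fi); apply: eq_card => P; rewrite inE.
apply/imsetP/eqP => [[S _ ->]|tP].
  apply/ffunP => l; rewrite !ffunE; have [e1 e2] := hF S.
  apply/idP/idP => [/(clopen_of_bpt nX)|/(clopen_of_bpt nY)].
    rewrite -e1 => /(same_trace l (clopen_of_clopen nD S)) h.
    by apply/(clopen_of_bpt nY); rewrite -e2.
  rewrite -e2 => /(same_trace l (clopen_of_clopen nD S)) h.
  by apply/(clopen_of_bpt nX); rewrite -e1.
have [|U [cU UX UY]] := lifting (clopen_of_clopen nX P.1) (clopen_of_clopen nY P.2).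
  move=> l; rewrite (clopen_of_bpt nX) (clopen_of_bpt nY).
  by have := congr1 (fun f : {ffun _ -> _} => f l) tP; rewrite !ffunE => ->.
have [S US] := clopen_of_surj nD cU; exists S => //.
have [e1 e2] := hF S; rewrite [P]surjective_pairing [F S]surjective_pairing.
congr pair.
  apply: (clopen_of_inj nX); rewrite -e1 -US.
  by apply/seteqP; split=> x /UX.
apply: (clopen_of_inj nY); rewrite -e2 -US.
by apply/seteqP; split=> y /UY.
Qed.

End Count.

(** Without boundary every pair of clopen subsets has equal traces, so the numbers of clopen subsets
    multiply and the exponents add. *)
Lemma closed_comp_circles (K L : cobordism R [::] [::]) k g c k' g' c' n h d :
  @normal_form R _ _ K k g c -> @normal_form R _ _ L k' g' c' ->
  @normal_form R _ _ (cob_comp K L) n h d -> n = (k + k')%N.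
Proof.
move=> nK nL nD.
have : (2 ^ n)%N = npairs c c'.
  pose iX : K -> cob_comp K L := gluel L; pose iY : L -> cob_comp K L := fun y => gluer K y.
  apply: (clopen_count nK nL nD (iX := iX) (iY := iY)).
  - exact: gluel_continuous.
  - exact: gluer_continuous.
  - by move=> [[]|[]].
  - by move=> U V _ _; exact: glue_ext.
  - by move=> A B cA cB _; apply: glue_clopen => // -[].
have -> : npairs c c' = (2 ^ (k + k'))%N.
  rewrite /npairs eq_cardT => [|P]; last by rewrite inE; apply/eqP/ffunP => -[[]|[]].
  by rewrite -cardT card_prod !card_set_strand_closed expnD.
by move/eqP; rewrite eqn_exp2l // => /eqP.
Qed.

Section Connected.
Context (a b : seq bool) (K : cobordism R a b) (k : nat) (g : strand a b k -> R -> K).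
Context (c : label a b -> strand a b k).
Hypothesis (nK : normal_form g c) (coK : forall x y : K, inseparable x y).

Lemma connected_strand (i j : strand a b k) : i = j.
Proof.
have in0 := @in01_0 R; have cj := clopen_of_clopen nK (finset.set1 j).
have : clopen_of g (finset.set1 j) (g j 0).
  by apply/(clopen_ofP nK j _ in0); rewrite finset.in_set1.
move=> /(coK (g j 0) (g i 0) cj)/(clopen_ofP nK i _ in0).
by rewrite finset.in_set1 => /eqP.
Qed.

Lemma connected_no_circle (l : label a b) : k = 0%N.
Proof.
have [m _] := comp_arc nK l; case: k (@connected_strand) m => // n h m.
by have := h (inl ord0) (inr m).
Qed.

End Connected.

(** The label [l] provides a boundary point, hence an arc; connectedness leaves no other strand, so
    both maps to the strands are forced. *)
Lemma connected_equiv a b (l : label a b) (K L : cobordism R a b) :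
  (forall x y : K, inseparable x y) -> (forall x y : L, inseparable x y) ->
  cob_equiv K L.
Proof.
move=> cK cL; have [k [g [c nK]]] := normal_form_exists K.
have [k' [h [d nL]]] := normal_form_exists L.
have k0 := connected_no_circle nK cK l; have k'0 := connected_no_circle nL cL l; subst k k'.
have e : c = d by apply: functional_extensionality_dep => m; exact: connected_strand nK cK _ _.
by subst d; exact: normal_form_equiv nK nL.
Qed.

(** The point [x] excludes the empty manifold. *)
Lemma closed_connected_circles (K : cobordism R [::] [::]) k g c (x : K) :
  @normal_form R _ _ K k g c -> (forall x y : K, inseparable x y) -> k = 1%N.
Proof.
move=> nK cK; have [_ /(_ x)[j [t _]] _] := nf_decomposition nK.
rewrite -[RHS](card1 j) -{1}(card_strand_closed k); apply: eq_card => i.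
by rewrite !inE (connected_strand nK cK i j) eqxx.
Qed.

End ClopenCount.

(** * The closure of two parallel cobordisms *)

Section Closure.
Context {R : realType} (a b : seq bool) (X Y : cobordism R a b).

Definition closure_strands :=
  cob_comp (bend_out (cob_id (R := R) a)) (cob_tensor (cob_id (map negb a)) Y).

(* The closed manifold glued from [Y] and the reversal of [X] along their
   common boundary, written with [Y] in the middle so that its image under a
   functor only depends on that of [Y]. *)
Definition cob_closure : cobordism R [::] [::] := cob_comp closure_strands (bend_in X).

Let M := bend_out (cob_id (R := R) a).
Let T := cob_tensor (cob_id (R := R) (map negb a)) Y.
Let B := bend_in X.

(** The parts of the closure: [X], the bent cylinders [M], and [T], made of the straight cylinders
    and [Y]. *)
Let ic (x : X) : cob_closure := gluer closure_strands (x : B).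
Let im (x : M) : cob_closure := gluel B (gluel T x : closure_strands).
Let iT (x : T) : cob_closure := gluel B (gluer M x : closure_strands).
Let il (x : cob_id (map negb a)) : cob_closure := iT (tensorl Y x).
Let ir (y : Y) : cob_closure := iT (tensorr (cob_id (map negb a)) y).

Let im_cont : continuous im.
Proof.
move=> x; apply: (@continuous_comp _ _ _ (gluel T : M -> closure_strands) (gluel B)).
  exact: gluel_continuous.
exact: gluel_continuous.
Qed.

Let iT_cont : continuous iT.
Proof.
move=> x; apply: (@continuous_comp _ _ _ (fun x : T => gluer M x : closure_strands) (gluel B)).
  exact: gluer_continuous.
exact: gluel_continuous.
Qed.

Let il_cont : continuous il.
Proof. by move=> x; apply: continuous_comp; [exact: tensorl_continuous|exact: iT_cont]. Qed.

Let ir_cont : continuous ir.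
Proof. by move=> x; apply: continuous_comp; [exact: tensorr_continuous|exact: iT_cont]. Qed.

Let neg (i : 'I_(size a)) : 'I_(size (map negb a)) := cast_ord (esym (size_map negb a)) i.
Let unneg (i : 'I_(size (map negb a))) : 'I_(size a) := cast_ord (size_map negb a) i.

(** This and the next three identities are the seams: from an ingoing point of [Y] the way through
    [M] and a straight cylinder leads to the corresponding point of [X], while outgoing points of
    [Y] and [X] are glued directly. *)
Let il_out i : il (existT _ i I1) = ic (cob_in X (unneg i)).
Proof.
have -> : cob_in X (unneg i) = cob_in B (catl b i) by rewrite /= /bent cat_funl.
rewrite /ic -glue_eq /il /iT; congr gluel.
rewrite -[cob_out _ _]/(gluer M (cob_out T (catl b i))); congr gluer.
by rewrite -[cob_out _ _]/(tensor_out _ _ _) /tensor_out cat_funl.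
Qed.

Let il_in i : il (existT _ i I0) = im (existT _ (unneg i) I0).
Proof.
rewrite /il /im /iT; congr gluel.
have -> : tensorl Y (existT _ i I0 : cob_id (map negb a)) = cob_in T (catl a i).
  by rewrite -[cob_in T _]/(tensor_in _ _ _) /tensor_in cat_funl.
rewrite -glue_eq; congr gluel.
by rewrite -[cob_out _ _]/(bent _ _) /bent cat_funl.
Qed.

Let im_out i : im (existT _ i I1) = ir (cob_in Y i).
Proof.
rewrite /ir /im /iT; congr gluel.
have -> : tensorr (cob_id (map negb a)) (cob_in Y i) = cob_in T (catr (map negb a) i).
  by rewrite -[cob_in T _]/(tensor_in _ _ _) /tensor_in cat_funr.
rewrite -glue_eq; congr gluel.
by rewrite -[cob_out _ _]/(bent _ _) /bent cat_funr.
Qed.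

Let ir_out j : ir (cob_out Y j) = ic (cob_out X j).
Proof.
have -> : cob_out X j = cob_in B (catr (map negb a) j) by rewrite /= /bent cat_funr.
rewrite /ic -glue_eq /ir /iT; congr gluel.
rewrite -[cob_out closure_strands _]/(gluer M (cob_out T (catr (map negb a) j))); congr gluer.
by rewrite -[cob_out T _]/(tensor_out _ _ _) /tensor_out cat_funr.
Qed.

Let il_ic i t : inseparable (il (existT _ i t)) (ic (cob_in X (unneg i))).
Proof. by rewrite -il_out; apply: (inseparable_map il_cont); exact: strands_inseparable. Qed.

Let im_ic i t : inseparable (im (existT _ i t)) (ic (cob_in X i)).
Proof.
apply: (@inseparable_trans _ _ (im (existT _ i I0))).
  by apply: (inseparable_map im_cont); exact: strands_inseparable.
by have := @il_ic (neg i) I0; rewrite il_in /unneg /neg cast_ordKV.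
Qed.

Lemma closure_count kX kY kD gX gY gD cX cY cD :
  @normal_form R a b X kX gX cX -> @normal_form R a b Y kY gY cY ->
  @normal_form R _ _ cob_closure kD gD cD -> (2 ^ kD)%N = npairs cX cY.
Proof.
move=> nX nY nD; apply: (clopen_count nX nY nD (iX := ic) (iY := ir)).
- exact: (@gluer_continuous _ _ _ _ closure_strands B).
- exact: ir_cont.
- case=> [i|j] /=; last by rewrite ir_out => U.
  by apply: inseparable_sym; rewrite -im_out; exact: im_ic.
(* A clopen set cannot separate a cylinder from the point of [X] to which it leads, so its traces on
   [X] and [Y] determine it. *)
- move=> U V cU cV hX hY; apply: glue_ext; last exact: hX.
  move=> p; case: (glue_cover p) => -[q ->].
    case: q => i t; rewrite -[gluel _ _]/(im (existT _ i t)).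
    by rewrite (im_ic t cU) (im_ic t cV).
  case: q => -[] q; first exact: hY.
  case: q => i t; rewrite -[gluel _ _]/(il (existT _ i t)).
  by rewrite (il_ic t cU) (il_ic t cV).
move=> A Bs cA cB AB.
(* On the cylinders the clopen set is prescribed by the ingoing points of [X] to which they lead. *)
pose TB : set T := [set p | match p :
    {t : bool & (if t then Y : manifold R else cob_id (map negb a) : manifold R)} with
  | existT true y => Bs y | existT false x => A (cob_in X (unneg (projT1 x))) end].
have cTB : clopen TB.
  apply: sum_clopen => -[]; first exact: cB.
  exact: (strands_clopen _ _ _ (fun i => A (cob_in X (unneg i)))).
have cMA : clopen ([set x | A (cob_in X (projT1 x))] : set M).
  exact: (strands_clopen _ _ _ (fun i => A (cob_in X i))).
have [|U1 [cU1 U1l U1r]] := glue_clopen (K := M) (L := T) cMA cTB.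
  move=> j; rewrite -[cob_in T j]/(tensor_in _ _ _) -[cob_out M j]/(bent _ _).
  rewrite /bent /tensor_in; case: (cat_ordP j) => i; rewrite !(cat_funl, cat_funr) //=.
  exact: (AB (inl i)).
have [|U [cU Ul Ur]] := glue_clopen (K := closure_strands) (L := B) cU1 cA.
  move=> j; rewrite -[cob_out _ _]/(gluer M (cob_out T j)) U1r.
  rewrite -[cob_out T j]/(tensor_out _ _ _) -[cob_in B j]/(bent _ _).
  rewrite /bent /tensor_out; case: (cat_ordP j) => i; rewrite !(cat_funl, cat_funr) //=.
  by split=> /(AB (inr i)).
exists U; split=> //.
by move=> y; rewrite /ir /iT Ul U1r.
Qed.

End Closure.

(** * Values on closed manifolds *)

Section Snake.
Context {R : realType}.

Definition cup : cobordism R [::] [:: false; true] := bend_out (cob_id [:: true]).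
Definition cap : cobordism R [:: true; false] [::] := bend_in (cob_id [:: false]).

Definition circle : cobordism R [::] [::] :=
  cob_comp (cob_comp cup (cob_sym [:: false] [:: true])) cap.

Definition zigzag_in : cobordism R [:: true] [:: true; false; true] :=
  cob_tensor (cob_id [:: true]) cup.
Definition zigzag_out : cobordism R [:: true; false; true] [:: true] :=
  cob_tensor cap (cob_id [:: true]).

Definition zigzag : cobordism R [:: true] [:: true] := cob_comp zigzag_in zigzag_out.

Lemma cob_id1_connected s (x y : cob_id (R := R) [:: s]) : inseparable x y.
Proof.
by case: x y => i t [j u]; rewrite (ord1 i) (ord1 j) in t u *; exact: strands_inseparable.
Qed.

Lemma circle_connected (x y : circle) : inseparable x y.
Proof.
pose S : cobordism R [:: false; true] [:: true; false] := cob_sym [:: false] [:: true].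
pose G := cob_comp cup S.
pose iu (p : cup) : circle := gluel cap (gluel S p : G).
pose im (p : S) : circle := gluel cap (gluer cup p : G).
pose ia (p : cap) : circle := gluer G p.
have cu : continuous iu.
  move=> p; apply: (@continuous_comp _ _ _ (gluel S : cup -> G) (gluel cap)).
    exact: gluel_continuous.
  exact: gluel_continuous.
have cs : continuous im.
  move=> p; apply: (@continuous_comp _ _ _ (fun p : S => gluer cup p : G) (gluel cap)).
    exact: gluer_continuous.
  exact: gluel_continuous.
pose o : circle := iu (existT _ ord0 I0).
have uo p : inseparable (iu p) o.
  by apply: (inseparable_map cu); exact: (@cob_id1_connected true).
have so p : inseparable (im p) o.
  case: p => i t; apply: (@inseparable_trans _ _ (im (cob_in S i))).
    by apply: (inseparable_map cs); exact: strands_inseparable.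
  by rewrite /im -glue_eq; exact: uo.
have ao p : inseparable (ia p) o.
  apply: (@inseparable_trans _ _ (ia (cob_in cap ord0))).
    apply: (inseparable_map (@gluer_continuous _ _ _ _ G cap)).
    exact: (@cob_id1_connected false).
  by rewrite /ia -glue_eq; exact: so.
suff H z : inseparable z o by apply: inseparable_trans (H x) (inseparable_sym (H y)).
case: (glue_cover z) => -[p ->]; last exact: ao.
by case: (glue_cover p) => -[q ->]; [exact: uo|exact: so].
Qed.

Lemma zigzag_connected (x y : zigzag) : inseparable x y.
Proof.
pose i1 (p : cob_id [:: true]) : zigzag := gluel zigzag_out (tensorl cup p : zigzag_in).
pose iu (p : cup) : zigzag := gluel zigzag_out (tensorr (cob_id [:: true]) p : zigzag_in).
pose ia (p : cap) : zigzag := gluer zigzag_in (tensorl (cob_id [:: true]) p : zigzag_out).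
pose i2 (p : cob_id [:: true]) : zigzag := gluer zigzag_in (tensorr cap p : zigzag_out).
have c1 : continuous i1.
  by move=> p; apply: continuous_comp; [exact: tensorl_continuous|exact: gluel_continuous].
have cu : continuous iu.
  by move=> p; apply: continuous_comp; [exact: tensorr_continuous|exact: gluel_continuous].
have ca : continuous ia.
  by move=> p; apply: continuous_comp; [exact: tensorl_continuous|exact: gluer_continuous].
have c2 : continuous i2.
  by move=> p; apply: continuous_comp; [exact: tensorr_continuous|exact: gluer_continuous].
have k1 p q : inseparable (i1 p) (i1 q).
  by apply: (inseparable_map c1); exact: cob_id1_connected.
have ku p q : inseparable (iu p) (iu q).
  by apply: (inseparable_map cu); exact: (@cob_id1_connected true).
have ka p q : inseparable (ia p) (ia q).
  by apply: (inseparable_map ca); exact: (@cob_id1_connected false).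
have k2 p q : inseparable (i2 p) (i2 q).
  by apply: (inseparable_map c2); exact: cob_id1_connected.
pose a0 := cob_in cap ord0.
(* The three middle points are indexed through two different splittings of the word; only the
   positions have to agree. *)
have E (i j : 'I_(size [:: true; false; true])) : val i = val j ->
    gluel zigzag_out (cob_out zigzag_in i) = gluer zigzag_in (cob_in zigzag_out j).
  by move=> ij; rewrite -(val_inj ij); exact: glue_eq.
have o1 (i : 'I_(size [:: true])) : cob_out zigzag_in (@catl [:: true] [:: false; true] i) =
    tensorl cup (cob_out (cob_id [:: true]) i) by exact: cat_funl.
have ou (i : 'I_(size [:: false; true])) :
    cob_out zigzag_in (@catr [:: true] [:: false; true] i) =
    tensorr (cob_id [:: true]) (cob_out cup i) by exact: cat_funr.
have oa (i : 'I_(size [:: true; false])) :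
    cob_in zigzag_out (@catl [:: true; false] [:: true] i) =
    tensorl (cob_id [:: true]) (cob_in cap i) by exact: cat_funl.
have o2 (i : 'I_(size [:: true])) : cob_in zigzag_out (@catr [:: true; false] [:: true] i) =
    tensorr cap (cob_in (cob_id [:: true]) i) by exact: cat_funr.
have e0 : i1 (cob_out (cob_id [:: true]) ord0) = ia a0.
  by rewrite /i1 -o1 /ia -oa; exact: E.
have e1 : iu (cob_out cup ord0) = ia (cob_in cap (lift ord0 ord0)).
  by rewrite /iu -ou /ia -oa; exact: E.
have e2 : iu (cob_out cup (lift ord0 ord0)) = i2 (cob_in (cob_id [:: true]) ord0).
  by rewrite /iu -ou /i2 -o2; exact: E.
have l1 p : inseparable (i1 p) (ia a0) by rewrite -e0; exact: k1.
have lu p : inseparable (iu p) (ia a0).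
  by apply: inseparable_trans (ku p (cob_out cup ord0)) _; rewrite e1; exact: ka.
have l2 p : inseparable (i2 p) (ia a0).
  by apply: inseparable_trans (k2 p (cob_in (cob_id [:: true]) ord0)) _; rewrite -e2; exact: lu.
suff H z : inseparable z (ia a0) by apply: inseparable_trans (H x) (inseparable_sym (H y)).
case: (glue_cover z) => -[[[] p] ->]; [exact: lu|exact: l1|exact: l2|exact: ka].
Qed.

(** Both sides are connected with nonempty boundary, so [connected_equiv] spares an explicit
    homeomorphism. *)
Lemma zigzag_id : cob_equiv zigzag (cob_id [:: true]).
Proof.
apply: (@connected_equiv R [:: true] [:: true] (inl ord0)); first exact: zigzag_connected.
exact: cob_id1_connected.
Qed.

End Snake.

(** * The zigzag identity for matrices *)

Section Trace.
Variable F : fieldType.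

Lemma sum_mxtens (m n : nat) (f : 'I_(m * n) -> F) :
  \sum_k f k = \sum_i \sum_j f (mxtens_index (i, j)).
Proof.
rewrite pair_big /= (reindex (@mxtens_index m n)) /=.
  by apply: eq_bigr => -[].
by exists (@mxtens_unindex m n) => i _; rewrite (mxtens_indexK, mxtens_unindexK).
Qed.

(* The zigzag identity says that the matrices with entries [A_(ij)] and
   [C_(ji)] are inverse to each other, and the circle is the trace of their
   product. *)
Lemma zigzag_trace (p q u m n t : nat) (eu : u = 1%N) (em : m = (q * p)%N)
    (en : n = (p * q)%N) (et1 : t = (p * m)%N) (et2 : t = (n * p)%N)
    (ep1 : p = (p * u)%N) (ep2 : p = (u * p)%N)
    (A : 'M[F]_(u, n)) (C : 'M[F]_(m, u)) (B1 : 'M[F]_(t, p)) (B2 : 'M[F]_(p, t))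
    (S : 'M[F]_(n, m)) :
  castmx (et1, ep1) B1 = tensmx 1%:M C -> castmx (ep2, et2) B2 = tensmx A 1%:M ->
  B2 *m B1 = 1%:M -> castmx (en, em) S = commutation_mx F q p ->
  A *m (S *m C) = (p%:R)%:M.
Proof.
subst u m n t => eB1 eB2 zz eS.
have B1E x y z l : B1 (mxtens_index (x, mxtens_index (y, z))) l =
    (x == l)%:R * C (mxtens_index (y, z)) ord0.
  have := congr1 (fun M : 'M[F]_(_, _) => M (mxtens_index (x, mxtens_index (y, z)))
    (mxtens_index (l, ord0))) eB1.
  rewrite tensmxE mxE castmxE => <-; congr (B1 _ _); first exact: val_inj.
  by apply: val_inj => /=; rewrite muln1 addn0.
have B2E i x y z : B2 i (mxtens_index (x, mxtens_index (y, z))) =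
    A ord0 (mxtens_index (x, y)) * (z == i)%:R.
  have := congr1 (fun M : 'M[F]_(_, _) => M (mxtens_index (ord0, i))
    (mxtens_index (mxtens_index (x, y), z))) eB2.
  rewrite tensmxE mxE castmxE (eq_sym z) => <-; congr (B2 _ _); first exact: val_inj.
  (* The two bracketings of the triple index give the same position. *)
  by apply: val_inj => /=; rewrite mulnDl mulnA addnA.
(* The diagonal entries of the zigzag identity. *)
have inv i : \sum_y A ord0 (mxtens_index (i, y)) * C (mxtens_index (y, i)) ord0 = 1.
  have := congr1 (fun M : 'M[F]_(_, _) => M i i) zz.
  rewrite !mxE eqxx mulr1n => <-; rewrite sum_mxtens (bigD1 i) //= [X in _ + X]big1 ?addr0.
    rewrite sum_mxtens; apply: eq_bigr => y _; rewrite (bigD1 i) //= big1 ?addr0.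
      by rewrite B1E B2E !eqxx mulr1 mul1r.
    by move=> z /negPf zi; rewrite B2E zi mulr0 mul0r.
  by move=> x /negPf xi; apply: big1 => s _; case: (mxtens_indexP s) => y z;
    rewrite B1E xi mul0r mulr0.
have SE i j k l : S (mxtens_index (i, j)) (mxtens_index (k, l)) =
    ((i == l) && (j == k))%:R.
  have := congr1 (fun M : 'M[F]_(_, _) => M (mxtens_index (i, j)) (mxtens_index (k, l))) eS.
  by rewrite castmxE [RHS]mxE !mxtens_indexK /= => <-; congr (S _ _); exact: val_inj.
apply/matrixP => i j; rewrite [i]ord1 [j]ord1 !mxE eqxx mulr1n sum_mxtens.
(* [p] is written as a sum of ones, each of which is an instance of [inv]. *)
rewrite -[RHS]mulr1 -[in RHS](card_ord p) -sumr_const mulr_suml.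
apply: eq_bigr => x _; rewrite mul1r -[RHS](inv x); apply: eq_bigr => y _.
congr (_ * _); rewrite mxE sum_mxtens (bigD1 y) //= [X in _ + X]big1 ?addr0.
  rewrite (bigD1 x) //= big1 ?addr0 => [|z /negPf zx].
    by rewrite SE !eqxx mul1r.
  by rewrite SE eq_sym zx mul0r.
by move=> w /negPf wy; apply: big1 => z _; rewrite SE (eq_sym y) wy andbF mul0r.
Qed.

End Trace.

(** * Values of the functor and faithfulness *)

Section Tqft.
Context {R : realType} {F : fieldType} (T : strict_tqft R F).

Local Notation "T[ K ]" := (tqft_mor T (cob_class K)) (format "T[ K ]").

Lemma tqft_equiv a b (K L : cobordism R a b) : cob_equiv K L -> T[K] = T[L].
Proof. by move=> /eq_cob_class ->. Qed.

Lemma tqft_tensorr a b c d (K : cobordism R a b) (L L' : cobordism R c d) :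
  T[L] = T[L'] -> T[cob_tensor K L] = T[cob_tensor K L'].
Proof.
move=> e; apply: (can_inj (castmxK (tqft_cat T b d) (tqft_cat T a c))).
by rewrite !tqft_tensor e.
Qed.

Lemma tqft_circle : T[circle] = ((tqft_ob T [:: true])%:R)%:M.
Proof.
rewrite tqft_comp tqft_comp.
have hi : castmx (tqft_cat T [:: true] [:: false; true], tqft_cat T [:: true] [::])
    T[zigzag_in] = tensmx 1%:M T[cup] by rewrite -tqft_id; exact: tqft_tensor.
have ho : castmx (tqft_cat T [::] [:: true], tqft_cat T [:: true; false] [:: true])
    T[zigzag_out] = tensmx T[cap] 1%:M by rewrite -tqft_id; exact: tqft_tensor.
have hz : T[zigzag_out] *m T[zigzag_in] = 1%:M.
  by rewrite -tqft_comp (tqft_equiv zigzag_id) tqft_id.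
exact: (zigzag_trace (tqft_unit T) hi ho hz (tqft_sym T [:: false] [:: true])).
Qed.

Fixpoint circles (n : nat) : cobordism R [::] [::] :=
  if n is n'.+1 then cob_comp (circles n') circle else cob_id [::].

Lemma circles_normal_form n : exists g c, @normal_form R _ _ (circles n) n g c.
Proof.
elim: n => [|n [g [c nf]]].
  have [k [g [c nf]]] := normal_form_exists (circles 0).
  suff k0 : k = 0%N by subst k; exists g, c.
  (* A circle would provide a point of the empty manifold. *)
  by case: k g c nf => // k g _ _; case: (g (inl ord0) 0) => -[].
have [k [h [d nf']]] := normal_form_exists (circles n.+1).
have [k1 [h1 [d1 nf1]]] := normal_form_exists (circle (R := R)).
have x : circle (R := R) := gluer _ (existT _ ord0 I0 : cap).
have k1E := closed_connected_circles x nf1 (@circle_connected R); subst k1.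
have := closed_comp_circles nf nf1 nf'; rewrite addn1 => kE; subst k.
by exists h, d.
Qed.

(** A closed manifold has no boundary points to connect, so it is equivalent to [circles k], where
    the value is a product. *)
Lemma tqft_closed (K : cobordism R [::] [::]) k g c : @normal_form R _ _ K k g c ->
  T[K] = ((tqft_ob T [:: true])%:R ^+ k)%:M.
Proof.
have [h [d nf]] := circles_normal_form k => nK.
have e : c = d by apply: functional_extensionality_dep => -[[]|[]].
subst d; rewrite (tqft_equiv (normal_form_equiv nK nf)).
elim: k {K g c nK h nf} => [|n IH]; first by rewrite tqft_id expr0.
by rewrite /= tqft_comp IH tqft_circle -scalar_mxM exprS.
Qed.

Hypothesis charF : [pchar F] =i pred0.

Lemma tqft_closed_circles (K L : cobordism R [::] [::]) k g c k' h d :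
  (2 <= tqft_ob T [:: true])%N ->
  @normal_form R _ _ K k g c -> @normal_form R _ _ L k' h d ->
  T[K] = T[L] -> k = k'.
Proof.
move=> p2 /tqft_closed -> /tqft_closed ->.
(* The matrices have size [tqft_ob T [::]], only provably 1; the trace extracts their scalars
   without a cast. *)
move=> /(congr1 mxtrace); rewrite !mxtrace_scalar tqft_unit !mulr1n -!natrX => e.
apply/eqP; rewrite -(eqn_exp2l _ _ p2).
move: e; set x := (_ ^ k)%N; set y := (_ ^ k')%N.
wlog xy : x y / (x <= y)%N.
  by move=> H e; case: (leqP x y) => [/H|/ltnW/H]; [exact|rewrite eq_sym; exact].
move=> /esym/eqP; rewrite -subr_eq0 -natrB // ((pcharf0P F).1 charF) subn_eq0 => yx.
by rewrite eqn_leq xy.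
Qed.

Lemma tqft_faithful a b (K L : cobordism R a b) : (2 <= tqft_ob T [:: true])%N ->
  T[K] = T[L] -> cob_equiv K L.
Proof.
move=> p2 KL.
have [k [g [c nK]]] := normal_form_exists K.
have [l [h [d nL]]] := normal_form_exists L.
(* Closing [K] and [L] up with the same [X] gives equal values, hence equally many circles and
   clopen subsets. *)
have pairs X n f e : @normal_form R a b X n f e -> npairs e c = npairs e d.
  move=> nX; have [m [g1 [c1 n1]]] := normal_form_exists (cob_closure X K).
  have [m' [h1 [d1 n2]]] := normal_form_exists (cob_closure X L).
  rewrite -(closure_count nX nK n1) -(closure_count nX nL n2).
  congr (2 ^ _)%N; apply: tqft_closed_circles p2 n1 n2 _.
  by rewrite !tqft_comp (tqft_tensorr _ KL).
apply: (ntrace_equiv nK nL); apply: npairs_ntrace; first exact: pairs nK.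
(* For [X = L] the mixed count appears with its arguments exchanged. *)
rewrite -(pairs _ _ _ _ nL) !npairsE; apply: eq_bigr => v _; exact: mulnC.
Qed.

End Tqft.

End Faithfulness.

Theorem corollary4p4 (R : realType) (F : fieldType)
  (charF : [pchar F]%R =i pred0) (T : strict_tqft R F) (p : nat)
  (Tp : tqft_ob T [:: true] = p) (p2 : 2 <= p) :
  forall (a b : seq bool) (k l : cob_hom R a b),
    tqft_mor T k = tqft_mor T l -> k = l.
Proof.
move=> a b k l; have [K ->] := cob_classP k; have [L ->] := cob_classP l.
rewrite -Tp in p2; move=> KL; apply/eq_cob_class.
exact: (Faithfulness.tqft_faithful charF p2 KL).
Qed.
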